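(* Let $N\ge2$ be an integer, $\mu_0,\mu_1\in\mathcal P_2(\mathbb R^d)$, let $\gamma\in\Gamma(\mu_0,\mu_1)$ be $N$-cyclically monotone, and let $v_t$ be its velocity field. Then: (i) $\mathcal L(v_t|\gamma)=0$. (ii) $\gamma$ is its unique weak rectified coupling, i.e. $\mathcal R(\gamma)=\{\gamma\}$. (iii) If $\mu_0$ is absolutely continuous, then $\gamma$ is rectifiable and there exists a monotone map $u$ such that $\gamma=(\mathrm{Id},u)_\#\mu_0$.
   Context: $\mathcal P_2(\mathbb R^m)$ denotes Borel probability measures with finite second moment, and $\Gamma(\mu_0,\mu_1)$ is the set of $\gamma\in\mathcal P_2(\mathbb R^d\times\mathbb R^d)$ with first marginal $\mu_0$ and second marginal $\mu_1$. Absolute continuity is with respect to Lebesgue measure. A plan $\gamma$ is $N$-cyclically monotone if for all $(x^{(1)},y^{(1)}),\dots,(x^{(N)},y^{(N)})\in\mathrm{supp}(\gamma)$ and all permutations $\tau$ of $\{1,\dots,N\}$, $\sum_{i=1}^N\|x^{(i)}-y^{(i)}\|^2\le\sum_{i=1}^N\|x^{(i)}-y^{(\tau(i))}\|^2$. A map $u$ is monotone if $\langle u(x)-u(x'),x-x'\rangle\ge0$ for all $x,x'$ in its domain (not necessarily maximal monotone). For $\gamma\in\Gamma(\mu_0,\mu_1)$ the interpolation $\mu_t$ ($t\in[0,1]$) is the law of $(1-t)x+ty$ under $\gamma$. The flow matching loss is $\mathcal L(w_t|\gamma)=\int_0^1\int\|w_t((1-t)x+ty)-y+x\|^2\,d\gamma(x,y)\,dt$,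 for Borel vector fields $w:(t,x)\mapsto w_t(x)\in\mathbb R^d$ with $\int_0^1\int\|w_t\|^2d\mu_t\,dt<\infty$. The velocity field $v_t$ of $\gamma$ is the minimizer of $\mathcal L(\cdot|\gamma)$ over such fields; it is unique up to $\mu_t\otimes dt$-null sets. Weak rectified couplings: $\mathcal R(\gamma)$ is the set of all $\tilde\gamma$ for which there is a Borel probability measure $\Lambda$ on curves $\lambda:[0,1]\to\mathbb R^d$ (on $C([0,1];\mathbb R^d)$, concentrated on absolutely continuous curves) such that: (a) $\dot\lambda(t)=v_t(\lambda(t))$ for a.e. $t$ and $\Lambda$-a.e. $\lambda$; (b) $\int\psi\,d\mu_t=\int\psi(\lambda(t))\,d\Lambda(\lambda)$ for all $\psi\in C_c(\mathbb R^d)$ and all $t\in[0,1]$; (c) $\int\psi(x,y)\,d\tilde\gamma(x,y)=\int\psi(\lambda(0),\lambda(1))\,d\Lambda(\lambda)$ for all $\psi\in C_c^\infty(\mathbb R^d\times\mathbb R^d)$. $\gamma$ is rectifiable if (for a suitable Borel representative of $v_t$) the flow ODE $\partial_t\Phi_t(x)=v_t(\Phi_t(x))$, $\Phi_0(x)=x$, has a unique solution on $[0,1]$ for $\mu_0$-almost every $x$ (solutions being absolutely continuous curves satisfying the ODE for a.e. $t$). *)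

(* Defs.v *)
(* R^d is the type 'rV[R]_d of row vectors over R : realType. *)
From HB Require Import structures.
From mathcomp Require Import all_boot all_order all_algebra all_fingroup.
From mathcomp Require Import all_classical all_reals all_analysis.

Set Implicit Arguments.
Unset Strict Implicit.
Unset Printing Implicit Defensive.

Import Order.TTheory GRing.Theory Num.Theory.
Import numFieldNormedType.Exports.

Local Open Scope classical_set_scope.
Local Open Scope ring_scope.

(* The Borel sigma-algebra. On 'rV[R]_d * 'rV[R]_d the library takes the
   product sigma-algebra, which is the Borel one by second countability. *)
HB.instance Definition _ (R : realType) (m n : nat) :=
  @isMeasurable.Build (sigma_display (@open 'M[R]_(m, n))) 'M[R]_(m, n)
    <<s @open 'M[R]_(m, n) >> (@sigma_algebra0 _ setT _) (@sigma_algebraC _ _)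
    (@sigma_algebra_bigcup _ setT _).

Definition dot (R : realType) (d : nat) (x y : 'rV[R]_d) : R :=
  \sum_(i < d) x ord0 i * y ord0 i.

(* The Euclidean norm; the library norm `|x| on matrices is the sup norm. *)
Definition enorm (R : realType) (d : nat) (x : 'rV[R]_d) : R :=
  Num.sqrt (dot x x).

(* Lebesgue measure on R^d, for Borel sets: R^n.+1 = R * R^n carries the
   product of the one-dimensional measure and Lebesgue measure on R^n. *)
Fixpoint lebesgue (R : realType) (d : nat) : set 'rV[R]_d -> \bar R :=
  match d return set 'rV[R]_d -> \bar R with
  | 0%N => \d_(0 : 'rV[R]_0)
  | n.+1 => pushforward (lebesgue_measure \x @lebesgue R n)%E
      (fun p : measurableTypeR R * 'rV[R]_n =>
         (row_mx p.1%:M p.2 : 'rV[R]_(1 + n)))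
  end.

Section couplings.
Context (R : realType) (d : nat).
Local Notation Rd := 'rV[R]_d.
Implicit Types (mu : probability Rd R) (gam : probability (Rd * Rd)%type R).

Definition in_P2 mu : Prop := (\int[mu]_x (enorm x ^+ 2)%:E < +oo)%E.

Definition coupling (mu0 mu1 : probability Rd R) gam : Prop :=
  [/\ (\int[gam]_p (enorm p.1 ^+ 2 + enorm p.2 ^+ 2)%:E < +oo)%E,
      forall A, measurable A -> gam (A `*` setT) = mu0 A
    & forall B, measurable B -> gam (setT `*` B) = mu1 B].

Definition measure_support gam : set (Rd * Rd) :=
  [set p | forall U, open U -> U p -> (0 < gam U)%E].

Definition cyclically_monotone (N : nat) gam : Prop :=
  forall x y : 'I_N -> Rd, (forall i, measure_support gam (x i, y i)) ->
  forall tau : 'S_N,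
    \sum_(i < N) enorm (x i - y i) ^+ 2 <=
    \sum_(i < N) enorm (x i - y (tau i)) ^+ 2.

Definition interp (t : R) (p : Rd * Rd) : Rd := (1 - t) *: p.1 + t *: p.2.

Definition interpolation gam (t : R) : set Rd -> \bar R :=
  pushforward gam (interp t).

Definition flow_loss gam (w : R -> Rd -> Rd) : \bar R :=
  (\int[lebesgue_measure]_(t in `[0%R, 1%R]) \int[gam]_p
     (enorm (w t (interp t p) - p.2 + p.1) ^+ 2)%:E)%E.

Definition admissible_field gam (w : R -> Rd -> Rd) : Prop :=
  measurable_fun (`[0, 1]%classic `*` setT : set (measurableTypeR R * Rd))
    (fun q => w q.1 q.2) /\
  (\int[lebesgue_measure]_(t in `[0%R, 1%R]) \int[interpolation gam t]_x
     (enorm (w t x) ^+ 2)%:E < +oo)%E.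

(* v is a representative of the velocity field, which is unique only up to
   null sets of mu_t dt. *)
Definition velocity_field gam (v : R -> Rd -> Rd) : Prop :=
  admissible_field gam v /\
  forall w, admissible_field gam w -> (flow_loss gam v <= flow_loss gam w)%E.

End couplings.

Definition unit_itv (R : realType) : set R := `[0, 1]%classic.

(* C([0,1]; R^d) *)
Definition curve (R : realType) (d : nat) : Type :=
  continuousType (set_type (@unit_itv R)) 'rV[R]_d.

HB.instance Definition _ (R : realType) (d : nat) := Choice.on (curve R d).
HB.instance Definition _ (R : realType) (d : nat) :=
  isPointed.Build (curve R d) (cst (0 : 'rV[R]_d)).

Definition curve_open (R : realType) (d : nat) : set (set (curve R d)) :=
  @open (initial_topology
    (id : curve R d -> {uniform set_type (@unit_itv R) -> 'rV[R]_d})).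

(* The space of curves with its Borel sigma-algebra for uniform convergence. *)
Definition curve_space (R : realType) (d : nat) :=
  g_sigma_algebraType (@curve_open R d).

Section curves.
Context (R : realType) (d : nat).
Local Notation Rd := 'rV[R]_d.

(* The value at time t; only t in [0,1] is meaningful, the extension being
   constantly 0 outside. *)
Definition at_time (l : curve R d) (t : R) : Rd :=
  'valL_ 0 (l : set_type (@unit_itv R) -> Rd) t.

Definition abs_continuous (l : curve R d) : Prop :=
  forall e : R, 0 < e -> exists2 del : R, 0 < del &
  forall (n : nat) (a b : 'I_n -> R),
    (forall i, 0 <= a i /\ a i <= b i /\ b i <= 1) ->
    (forall i j, i != j -> b i <= a j \/ b j <= a i) ->
    \sum_(i < n) (b i - a i) < del ->
    \sum_(i < n) enorm (at_time l (b i) - at_time l (a i)) < e.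

Definition satisfies_ode (v : R -> Rd -> Rd) (l : curve R d) : Prop :=
  {ae lebesgue_measure, forall t : measurableTypeR R, 0 <= t <= 1 ->
    is_derive (t : R) (1 : R) (at_time l) (v t (at_time l t))}.

Definition ode_solution (v : R -> Rd -> Rd) (l : curve R d) : Prop :=
  abs_continuous l /\ satisfies_ode v l.

End curves.

Definition compactly_supported (R : realType) (V : topologicalType)
  (f : V -> R) : Prop := compact (closure [set x | f x != 0]).

(* C^n: in finite dimension, f is C^n.+1 iff it is differentiable with all
   its directional derivatives C^n. *)
Fixpoint of_class_C (R : realType) (V : normedModType R) (n : nat)
    (f : V -> R) : Prop :=
  match n with
  | 0%N => continuous f
  | k.+1 => (forall x, differentiable f x) /\ forall u, of_class_C k ('D_u f)
  end.

Definition smooth (R : realType) (V : normedModType R) (f : V -> R) : Prop :=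
  forall n, of_class_C n f.

Section rectified.
Context (R : realType) (d : nat).
Local Notation Rd := 'rV[R]_d.

(* gam' belongs to R(gam), with v the velocity field of gam. *)
Definition weak_rectified_coupling (gam : probability (Rd * Rd)%type R)
    (v : R -> Rd -> Rd) (gam' : probability (Rd * Rd)%type R) : Prop :=
  exists Lam : probability (curve_space R d) R,
    {ae Lam, forall l, abs_continuous l} /\
    [/\ {ae Lam, forall l, satisfies_ode v l},
        forall psi : Rd -> R, continuous psi -> compactly_supported psi ->
        forall t : R, 0 <= t <= 1 ->
          (\int[interpolation gam t]_x (psi x)%:E =
           \int[Lam]_l (psi (at_time l t))%:E)%E
      & forall psi : Rd * Rd -> R, smooth psi -> compactly_supported psi ->
          (\int[gam']_p (psi p)%:E =
           \int[Lam]_l (psi (at_time l 0, at_time l 1))%:E)%E].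

Definition rectifiable (mu0 : probability Rd R)
    (gam : probability (Rd * Rd)%type R) : Prop :=
  exists2 v : R -> Rd -> Rd, velocity_field gam v &
    {ae mu0, forall x, exists! l : curve R d,
      ode_solution v l /\ at_time l 0 = x}.

Definition monotone_map (D : set Rd) (u : Rd -> Rd) : Prop :=
  forall x x', D x -> D x' -> 0 <= dot (u x - u x') (x - x').

(* gam = (Id, u)_# mu0 for a Borel map u with domain D of full mu0-measure *)
Definition induced_by_map (mu0 : probability Rd R)
    (gam : probability (Rd * Rd)%type R) (D : set Rd) (u : Rd -> Rd) : Prop :=
  [/\ measurable D, mu0 D = 1%E, measurable_fun D u
    & forall A, measurable A ->
        gam A = mu0 (D `&` (fun x => (x, u x)) @^-1` A)].

End rectified.

(* Main.v *)
(* Cyclic monotonicity of order N >= 2 makes the support S of gam a monotone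
   set. Hence for 0 < t < 1 the map (x, y) |-> (1 - t) x + t y has a Lipschitz
   inverse from the trace of S at time t, its image, to S. So y - x is a
   function of t and (1 - t) x + t y, the loss vanishes, and every velocity
   field agrees almost everywhere with y - x on the trace. By Fubini, almost
   every curve of a weak rectification of gam follows this velocity on the trace.
   Along such a curve the pair (x, y) is an absolutely continuous function of
   time with derivative 0 almost everywhere, so the curve is a straight segment
   from x to y with (x, y) in S. Since (x, y) is a function of the position at
   time 1/2, whose law is prescribed, the rectification is gam.

   For (iii), let x lie below two points of S whose i-th coordinates are
   separated by a rational c. By monotonicity, for fixed i and c, every line
   parallel to the i-th axis contains at most one such x, so these x are
   Lebesgue null and S is a graph over mu0-almost every x. The segment issued
   from x is then the only solution of the ODE starting at x provided that
   solutions cannot leave the trace: off the trace the velocity is chosen to be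
   a function of time that is not integrable on any interval. *)

Require Import Defs.
From HB Require Import structures.
From mathcomp Require Import all_boot all_order all_algebra all_fingroup.
From mathcomp Require Import all_classical all_reals all_analysis.
From mathcomp Require Import measurable_realfun lra ring.

Set Implicit Arguments.
Unset Strict Implicit.
Unset Printing Implicit Defensive.

Import Order.TTheory GRing.Theory Num.Theory.
Import numFieldNormedType.Exports.

Local Open Scope classical_set_scope.
Local Open Scope ring_scope.

(** * Borel sets *)

(** Two obstacles shape the development. The first is measurability: the trace, the inverse
    [endpoints] and the map whose graph carries the plan are all defined through images, and a
    continuous image of a Borel set need not be Borel. Since supports are closed and R^d is a
    countable union of compact sets, every image at stake is sigma-compact, hence Borel. The second
    is that the ODE holds at almost every time only. Constancy of the endpoints along a curve rests
    on an increment inequality for absolutely continuous functions, proved by continuous induction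
    along an open cover of the exceptional times, without integrating a derivative. The same
    inequality rules out the spike. Moreover, almost every time only gives a dense set of times at
    which a curve is on the trace; the others follow because the trace is closed within the times
    strictly between 0 and 1. Finally, couplings are tested only against smooth functions of compact
    support, so bumps made from exp(-1/x) are needed to recover a measure. *)

Definition countable_base (T : topologicalType) (B : nat -> set T) :=
  (forall i, open (B i)) /\
  forall U x, open U -> U x -> exists2 i, B i x & B i `<=` U.

Lemma countable_base_open (T : topologicalType) (B : nat -> set T) (U : set T) :
  countable_base B -> open U -> U = \bigcup_(i in [set i | B i `<=` U]) B i.
Proof.
move=> [_ baseB] oU; apply/seteqP; split=> [x Ux|x [i /= BU /BU//]].
by have [i Bix BU] := baseB U x oU Ux; exists i.
Qed.

Lemma open_ball_sub (R : numFieldType) (T : pseudoMetricType R) (A : set T) :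
  (forall x, A x -> exists2 e : R, 0 < e & ball x e `<=` A) -> open A.
Proof.
by move=> bA; rewrite openE => x /bA[e e0 xA]; apply/nbhs_ballP; exists e.
Qed.

(** The factor 1/2 keeps [x] well inside the ball around [f i], so that [x] is interior to that
    ball. *)
Lemma dense_ball (R : realType) (T : pseudoMetricType R) (I : Type)
    (f : I -> T) (U : set T) (x : T) :
  (forall x (e : R), 0 < e -> exists i, ball x e (f i)) -> open U -> U x ->
  exists i (k : nat), ball x (k.+1%:R^-1 / 2) (f i) /\
    ball (f i) k.+1%:R^-1 `<=` U.
Proof.
move=> denf oU Ux.
have /nbhs_ballP[e /= e0 eU] : nbhs x U by exact: open_nbhs_nbhs.
have e20 : 0 < e / 2 by rewrite divr_gt0.
have [k ke] : exists k : nat, k.+1%:R^-1 < e / 2.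
  by have [k _ ke] := near_infty_natSinv_lt (PosNum e20); exists k; apply: ke => /=.
have k0 : 0 < k.+1%:R^-1 / 2 :> R by rewrite divr_gt0 ?invr_gt0.
have [i xi] := denf x _ k0; exists i, k; split=> // y iy; apply: eU.
rewrite [X in ball _ X _]splitr; apply: ball_triangle (le_ball (ltW ke) iy).
apply: le_ball xi; apply: ltW; apply: lt_trans ke.
by rewrite ltr_pdivrMr ?invr_gt0// ltr_pMr ?invr_gt0// ltr1n.
Qed.

Lemma dense_countable_base (R : realType) (T : pseudoMetricType R)
    (I : countType) (f : I -> T) :
  (forall x (e : R), 0 < e -> exists i, ball x e (f i)) ->
  exists B : nat -> set T, countable_base B.
Proof.
(* Interiors are taken because a ball of a pseudometric type need not be open. *)
move=> denf; exists (fun n => if unpickle n is Some (i, k)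
  then interior (ball (f i) k.+1%:R^-1) else set0); split=> [n|U x oU Ux].
  by case: unpickle => [[i k]|]; [exact: open_interior|exact: open0].
have [i [k [xi iU]]] := dense_ball denf oU Ux.
exists (pickle (i, k)); rewrite pickleK; last first.
  exact: (subset_trans (@interior_subset _ _) iU).
rewrite /interior; apply/nbhs_ballP; exists (k.+1%:R^-1 / 2).
  by rewrite /= divr_gt0 ?invr_gt0.
move=> y xy; rewrite [X in ball _ X _]splitr; apply: ball_triangle xy.
exact: ball_sym.
Qed.

Lemma ball_rat (R : realType) (x e : R) : 0 < e ->
  exists q : rat, ball x e (ratr q).
Proof.
move=> e0; have xe : x < x + e by rewrite ltrDl.
have [q] := rat_in_itvoo xe; rewrite in_itv/= => /andP[xq qe].
by exists q; rewrite /ball/= distrC gtr0_norm ?subr_gt0// ltrBlDl.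
Qed.

Lemma countable_base_real (R : realType) :
  exists B : nat -> set R, countable_base B.
Proof. by apply: (@dense_countable_base R R rat ratr); exact: ball_rat. Qed.

Lemma ball_rat_mx (R : realType) (m n : nat) (x : 'M[R]_(m, n)) (e : R) :
  0 < e -> exists q : 'M[rat]_(m, n), ball x e (map_mx ratr q).
Proof.
move=> e0.
have /choice[q qP] : forall ij : 'I_m * 'I_n, exists q : rat,
    ball (x ij.1 ij.2) e (ratr q) by move=> ij; exact: ball_rat.
exists (\matrix_(i, j) q (i, j)); split=> // i j; rewrite !mxE.
exact: qP (i, j).
Qed.

Lemma countable_base_mx (R : realType) (m n : nat) :
  exists B : nat -> set 'M[R]_(m, n), countable_base B.
Proof.
apply: (@dense_countable_base R 'M[R]_(m, n) 'M[rat]_(m, n)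
  (fun q => map_mx ratr q)) => x e; exact: ball_rat_mx.
Qed.

Lemma countable_base_prod (T1 T2 : topologicalType) (B1 : nat -> set T1)
    (B2 : nat -> set T2) : countable_base B1 -> countable_base B2 ->
  countable_base (fun n => if unpickle n is Some (i, j) then B1 i `*` B2 j
                           else set0).
Proof.
move=> [oB1 b1] [oB2 b2]; split=> [n|U [x y] oU Uxy].
  case: unpickle => [[i j]|]; [|exact: open0].
  rewrite openE => -[x y] [/= Bx By]; exists (B1 i, B2 j) => //=.
  by split; exact: open_nbhs_nbhs.
have [[P Q]/= [Px Qy] PQU] : nbhs (x, y) U by exact: open_nbhs_nbhs.
move: Px Qy; rewrite !nbhsE => -[P' [oP' P'x] P'P] [Q' [oQ' Q'y] Q'Q].
have [i Bi BP] := b1 _ _ oP' P'x; have [j Bj BQ] := b2 _ _ oQ' Q'y.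
exists (pickle (i, j)); rewrite pickleK//= => -[a b] [/= /BP/P'P Pa /BQ/Q'Q Qb].
exact: PQU.
Qed.

Section borel_sets.
Context (R : realType).

Lemma open_measurable_mx (m n : nat) (U : set 'M[R]_(m, n)) :
  open U -> measurable U.
Proof. by move=> oU; apply: sub_sigma_algebra. Qed.

(** By second countability an open set is a countable union of open rectangles. The maps [f1] and
    [f2] are identities in every use: they link the measurable structure of a factor to its topology
    when these sit on different types, as for [measurableTypeR R] and [R]. *)
Lemma open_measurable_prod (d1 d2 : measure_display)
    (M1 : measurableType d1) (M2 : measurableType d2)
    (T1 T2 : topologicalType) (f1 : M1 -> T1) (f2 : M2 -> T2)
    (B1 : nat -> set T1) (B2 : nat -> set T2) (U : set (T1 * T2)) :
  countable_base B1 -> countable_base B2 ->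
  (forall A, open A -> measurable (f1 @^-1` A)) ->
  (forall A, open A -> measurable (f2 @^-1` A)) ->
  open U -> measurable ((fun p : M1 * M2 => (f1 p.1, f2 p.2)) @^-1` U).
Proof.
move=> b1 b2 m1 m2 oU.
rewrite (countable_base_open (countable_base_prod b1 b2) oU) preimage_bigcup.
apply: bigcup_measurable => n _.
case: unpickle => [[i j]|]; last by rewrite preimage_set0.
rewrite (_ : _ @^-1` _ = (f1 @^-1` B1 i) `*` (f2 @^-1` B2 j))//.
by apply: measurableX; [apply: m1; have [] := b1|apply: m2; have [] := b2].
Qed.

Lemma open_measurable_mx2 (m n p q : nat)
    (U : set ('M[R]_(m, n) * 'M[R]_(p, q))) : open U -> measurable U.
Proof.
move=> oU; have [B1 b1] := countable_base_mx R m n.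
have [B2 b2] := countable_base_mx R p q.
have := @open_measurable_prod _ _ 'M[R]_(m, n) 'M[R]_(p, q) _ _ id id B1 B2 U
  b1 b2 (@open_measurable_mx _ _) (@open_measurable_mx _ _) oU.
by congr measurable; apply/funext => -[].
Qed.

Lemma open_measurable_time (m n : nat) (U : set (measurableTypeR R * 'M[R]_(m, n))) :
  open U -> measurable U.
Proof.
move=> oU; have [B1 b1] := countable_base_real R.
have [B2 b2] := countable_base_mx R m n.
have := @open_measurable_prod _ _ (measurableTypeR R) 'M[R]_(m, n) _ _ id id B1 B2 U
  b1 b2 (@measurable_realfun.open_measurable R) (@open_measurable_mx _ _) oU.
by congr measurable; apply/funext => -[].
Qed.

Lemma open_measurable_time2 (m n p q : nat)
    (U : set (measurableTypeR R * ('M[R]_(m, n) * 'M[R]_(p, q)))) :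
  open U -> measurable U.
Proof.
move=> oU; have [B1 b1] := countable_base_real R.
have [B2 b2] := countable_base_mx R m n.
have [B3 b3] := countable_base_mx R p q.
have := @open_measurable_prod _ _ (measurableTypeR R)
  ('M[R]_(m, n) * 'M[R]_(p, q))%type _ _ id id B1 _ U
  b1 (countable_base_prod b2 b3)
  (@measurable_realfun.open_measurable R) (@open_measurable_mx2 _ _ _ _) oU.
by congr measurable; apply/funext => -[].
Qed.

Lemma measurable_fun_open_mx (d : measure_display) (T : measurableType d)
    (D : set T) (m n : nat) (f : T -> 'M[R]_(m, n)) :
  (forall U, open U -> measurable (D `&` f @^-1` U)) -> measurable_fun D f.
Proof.
move=> mf; apply: (measurability (@open 'M[R]_(m, n))) => //.
by move=> _ [U oU <-]; exact: mf.
Qed.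

Lemma measurable_fun_open_real (d : measure_display) (T : measurableType d)
    (D : set T) (f : T -> R) :
  (forall U, open U -> measurable (D `&` f @^-1` U)) -> measurable_fun D f.
Proof.
move=> mf; apply: (measurability _ (measurable_realfun.RGenOpens.measurableE R)).
by move=> _ [_ [a [b ->]] <-]; apply: mf; exact: interval_open.
Qed.

End borel_sets.

(** * Sigma-compact sets *)

Definition sigma_compact (T : topologicalType) (A : set T) :=
  exists2 K : nat -> set T, forall n, compact (K n) & A = \bigcup_n K n.

Lemma sigma_compact_closedI (T : topologicalType) (A C : set T) :
  sigma_compact A -> closed C -> sigma_compact (A `&` C).
Proof.
move=> [K cK ->] cC; exists (fun n => K n `&` C).
  by move=> n; exact: compact_closedI.
by rewrite setI_bigcupl.
Qed.

(** This stability is the point of the notion: unlike the Borel sets, the sigma-compact sets survive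
    continuous images, and in a Hausdorff space they are Borel. *)
Lemma sigma_compact_image (T U : topologicalType) (f : T -> U) (A : set T) :
  continuous f -> sigma_compact A -> sigma_compact (f @` A).
Proof.
move=> cf [K cK ->]; exists (fun n => f @` K n).
  by move=> n; apply: continuous_compact => //; exact: continuous_subspaceT.
by rewrite image_bigcup.
Qed.

Lemma sigma_compactX (T U : topologicalType) (A : set T) (B : set U) :
  sigma_compact A -> sigma_compact B -> sigma_compact (A `*` B).
Proof.
move=> [K cK ->] [L cL ->].
exists (fun n => if unpickle n is Some (i, j) then K i `*` L j else set0).
  move=> n; case: unpickle => [[i j]|]; first exact: compact_setX.
  exact: compact0.
apply/seteqP; split=> [[x y] [[i _ Kx] [j _ Ly]]|[x y] [n _]].
  by exists (pickle (i, j)) => //; rewrite pickleK.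
by case: unpickle => [[i j]|//] [/= Kx Ly]; split; [exists i|exists j].
Qed.

Lemma sigma_compact_closed_measurable (d : measure_display)
    (M : measurableType d) (T : topologicalType) (f : M -> T) (A : set T) :
  hausdorff_space T -> (forall U, open U -> measurable (f @^-1` U)) ->
  sigma_compact A -> measurable (f @^-1` A).
Proof.
move=> hT mf [K cK ->]; rewrite preimage_bigcup.
apply: bigcupT_measurable => n; rewrite -[K n]setCK -preimage_setC.
by apply: measurableC; apply: mf; apply: closed_openC; exact: compact_closed.
Qed.

Section sigma_compact_sets.
Context (R : realType).

Lemma sigma_compact_itvoo (a b : R) : sigma_compact `]a, b[%classic.
Proof.
exists (fun n => `[a + n.+1%:R^-1, b - n.+1%:R^-1]%classic).
  by move=> n; exact: segment_compact.
apply/seteqP; split=> [/= x|/= x [n _]] /=; rewrite !in_itv/=.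
  move=> /andP[ax xb]; have m0 : 0 < Num.min (x - a) (b - x).
    by rewrite lt_min !subr_gt0 ax.
  have [k _ ke] := near_infty_natSinv_lt (PosNum m0).
  exists k => //=; rewrite in_itv/=; have := ke k (leqnn _); rewrite /= lt_min.
  move=> /andP[xa bx]; apply/andP; split; first by rewrite -lerBrDl ltW.
  by rewrite lerBrDr -lerBrDl ltW.
have n0 : 0 < n.+1%:R^-1 :> R by rewrite invr_gt0.
move=> /andP[xa bx]; apply/andP; split.
  by apply: lt_le_trans xa; rewrite ltrDl.
by apply: le_lt_trans bx _; rewrite gtrBl.
Qed.

Lemma sigma_compact_rV (d : nat) : sigma_compact [set: 'rV[R]_d].
Proof.
exists (fun n => closed_ball (0 : 'rV[R]_d) n.+1%:R).
  move=> n; apply: bounded_closed_compact; last exact: closed_ball_closed.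
  exists n.+1%:R; split; first exact: realn.
  move=> y ny x; rewrite closed_ballE//= /closed_ball_/= sub0r normrN => xn.
  exact: le_trans (ltW ny).
apply/seteqP; split=> // x _; exists (Num.truncn `|x|) => //.
rewrite closed_ballE//= /closed_ball_/= sub0r normrN ltW//.
by have := truncnS_gt `|x|.
Qed.

Lemma sigma_compact_rV2 (d : nat) (A : set ('rV[R]_d * 'rV[R]_d)) :
  closed A -> sigma_compact A.
Proof.
move=> cA; rewrite -[A]setTI -setXTT; apply: sigma_compact_closedI => //.
by apply: sigma_compactX; exact: sigma_compact_rV.
Qed.

Lemma sigma_compact_measurable_rV (d : nat) (A : set 'rV[R]_d) :
  sigma_compact A -> measurable A.
Proof.
apply: (@sigma_compact_closed_measurable _ 'rV[R]_d _ id).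
  exact: norm_hausdorff.
by move=> U oU; exact: open_measurable_mx.
Qed.

Lemma sigma_compact_measurable_time (d : nat)
    (A : set (measurableTypeR R * 'rV[R]_d)) :
  sigma_compact A -> measurable A.
Proof.
apply: (@sigma_compact_closed_measurable _ (measurableTypeR R * 'rV[R]_d)%type
  (R * 'rV[R]_d)%type id).
  exact: norm_hausdorff.
by move=> U oU; exact: open_measurable_time.
Qed.

End sigma_compact_sets.

(** * Monotone sets and their traces *)

Lemma continuous_fst (T U : topologicalType) : continuous (@fst T U).
Proof. by move=> [x y]; exact: cvg_fst. Qed.

Lemma continuous_snd (T U : topologicalType) : continuous (@snd T U).
Proof. by move=> [x y]; exact: cvg_snd. Qed.

Section euclidean.
Context (R : realType) (d : nat).
Local Notation Rd := 'rV[R]_d.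
Implicit Types x y z : Rd.

Lemma dot_ge0 x : 0 <= dot x x.
Proof. by apply: sumr_ge0 => i _; rewrite -expr2 sqr_ge0. Qed.

Lemma enorm_sqr x : enorm x ^+ 2 = dot x x.
Proof. by rewrite sqr_sqrtr ?dot_ge0. Qed.

Lemma enorm_ge0 x : 0 <= enorm x.
Proof. exact: sqrtr_ge0. Qed.

Lemma normr_coord_le x i : `|x ord0 i| <= `|x|.
Proof.
rewrite [leRHS]/Num.norm/= mx_normrE.
exact: (le_bigmax _ (fun ij : 'I_1 * 'I_d => `|x ij.1 ij.2|) (ord0, i)).
Qed.

Lemma coord_le_enorm x i : `|x ord0 i| <= enorm x.
Proof.
rewrite -sqrtr_sqr /enorm ler_sqrt ?dot_ge0// /dot (bigD1 i)//= -expr2 lerDl.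
by apply: sumr_ge0 => j _; rewrite -expr2 sqr_ge0.
Qed.

(** Together with [enorm_le_normr], this passes between the Euclidean estimates given by
    monotonicity and the sup norm, in which balls, limits and derivatives are expressed. *)
Lemma normr_le_enorm x : `|x| <= enorm x.
Proof.
rewrite [leLHS]/Num.norm/= mx_normrE; apply/bigmax_leP; split=> [|[i j] _].
  exact: enorm_ge0.
by rewrite /= ord1 coord_le_enorm.
Qed.

Lemma enorm_le_normr x : enorm x <= Num.sqrt d%:R * `|x|.
Proof.
have -> : `|x| = Num.sqrt (`|x| ^+ 2) by rewrite sqrtr_sqr normr_id.
rewrite -sqrtrM ?ler0n// ler_wsqrtr//.
have -> : d%:R * `|x| ^+ 2 = \sum_(i < d) `|x| ^+ 2.
  by rewrite sumr_const card_ord mulr_natl.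
apply: ler_sum => i _; rewrite -expr2 -real_normK ?num_real//.
by rewrite lerXn2r ?nnegrE// normr_coord_le.
Qed.

Lemma enorm0 : enorm (0 : Rd) = 0.
Proof. by rewrite /enorm /dot big1 ?sqrtr0// => i _; rewrite mxE mul0r. Qed.

Lemma enorm_eq0 x : enorm x = 0 -> x = 0.
Proof. by move=> x0; apply/eqP; rewrite -normr_le0 -x0 normr_le_enorm. Qed.

Lemma enormZ (a : R) x : enorm (a *: x) = `|a| * enorm x.
Proof.
rewrite /enorm -sqrtr_sqr -sqrtrM ?sqr_ge0//; congr Num.sqrt.
by rewrite /dot mulr_sumr; apply: eq_bigr => i _; rewrite mxE; ring.
Qed.

Lemma enormB_sqr_le x y : enorm (x - y) ^+ 2 <= 2 * (enorm x ^+ 2 + enorm y ^+ 2).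
Proof.
rewrite !enorm_sqr -subr_ge0 (_ : _ - _ = dot (x + y) (x + y)) ?dot_ge0//.
rewrite /dot -big_split/= mulr_sumr -sumrB; apply: eq_bigr => i _.
by rewrite !mxE; ring.
Qed.

Lemma continuous_dot : continuous (fun x => dot x x).
Proof.
apply: (@continuous_big R 'I_d +%R 0 xpredT _ Rd _
  (fun i (x : Rd) => x ord0 i * x ord0 i)); first exact: add_continuous.
move=> i _ x.
by apply: (@cvgM R Rd (nbhs x)); exact: (@coord_continuous R 1 d ord0 i x).
Qed.

Lemma continuous_enorm : continuous (@enorm R d).
Proof.
move=> x; apply: continuous_comp; first exact: continuous_dot.
exact: sqrt_continuous.
Qed.

End euclidean.

Section interpolate.
Context (R : realType) (d : nat).
Local Notation Rd := 'rV[R]_d.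

Lemma continuous_interp :
  continuous (fun q : R * (Rd * Rd) => interp q.1 q.2).
Proof.
move=> q; have c1 := @continuous_fst R (Rd * Rd)%type q.
have c2 := @continuous_snd R (Rd * Rd)%type q.
apply: cvgD; apply: cvgZ => //.
- by apply: cvgB => //; exact: cvg_cst.
- by apply: (continuous_comp c2); exact: continuous_fst.
- by apply: (continuous_comp c2); exact: continuous_snd.
Qed.

Lemma interp0 (p : Rd * Rd) : interp 0 p = p.1.
Proof. by rewrite /interp subr0 scale1r scale0r addr0. Qed.

Lemma interp1 (p : Rd * Rd) : interp 1 p = p.2.
Proof. by rewrite /interp subrr scale1r scale0r add0r. Qed.

Lemma interp_slope (s t : R) (p : Rd * Rd) :
  interp t p - interp s p = (t - s) *: (p.2 - p.1).
Proof. by apply/rowP => i; rewrite /interp !mxE; ring. Qed.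

Definition monotone_set (S : set (Rd * Rd)) :=
  forall p q, S p -> S q -> 0 <= dot (p.1 - q.1) (p.2 - q.2).

Section monotone.
Variable S : set (Rd * Rd).
Hypothesis Smon : monotone_set S.

(** The difference of the two sides is the cross term 2t(1 - t)<p.1 - q.1, p.2 - q.2>, nonnegative
    by monotonicity. Dropping either term on the left gives the two Lipschitz bounds that follow. *)
Lemma interp_expand (t : R) p q : 0 <= t <= 1 -> S p -> S q ->
  (1 - t) ^+ 2 * enorm (p.1 - q.1) ^+ 2 + t ^+ 2 * enorm (p.2 - q.2) ^+ 2
  <= enorm (interp t p - interp t q) ^+ 2.
Proof.
move=> /andP[t0 t1] Sp Sq; rewrite !enorm_sqr -subr_ge0.
rewrite (_ : _ - _ = 2 * t * (1 - t) * dot (p.1 - q.1) (p.2 - q.2)).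
  by rewrite !mulr_ge0// ?subr_ge0//; exact: Smon.
rewrite /dot !mulr_sumr -big_split/= -sumrB; apply: eq_bigr => i _.
by rewrite /interp !mxE; ring.
Qed.

Lemma interp_fst_le (t : R) p q : 0 < t < 1 -> S p -> S q ->
  enorm (p.1 - q.1) <= (1 - t)^-1 * enorm (interp t p - interp t q).
Proof.
move=> /andP[t0 t1] Sp Sq; rewrite mulrC ler_pdivlMr ?subr_gt0//.
have t01 : 0 <= t <= 1 by rewrite !ltW.
have t1' : 0 <= 1 - t by rewrite subr_ge0 ltW.
rewrite -(@ler_pXn2r _ 2)// ?nnegrE ?mulr_ge0 ?enorm_ge0//.
apply: le_trans (interp_expand t01 Sp Sq).
by rewrite exprMn mulrC lerDl mulr_ge0 ?sqr_ge0.
Qed.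

Lemma interp_snd_le (t : R) p q : 0 < t < 1 -> S p -> S q ->
  enorm (p.2 - q.2) <= t^-1 * enorm (interp t p - interp t q).
Proof.
move=> /andP[t0 t1] Sp Sq; rewrite mulrC ler_pdivlMr//.
have t01 : 0 <= t <= 1 by rewrite !ltW.
have t0' := ltW t0.
rewrite -(@ler_pXn2r _ 2)// ?nnegrE ?mulr_ge0 ?enorm_ge0//.
apply: le_trans (interp_expand t01 Sp Sq).
by rewrite exprMn mulrC lerDr mulr_ge0 ?sqr_ge0.
Qed.

Lemma interp_inj (t : R) p q : 0 < t < 1 -> S p -> S q ->
  interp t p = interp t q -> p = q.
Proof.
move=> t01 Sp Sq pq; have e0 : enorm (interp t p - interp t q) = 0.
  by rewrite pq subrr enorm0.
have := interp_fst_le t01 Sp Sq; rewrite e0 mulr0 => p1.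
have := interp_snd_le t01 Sp Sq; rewrite e0 mulr0 => p2.
rewrite [p]surjective_pairing [q]surjective_pairing; congr pair.
  apply/subr0_eq/enorm_eq0/eqP; by rewrite eq_le p1 enorm_ge0.
by apply/subr0_eq/enorm_eq0/eqP; rewrite eq_le p2 enorm_ge0.
Qed.

End monotone.

(** Times 0 and 1 are left out: there [interp] forgets one endpoint and may fail to be injective on
    [S]. *)
Definition trace (S : set (Rd * Rd)) : set (R * Rd) :=
  [set q | 0 < q.1 < 1 /\ exists2 p, S p & interp q.1 p = q.2].

(* The inverse of interp t on the trace; off the trace, the junk value 0. *)
Definition endpoints (S : set (Rd * Rd)) (t : R) (z : Rd) : Rd * Rd :=
  xget 0 [set p | [/\ 0 < t < 1, S p & interp t p = z]].

Lemma trace_interp (S : set (Rd * Rd)) (t : R) p : 0 < t < 1 -> S p ->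
  trace S (t, interp t p).
Proof. by move=> t01 Sp; split => //; exists p. Qed.

Lemma endpoints_trace (S : set (Rd * Rd)) (t : R) z : trace S (t, z) ->
  S (endpoints S t z) /\ interp t (endpoints S t z) = z.
Proof.
move=> [/= t01 [p Sp tp]]; rewrite /endpoints; case: xgetP => [_ _ []//|].
by move=> /(_ p); case.
Qed.

Lemma endpoints_interp (S : set (Rd * Rd)) (t : R) p : monotone_set S ->
  0 < t < 1 -> S p -> endpoints S t (interp t p) = p.
Proof.
move=> Smon t01 Sp; have [Se] := endpoints_trace (trace_interp t01 Sp).
exact: (interp_inj Smon).
Qed.

Lemma endpoints_out (S : set (Rd * Rd)) (t : R) z : ~ trace S (t, z) ->
  endpoints S t z = 0.
Proof.
move=> nG; rewrite /endpoints xgetPN// => p [/= t01 Sp tp].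
by apply: nG; split => //; exists p.
Qed.

(** A preimage under [endpoints], which is defined by choice, becomes a direct image under a
    continuous map, so that sigma-compactness applies. *)
Lemma trace_imageE (S : set (Rd * Rd)) (C : set (Rd * Rd)) : monotone_set S ->
  trace S `&` [set q | C (endpoints S q.1 q.2)] =
  (fun q : R * (Rd * Rd) => (q.1, interp q.1 q.2)) @`
    (`]0, 1[%classic `*` (S `&` C)).
Proof.
move=> Smon; apply/seteqP; split=> [[t z] [/= tz]|[s z] [[t p]] /=].
  have [? e] := endpoints_trace tz => Ct.
  exists (t, endpoints S t z) => /=; last by rewrite e.
  by split=> //=; rewrite in_itv/=; case: tz.
move=> [/=]; rewrite in_itv/= => t01 [Sp Cp] [<- <-]; split => /=.
  exact: trace_interp.
by rewrite endpoints_interp.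
Qed.

Lemma trace_sigma_compact (S C : set (Rd * Rd)) : monotone_set S -> closed S ->
  closed C -> sigma_compact (trace S `&` [set q | C (endpoints S q.1 q.2)]).
Proof.
move=> Smon cS cC; rewrite trace_imageE//; apply: sigma_compact_image.
  move=> q; exact: (cvg_pair (@continuous_fst _ _ q) (@continuous_interp _)).
apply: sigma_compactX; first exact: sigma_compact_itvoo.
by apply: sigma_compact_rV2; exact: closedI.
Qed.

Lemma trace_measurable (S : set (Rd * Rd)) : monotone_set S -> closed S ->
  measurable (trace S : set (measurableTypeR R * Rd)).
Proof.
move=> Smon cS; apply: sigma_compact_measurable_time.
have := trace_sigma_compact Smon cS (@closedT _).
by rewrite (_ : [set _ | _] = setT) ?setIT//; apply/seteqP.
Qed.

(** Within the trace, preimages of closed sets are sigma-compact; an open [U] is therefore reached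
    through its complement. The case of interest is [f] a projection, which gives each endpoint
    separately. *)
Lemma measurable_endpoints (S : set (Rd * Rd)) (f : Rd * Rd -> Rd) :
  monotone_set S -> closed S -> continuous f ->
  measurable_fun setT
    (fun q : measurableTypeR R * Rd => f (endpoints S q.1 q.2)).
Proof.
move=> Smon cS cf; apply: measurable_fun_open_mx => U oU; rewrite setTI.
have mG := trace_measurable Smon cS.
have cU : closed (f @^-1` (~` U)).
  by apply: closed_comp; [move=> *; exact: cf|exact: open_closedC].
have mC := sigma_compact_measurable_time (trace_sigma_compact Smon cS cU).
rewrite -[X in measurable X]setIT -(setUv (trace S)) setIUr.
apply: measurableU.
  rewrite (_ : _ `&` _ = trace S `\` (trace S `&`
    [set q | (f @^-1` (~` U)) (endpoints S q.1 q.2)])); first exact: measurableD.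
  apply/seteqP; split=> [q [Uq Gq]|q [Gq UGq]]; split=> //.
    by move=> [_]; exact.
  by apply: contrapT => NU; apply: UGq.
(* Off the trace the value is constantly [f 0], so this part of the preimage is all of the
   complement of the trace or empty. *)
have [U0|nU0] := pselect (U (f 0)).
  rewrite (_ : _ `&` _ = ~` trace S); first exact: measurableC.
  apply/seteqP; split=> [q []//|[t z] /= nG]; split=> //.
  by rewrite /preimage/= endpoints_out.
rewrite (_ : _ `&` _ = set0)//; apply/seteqP; split=> [[t z] [/=]|//].
by move=> /[swap] /endpoints_out ->.
Qed.

End interpolate.

(** * The support of a plan *)

Section support.
Context (R : realType) (d : nat) (gam : probability ('rV[R]_d * 'rV[R]_d)%type R).
Local Notation S := (measure_support gam).

Lemma closed_support : closed S.
Proof.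
rewrite -[S]setCK; apply: open_closedC; rewrite openE => p.
move=> /existsNP[U] /not_implyP[oU] /not_implyP[Up gU].
rewrite /interior; apply: filterS (open_nbhs_nbhs (conj oU Up)) => q Uq.
by move=> /(_ U oU Uq).
Qed.

Lemma support_measurable : measurable S.
Proof.
rewrite -[S]setCK; apply: measurableC; apply: open_measurable_mx2.
by apply: closed_openC; exact: closed_support.
Qed.

(** A Lindelof argument: each point outside the support has a null neighbourhood, hence a null basic
    one, and there are countably many basic open sets. *)
Lemma supportC_null : gam (~` S) = 0%E.
Proof.
have [B1 b1] := countable_base_mx R 1 d.
have [B [oB bB]] : exists B : nat -> set ('rV[R]_d * 'rV[R]_d),
  countable_base B := ex_intro _ _ (countable_base_prod b1 b1).
pose F n := if pselect (gam (B n) = 0%E) then B n else set0.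
have oF n : open (F n) by rewrite /F; case: pselect => ?; [exact: oB|exact: open0].
apply: (@subset_measure0 _ _ _ gam _ (\bigcup_n F n)).
- exact: (measurableC support_measurable).
- by apply: bigcupT_measurable => n; exact: open_measurable_mx2.
- move=> p /existsNP[U] /not_implyP[oU] /not_implyP[Up gU].
  have [n Bp BU] := bB U p oU Up; exists n => //; rewrite /F.
  case: pselect => //= ng0; exfalso; apply: ng0; apply/eqP; rewrite -measure_le0.
  apply: le_trans (le_measure _ _ _ BU) _; rewrite ?inE.
  - exact: open_measurable_mx2.
  - exact: open_measurable_mx2.
  - by rewrite leNgt; apply/negP.
- apply/eqP; rewrite -measure_le0.
  apply: le_trans (measure_sigma_subadditive _ _ _ (@subset_refl _ _)) _.
  - by move=> n; exact: open_measurable_mx2.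
  - by apply: bigcupT_measurable => n; exact: open_measurable_mx2.
  rewrite eseries0// => n _ _; rewrite /F; case: pselect => [g0|?] /=; first exact: g0.
  by rewrite measure0.
Qed.

Lemma support_full : gam S = 1%E.
Proof.
have := probability_setC gam (measurableC support_measurable).
by rewrite setCK supportC_null sube0.
Qed.

(** The inequality is applied to [p] once and [q] repeated N - 1 times, with the permutation
    exchanging the first two indices. The remaining N - 2 terms are the same on both sides, and what
    is left is twice the scalar product. *)
Lemma cyclically_monotone_set (N : nat) : (2 <= N)%N ->
  cyclically_monotone N gam -> monotone_set S.
Proof.
case: N => [|[|N]]// _ cm p q Sp Sq.
pose sel (T : Type) (a b : T) (i : 'I_N.+2) := if i == ord0 then a else b.
have := cm (sel _ p.1 q.1) (sel _ p.2 q.2) _ (tperm ord0 (lift ord0 ord0)).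
have Ssel i : S (sel _ p.1 q.1 i, sel _ p.2 q.2 i).
  by rewrite /sel; case: ifP => _; rewrite -surjective_pairing.
move=> /(_ Ssel).
rewrite [in leLHS](bigD1 ord0)//= [in leLHS](bigD1 (lift ord0 ord0))//=.
rewrite [in leRHS](bigD1 ord0)//= [in leRHS](bigD1 (lift ord0 ord0))//=.
rewrite tpermL tpermR /sel/= !addrA.
rewrite [X in _ <= _ + X](eq_bigr (fun=> enorm (q.1 - q.2) ^+ 2)); last first.
  move=> i /andP[i0 i1]; 
  by rewrite (negbTE i0) tpermD ?(negbTE i0)// eq_sym.
rewrite [X in _ + X <= _](eq_bigr (fun=> enorm (q.1 - q.2) ^+ 2)); last first.
  by move=> i /andP[/negbTE i0 i1]; rewrite i0.
rewrite lerD2r -subr_ge0 !enorm_sqr.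
rewrite (_ : _ - _ = 2 * dot (p.1 - q.1) (p.2 - q.2)) ?pmulr_rge0//.
rewrite /dot mulr_sumr -!big_split/= -sumrB; apply: eq_bigr => i _.
by rewrite !mxE; ring.
Qed.

End support.

(** * Absolutely continuous curves on the trace *)

Section absolute_continuity.
Context (R : realType).
Local Notation mu := (@lebesgue_measure R).
Implicit Types (f : R -> R) (a b c : R).

Definition abs_continuous_on f a b := forall e : R, 0 < e ->
  exists2 del : R, 0 < del & forall (n : nat) (A B : 'I_n -> R),
    (forall i, a <= A i /\ A i <= B i /\ B i <= b) ->
    (forall i j, i != j -> B i <= A j \/ B j <= A i) ->
    \sum_(i < n) (B i - A i) < del ->
    \sum_(i < n) `|f (B i) - f (A i)| < e.

(** A lower bound [c] for the derivative at [t], tested on intervals that straddle [t] instead of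
    starting there: this is the form in which [real_induction] crosses a point. *)
Definition slope_ge f a b c t := forall e : R, 0 < e ->
  exists2 del : R, 0 < del & forall u v, a <= u -> u <= t -> t <= v -> v <= b ->
    v - u < del -> (c - e) * (v - u) <= f v - f u.

Lemma lebesgue_null_cover (N : set R) (e : R) : 0 < e ->
  mu.-negligible N -> exists U : set R, [/\ open U, N `<=` U & (mu U < e%:E)%E].
Proof.
move=> e0 [M [mM M0 NM]].
have [|U [oU MU UM]] := lebesgue_regularity_outer mM _ e0. 
  by apply: (@le_lt_trans _ _ 0%E) => //; rewrite -M0.
exists U; split=> //; first exact: subset_trans MU.
have mU : measurable U by exact: measurable_realfun.open_measurable.
rewrite -(setDUK MU); apply: le_lt_trans (measureU2 _ _ _) _ => //.
  exact: measurableD.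
by rewrite /= M0 add0e.
Qed.

(** Continuous induction: the supremum of the points where [P] holds can itself be crossed, so it
    cannot be less than [b]. *)
Lemma real_induction (P : R -> Prop) a b : a <= b -> P a ->
  (forall m, a <= m <= b -> exists2 r, 0 < r & forall u v, a <= u -> u <= m ->
     m <= v -> v <= b -> v - u < r -> P u -> P v) -> P b.
Proof.
move=> ab Pa step; pose T := [set t | a <= t <= b /\ P t].
have Ta : T a by split=> //; rewrite lexx.
have ubT : ubound T b by move=> t [/andP[]].
have sT : has_sup T by split; [exists a|exists b].
pose m := sup T; have am : a <= m by apply: ub_le_sup => //; exists b.
have mb : m <= b by apply: ge_sup => //; exists a.
have [|r r0 stepm] := step m; first by rewrite am.
have r2 : 0 < r / 2 by rewrite divr_gt0.
have [u [/andP[au ub] Pu] mu] := sup_adherent r2 sT.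
have um : u <= m by apply: ub_le_sup => //; [exists b|split => //; rewrite au].
(* As [u] is less than r/2 below [m], the step from [u] to [v] is shorter than 5r/6, within the
   allowed [r]; unless [v] is [b], it ends beyond the supremum. *)
pose v := Num.min b (m + r / 3).
have mv : m <= v by rewrite le_min mb lerDl divr_ge0// ltW.
have vb : v <= b by rewrite ge_min lexx.
have Pv : P v.
  apply: (stepm u) => //; have : v <= m + r / 3 by rewrite ge_min lexx orbT.
  by rewrite -/m in mu; lra.
have vm : v <= m.
  by apply: ub_le_sup; [exists b|split => //; rewrite vb (le_trans am)].
have : ~~ (b > m + r / 3).
  apply/negP => bm; have : m + r / 3 <= m by rewrite -{2}(le_anti (introT andP (conj vm mv))) /v min_r// ltW.
  by rewrite gerDl pmulr_lle0 ?invr_gt0// leNgt r0.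
by rewrite -leNgt => bm; rewrite -(min_l bm).
Qed.

(** The exceptional times are covered by an open set [U] of small measure, and one walks from [a] to
    [b]. Steps across good times increase [f] at rate at least c - e. Steps across bad times are
    recorded as disjoint intervals inside [U]; absolute continuity bounds the variation of [f] on
    them by [e], and the gain missed there is at most |c - e| times their length, again at most [e].
    The constant [K] exceeds |c - e| and is positive even when it vanishes. *)
Lemma ac_increment_ge_approx f a b c e : a <= b -> 0 < e ->
  abs_continuous_on f a b ->
  {ae mu, forall t, a < t < b -> slope_ge f a b c t} ->
  (c - e) * (b - a) - 2 * e <= f b - f a.
Proof.
move=> ab e0 ac aeb; have [del del0 acP] := ac e e0.
pose K := `|c - e| + 1; have K0 : 0 < K by rewrite ltr_wpDl.
have m0 : 0 < Num.min del (e / K) by rewrite lt_min del0 divr_gt0.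
(* The points [a] and [b] count as bad because the slope is controlled only strictly between
   them. *)
pose bad := ~` [set t | a < t < b -> slope_ge f a b c t] `|` [set a; b].
have [U [oU badU mU]] : exists U : set R, [/\ open U, bad `<=` U
    & (mu U < (Num.min del (e / K))%:E)%E].
  apply: lebesgue_null_cover => //; apply: negligibleU => //.
  exists [set a; b]; split => //; first exact: measurableU.
  apply/eqP; rewrite -measure_le0; apply: le_trans (measureU2 _ _ _) _ => //.
  by rewrite /= !lebesgue_measure_set1 adde0.
have msU : measurable U by exact: measurable_realfun.open_measurable.
(* Invariant of the walk up to time [t]: the recorded intervals are ordered and end before [t],
   their length is paid for by the part of [U] left of [t], and [f] has gained enough up to the
   losses on them. *)
pose P t := exists n (A B : nat -> R),
  [/\ forall i, (i < n)%N -> [/\ a <= A i, A i <= B i & B i <= t],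
      forall i j, (i < j < n)%N -> B i <= A j,
      ((\sum_(i < n) (B i - A i))%:E <= mu (U `&` `]-oo, t[))%E
    & (c - e) * (t - a) - \sum_(i < n) (`|f (B i) - f (A i)| + `|c - e| * (B i - A i))
      <= f t - f a].
have [n [A [B [AB disj len fba]]]] : P b.
  apply: (@real_induction P a b ab).
    exists 0%N, (fun=> 0), (fun=> 0); split=> //; rewrite !big_ord0 ?measure_ge0//.
    by rewrite !subrr mulr0 subr0.
  move=> m /andP[am mb].
  have [bm|nbm] := pselect (bad m).
    (* A ball around a bad [m] lies in [U]. Any shorter step across [m] stays in it, so the whole
       step can be appended to the list of recorded intervals. *)
    have /nbhs_ballP[r /= r0 rU] : nbhs m U by apply: open_nbhs_nbhs; split=> //; exact: badU.
    exists r => // u v au um mv vb uvr [n [A [B [AB disj len fba]]]].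
    have uv : u <= v by exact: le_trans mv.
    exists n.+1, (fun i => if (i < n)%N then A i else u),
      (fun i => if (i < n)%N then B i else v); split.
    - move=> i _; case: ifPn => [ni|_]; last by [].
      by have [? ? Bu] := AB i ni; split=> //; exact: le_trans Bu uv.
    - move=> i j /andP[ij]; rewrite ltnS leq_eqVlt => /orP[/eqP jn|jn].
        by subst j; rewrite ij ltnn; have [] := AB i ij.
      by rewrite (ltn_trans ij jn) jn; apply: disj; rewrite ij.
    - rewrite big_ord_recr/= ltnn; under eq_bigr do rewrite ltn_ord.
      rewrite EFinD; have -> : (v - u)%:E = mu `[u, v[.
        rewrite lebesgue_measure_itv/= lte_fin.
        by case: ltP => // vu; rewrite (le_anti (introT andP (conj uv vu))) subrr.
      apply: le_trans (leeD len (lexx _)) _.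
      rewrite -measureU//=; last first.
      - apply/seteqP; split=> // x [[_ /=]]; rewrite !in_itv/= => xu /andP[ux _].
        by have := le_lt_trans ux xu; rewrite ltxx.
      - exact: measurableI.
      apply: le_measure; rewrite ?inE//=.
      + by apply: measurableU => //; exact: measurableI.
      + exact: measurableI.
      + move=> x [[Ux /=]|/=]; rewrite !in_itv/=.
          by move=> xu; split=> //=; exact: lt_le_trans uv.
        move=> /andP[ux xv]; split=> //=.
        apply: rU; rewrite /ball/= ltr_distlC; apply/andP; split; lra.
    - rewrite big_ord_recr/= ltnn; under eq_bigr do rewrite ltn_ord.
      set s := \sum_(i < n) _ in fba *.
      have h1 : - `|f v - f u| <= f v - f u by rewrite lerNl -normrN ler_norm.
      have h2 : (c - e) * (v - u) <= `|c - e| * (v - u).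
        by rewrite ler_wpM2r ?subr_ge0// ler_norm.
      by lra.
  have amb : a < m < b.
    rewrite !lt_neqAle am mb !andbT; apply/andP; split; apply/eqP => E; apply: nbm; right.
      by left; rewrite E.
    by right; rewrite E.
  have slm : slope_ge f a b c m.
    by apply: contrapT => ns; apply: nbm; left => /= h; apply: ns; exact: h.
  have [r r0 rP] := slm e e0.
  exists r => // u v au um mv vb uvr [n [A [B [AB disj len fba]]]].
  have uv : u <= v by exact: le_trans mv.
  exists n, A, B; split=> //.
  - by move=> i ni; have [? ? Bu] := AB i ni; split=> //; exact: le_trans Bu uv.
  - apply: le_trans len _; apply: le_measure; rewrite ?inE//=; try exact: measurableI.
    by apply: setIS => x /=; rewrite !in_itv/= => /lt_le_trans; apply.
  - by have := rP u v au um mv vb uvr; lra.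
have lenR : \sum_(i < n) (B i - A i) < Num.min del (e / K).
  rewrite -lte_fin; apply: le_lt_trans len _; apply: le_lt_trans mU.
  by apply: le_measure; rewrite ?inE//=; exact: measurableI.
move: lenR; rewrite lt_min => /andP[lendel lenK].
have sumf : \sum_(i < n) `|f (B i) - f (A i)| < e.
  apply: (acP n (fun i => A i) (fun i => B i)) => //.
    by move=> i; have [] := AB i (ltn_ord i).
  move=> i j ij; have [ij'|ij'|/val_inj/eqP] := ltngtP i j; last by rewrite (negbTE ij).
    by left; apply: disj; rewrite ij'/=.
  by right; apply: disj; rewrite ij'/=.
have sumc : `|c - e| * \sum_(i < n) (B i - A i) <= e.
  have s0 : 0 <= \sum_(i < n) (B i - A i).
    by apply: sumr_ge0 => i _; rewrite subr_ge0; have [] := AB i (ltn_ord i).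
  apply: le_trans (_ : K * \sum_(i < n) (B i - A i) <= e).
    by rewrite ler_wpM2r// lerDl.
  by rewrite mulrC -ler_pdivlMr// ltW.
move: fba; rewrite big_split/= -mulr_sumr => fba.
by lra.
Qed.

Lemma ac_increment_ge f a b c : a <= b -> abs_continuous_on f a b ->
  {ae mu, forall t, a < t < b -> slope_ge f a b c t} ->
  c * (b - a) <= f b - f a.
Proof.
move=> ab ac aeb; apply/ler_addgt0Pr => e e0.
(* With e' in place of [e], the approximate bound is off by e'(b - a) + 2e', which equals [e] for e'
   = e / (b - a + 2). *)
have D0 : 0 < b - a + 2 by rewrite ltr_wpDl ?subr_ge0.
have ed0 : 0 < e / (b - a + 2) by rewrite divr_gt0.
have := ac_increment_ge_approx ab ed0 ac aeb.
have : e / (b - a + 2) * (b - a + 2) = e by rewrite divfK ?gt_eqF.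
by lra.
Qed.

End absolute_continuity.

Lemma is_derive_approx (R : realType) (V : normedModType R) (f : R -> V)
    (t : R) (D : V) : is_derive t 1 f D -> forall e : R, 0 < e ->
  exists2 del : R, 0 < del & forall s, `|s - t| < del ->
    `|f s - f t - (s - t) *: D| <= e * `|s - t|.
Proof.
move=> [df Df] e e0; have : h^-1 *: ((f \o shift t) (h *: 1) - f t) @[h --> 0^'] --> D.
  by rewrite -Df; exact: df.
move=> /cvgrPdist_lt/(_ e e0); rewrite near_withinE => /nbhs_ballP[r /= r0 rP].
exists r => // s st; have [->|ts] := eqVneq s t.
  by rewrite !subrr scale0r subrr !normr0 mulr0.
have st0 : s - t != 0 by rewrite subr_eq0.
have := rP (s - t); rewrite /ball/= sub0r normrN => /(_ st st0).
rewrite /shift/= [_ *: 1]mulr1 subrK => /ltW h.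
have -> : f s - f t - (s - t) *: D =
    (s - t) *: - (D - (s - t)^-1 *: (f s - f t)).
  by rewrite opprB scalerBr scalerA mulfV// scale1r.
by rewrite normrZ normrN mulrC ler_wpM2r.
Qed.

Lemma unit_itv_dense (R : realType) (t e : R) : 0 <= t <= 1 -> 0 < e ->
  exists2 s, 0 < s < 1 & `|t - s| < e.
Proof.
move=> /andP[t0 t1] e0.
pose h := Num.min (1 / 2) (e / 2).
have h0 : 0 < h by rewrite lt_min !divr_gt0.
have h1 : h <= 1 / 2 by rewrite ge_min lexx.
have h2 : h <= e / 2 by rewrite ge_min lexx orbT.
exists (t + h * (1 / 2 - t)).
  by apply/andP; split; nra.
rewrite opprD addNKr normrN normrM (gtr0_norm h0).
have : `|1 / 2 - t| <= 1 by rewrite ler_norml; apply/andP; split; lra.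
by have := normr_ge0 (1 / 2 - t); nra.
Qed.

Section straight_lines.
Context (R : realType) (d : nat) (S : set ('rV[R]_d * 'rV[R]_d)).
Variable l : curve R d.
Hypotheses (Smon : monotone_set S) (acl : abs_continuous l).
Hypothesis trl : forall t, 0 < t < 1 -> trace S (t, at_time l t).
Hypothesis odel : {ae lebesgue_measure, forall t : measurableTypeR R, 0 < t < 1 ->
  is_derive (t : R) (1 : R) (at_time l)
    ((endpoints S t (at_time l t)).2 - (endpoints S t (at_time l t)).1)}.

Let p t := endpoints S t (at_time l t).
Let w t := (p t).2 - (p t).1.

Lemma abs_continuous_uniform (e : R) : 0 < e -> exists2 del : R, 0 < del &
  forall s t, 0 <= s <= 1 -> 0 <= t <= 1 -> `|s - t| < del ->
    `|at_time l s - at_time l t| < e.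
Proof.
move=> /acl[del del0 delP]; exists del => // s t.
wlog st : s t / s <= t => [wl|/andP[s0 s1] /andP[t0 t1]].
  have [st|ts] := leP s t; first exact: wl.
  by move=> s1 t1; rewrite distrC [X in _ -> X < _]distrC; apply: wl => //; exact: ltW.
rewrite distrC ger0_norm ?subr_ge0// => std; rewrite distrC.
apply: le_lt_trans (normr_le_enorm _) _.
have := delP 1%N (fun=> s) (fun=> t); rewrite !big_ord1; apply => //.
by move=> i j; rewrite !ord1 eqxx.
Qed.

Lemma curve_endpoints t : 0 < t < 1 -> S (p t) /\ interp t (p t) = at_time l t.
Proof. by move=> t01; exact: endpoints_trace (trl t01). Qed.

Variables (a b : R).
Hypotheses (a0 : 0 < a) (ab : a <= b) (b1 : b < 1).

(** The sum of the two Lipschitz constants of the inverse of [interp t], uniform for t in [a, b],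
    times the factor from the sup norm to the Euclidean norm. The added 1 makes it positive, also in
    dimension 0. *)
Let C : R := ((1 - b)^-1 + a^-1) * Num.sqrt d%:R + 1.

Let C0 : 0 < C.
Proof.
rewrite ltr_wpDl// mulr_ge0 ?sqrtr_ge0// addr_ge0 ?invr_ge0 ?subr_ge0 ?ltW//.
Qed.

(* The right-hand side is o(t - s) wherever the curve has derivative w s, so the
   endpoints have derivative 0 there. *)
Lemma endpoints_lipschitz s t : a <= s <= b -> a <= t <= b ->
  enorm ((p t).1 - (p s).1) + enorm ((p t).2 - (p s).2) <=
  C * `|at_time l t - at_time l s - (t - s) *: w s|.
Proof.
move=> /andP[as_ sb] /andP[at_ tb].
have s01 : 0 < s < 1 by rewrite (lt_le_trans a0)// (le_lt_trans sb).
have t01 : 0 < t < 1 by rewrite (lt_le_trans a0)// (le_lt_trans tb).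
have [Ss ls] := curve_endpoints s01; have [St lt_] := curve_endpoints t01.
have := interp_fst_le Smon t01 St Ss; have := interp_snd_le Smon t01 St Ss.
have -> : interp t (p t) - interp t (p s) =
    at_time l t - at_time l s - (t - s) *: w s.
  by rewrite lt_ -[in RHS]ls -interp_slope opprB addrA subrK.
set z := _ - _ *: _ => h2 h1.
apply: le_trans (lerD h1 h2) _; rewrite -mulrDl.
apply: le_trans (_ : ((1 - b)^-1 + a^-1) * enorm z <= _).
  rewrite ler_wpM2r ?enorm_ge0// lerD//.
    by rewrite lef_pV2 ?posrE ?subr_gt0 ?lerD2l ?lerN2//; case/andP: t01.
  by rewrite lef_pV2 ?posrE//; case/andP: t01.
have i0 : 0 <= (1 - b)^-1 + a^-1 by rewrite addr_ge0 ?invr_ge0 ?subr_ge0 ?ltW.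
apply: le_trans (ler_wpM2l i0 (enorm_le_normr z)) _.
by rewrite mulrA ler_wpM2r// /C lerDl.
Qed.

(** With this bound, [endpoints_lipschitz] controls the increments of the endpoints by those of the
    curve and of time, so the endpoints inherit absolute continuity. The bound itself comes from
    comparing each time with [a], the curve being bounded on [a, b]. *)
Lemma velocity_bounded : exists2 M : R, 0 < M &
  forall s, a <= s <= b -> `|w s| <= M.
Proof.
have [a0' ab' b1'] := And3 a0 ab b1.
have in01 x : a <= x <= b -> 0 <= x <= 1.
  by move=> /andP[ax xb]; rewrite (le_trans (ltW a0) ax) (le_trans xb (ltW b1)).
have : {within `[a, b], continuous (fun s => `|at_time l s| : R)}.
  apply/subspace_continuousP => s; rewrite /= in_itv/= => sab.
  apply/cvgrPdist_lt => e /abs_continuous_uniform[del del0 delP].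
  rewrite near_withinE; apply/nbhs_ballP; exists del => //= t.
  rewrite /ball/= in_itv/= => std tab.
  by apply: le_lt_trans (ler_dist_dist _ _) _; apply: delP => //; exact: in01.
move=> /(EVT_max ab)[c cab cmax].
pose L : R := `|at_time l c|.
have lL s : a <= s <= b -> `|at_time l s| <= L.
  by move=> sab; apply: cmax; rewrite in_itv.
have aab : a <= a <= b by rewrite lexx.
exists (`|w a| + C * (L + L + 1 * `|w a|) + 1).
  by rewrite ltr_wpDl// addr_ge0// mulr_ge0 ?(ltW C0)// !addr_ge0 ?mulr_ge0 ?normr_ge0.
move=> s sab; have := endpoints_lipschitz aab sab => h.
have : `|w s - w a| <= C * `|at_time l s - at_time l a - (s - a) *: w a|.
  apply: le_trans h; rewrite [leRHS]addrC.
  rewrite (_ : w s - w a = (p s).2 - (p a).2 - ((p s).1 - (p a).1)).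
    apply: le_trans (ler_normB _ _) _.
    by apply: lerD; exact: normr_le_enorm.
  by rewrite /w; apply/rowP => i; rewrite !mxE; ring.
have : `|at_time l s - at_time l a - (s - a) *: w a| <= L + L + 1 * `|w a|.
  apply: le_trans (ler_normB _ _) _; apply: lerD.
    by apply: le_trans (ler_normB _ _) _; apply: lerD; exact: lL.
  rewrite normrZ ler_wpM2r// ler_norml; case/andP: sab => ? ?; apply/andP; split; lra.
move=> /(ler_wpM2l (ltW C0)) h1 h2.
have := ler_normD (w s - w a) (w a); rewrite subrK => h3.
by lra.
Qed.

(** The increment inequality is used with slope 0. Only one inequality is claimed; the opposite one
    follows by applying it to the opposite of [f]. *)
Lemma endpoints_coord_const (f : 'rV[R]_d * 'rV[R]_d -> R) :
  (forall q q', `|f q - f q'| <= enorm (q.1 - q'.1) + enorm (q.2 - q'.2)) ->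
  f (p a) <= f (p b).
Proof.
have [a0' ab' b1'] := And3 a0 ab b1.
move=> lipf; rewrite -subr_ge0 -[leLHS](mul0r (b - a)).
have lip s t : a <= s <= b -> a <= t <= b -> `|f (p t) - f (p s)| <=
    C * `|at_time l t - at_time l s - (t - s) *: w s|.
  by move=> sab tab; apply: le_trans (lipf _ _) _; exact: endpoints_lipschitz.
apply: (@ac_increment_ge R (fun t => f (p t))) => //.
  move=> e e0; have [M M0 wM] := velocity_bounded.
  (* Half of [e] is spent on the increments of the curve and half on the displacement at speed at
     most [M], both amplified by [C]. *)
  have eC0 : 0 < e / (2 * C) by rewrite divr_gt0 ?mulr_gt0.
  have eCM0 : 0 < e / (2 * C * M) by rewrite divr_gt0 ?mulr_gt0.
  have [del del0 delP] := acl eC0.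
  exists (Num.min del (e / (2 * C * M))); first by rewrite lt_min del0.
  move=> n A B AB disj; rewrite lt_min => /andP[h1 h2].
  have {}delP : \sum_(i < n) enorm (at_time l (B i) - at_time l (A i)) < e / (2 * C).
    apply: delP => // i; have [aA [AB' Bb]] := AB i; split; first by lra.
    by split=> //; lra.
  apply: le_lt_trans (_ : \sum_(i < n) C *
      (enorm (at_time l (B i) - at_time l (A i)) + M * (B i - A i)) < e).
    apply: ler_sum => i _; have [aA [AB' Bb]] := AB i.
    have Aab : a <= A i <= b by apply/andP; split; lra.
    apply: le_trans (lip (A i) (B i) _ _) _; first by [].
      by apply/andP; split; lra.
    rewrite ler_wpM2l ?(ltW C0)//; apply: le_trans (ler_normB _ _) _.
    apply: lerD; first exact: normr_le_enorm.
    rewrite normrZ ger0_norm ?subr_ge0// mulrC.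
    by rewrite ler_wpM2r ?subr_ge0// wM.
  rewrite -mulr_sumr big_split/= -mulr_sumr mulrDr.
  have -> : e = C * (e / (2 * C)) + C * (M * (e / (2 * C * M))).
    by field; rewrite !gt_eqF.
  by apply: ltrD; rewrite ltr_pM2l// ltr_pM2l.
apply: filterS odel => t /= odet /andP[at_ tb] e e0.
have t01 : 0 < t < 1 by rewrite (lt_trans a0)// (lt_trans tb).
(* The Lipschitz estimate is centred at the time [t] of differentiability, where its right-hand side
   is the first-order remainder of the curve. *)
have [del del0 delP] := is_derive_approx (odet t01) (divr_gt0 e0 C0).
exists del => // u v au ut tv vb uvd.
have tab : a <= t <= b by rewrite !ltW.
have h1 : `|f (p v) - f (p t)| <= e * (v - t).
  apply: le_trans (lip _ _ tab _) _; first by apply/andP; split; lra.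
  rewrite mulrC -ler_pdivlMr// mulrAC.
  have /delP : `|v - t| < del by rewrite ger0_norm ?subr_ge0//; lra.
  by rewrite [X in _ <= _ * X]ger0_norm ?subr_ge0.
have h2 : `|f (p u) - f (p t)| <= e * (t - u).
  apply: le_trans (lip _ _ tab _) _; first by apply/andP; split; lra.
  rewrite mulrC -ler_pdivlMr// mulrAC.
  have /delP : `|u - t| < del by rewrite distrC ger0_norm ?subr_ge0//; lra.
  by rewrite [X in _ <= _ * X]distrC [X in _ <= _ * X]ger0_norm ?subr_ge0.
move: h1 h2; rewrite !ler_norml => /andP[? ?] /andP[? ?].
by lra.
Qed.

End straight_lines.

Lemma straight_line (R : realType) (d : nat) (S : set ('rV[R]_d * 'rV[R]_d))
    (l : curve R d) : monotone_set S -> abs_continuous l ->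
  (forall t, 0 < t < 1 -> trace S (t, at_time l t)) ->
  {ae lebesgue_measure, forall t : measurableTypeR R, 0 < t < 1 ->
    is_derive (t : R) (1 : R) (at_time l)
    ((endpoints S t (at_time l t)).2 - (endpoints S t (at_time l t)).1)} ->
  exists2 q, S q & forall t, 0 <= t <= 1 -> at_time l t = interp t q.
Proof.
move=> Smon acl trl odel; pose p t := endpoints S t (at_time l t).
have le_const (f : 'rV[R]_d * 'rV[R]_d -> R) a b :
    (forall q q', `|f q - f q'| <= enorm (q.1 - q'.1) + enorm (q.2 - q'.2)) ->
    0 < a -> a <= b -> b < 1 -> f (p a) = f (p b).
  move=> lipf a0 ab b1; apply/le_anti/andP; split.
    exact: (endpoints_coord_const Smon acl trl odel a0 ab b1 lipf).
  rewrite -lerN2.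
  apply: (endpoints_coord_const Smon acl trl odel a0 ab b1 (f := fun q => - f q)).
  by move=> q q'; rewrite -opprD normrN.
have pconst a b : 0 < a -> a <= b -> b < 1 -> p a = p b.
  move=> a0 ab b1; rewrite [LHS]surjective_pairing [RHS]surjective_pairing.
  congr pair; apply/rowP => i.
    apply: (le_const (fun q => q.1 ord0 i)) => // q q'.
    rewrite -[leLHS]addr0 lerD ?enorm_ge0//.
    by have := coord_le_enorm (q.1 - q'.1) i; rewrite !mxE.
  apply: (le_const (fun q => q.2 ord0 i)) => // q q'.
  rewrite -[leLHS]add0r lerD ?enorm_ge0//.
  by have := coord_le_enorm (q.2 - q'.2) i; rewrite !mxE.
have h01 : 0 < (2^-1 : R) < 1 by rewrite invr_gt0 invf_lt1// ltr1n andbT.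
have lin t : 0 < t < 1 -> at_time l t = interp t (p 2^-1).
  move=> /andP[t0 t1]; have [h0 h1] := andP h01.
  have <- : p t = p 2^-1.
    by have [th|ht] := leP t 2^-1; [exact: pconst|rewrite -(pconst _ _ h0 (ltW ht))].
  by have [_ ->] := curve_endpoints trl (introT andP (conj t0 t1)).
exists (p 2^-1); first by have [] := curve_endpoints trl h01.
(* Times 0 and 1 are reached by continuity: a nearby [s] inside the interval is chosen so that
   neither the curve nor the segment moves by more than e/2. *)
move=> t t01; apply/eqP; rewrite -subr_eq0 -normr_le0.
apply/ler_addgt0Pr => e e0; rewrite add0r.
have [del del0 delP] := abs_continuous_uniform acl (divr_gt0 e0 (ltr0n R 2)).
set q := p 2^-1; pose W := `|q.2 - q.1| + 1.
have W0 : 0 < W by rewrite ltr_wpDl.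
have [|s s01 ts] := unit_itv_dense t01 (_ : 0 < Num.min del (e / 2 / W)).
  by rewrite lt_min del0 !divr_gt0.
move: ts; rewrite lt_min => /andP[td tW].
rewrite (_ : _ - _ = (at_time l t - at_time l s) - (t - s) *: (q.2 - q.1)); last first.
  by rewrite -interp_slope (lin s s01) opprB addrA subrK.
apply: le_trans (ler_normB _ _) _; rewrite [e]splitr.
apply: lerD; first by apply/ltW/delP => //; case/andP: s01 => ? ?; rewrite !ltW.
rewrite normrZ; apply: le_trans (_ : `|t - s| * W <= _).
  by rewrite ler_wpM2l// lerDl.
by rewrite -ler_pdivlMr// ltW.
Qed.

(** * Smooth bump functions determine a measure *)

Section smooth_functions.
Context (R : realType).
Implicit Types V W : normedModType R.

Lemma smooth_differentiable V (f : V -> R) (x : V) : smooth f -> differentiable f x.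
Proof. by move=> /(_ 1%N)[]. Qed.

Lemma smooth_continuous V (f : V -> R) : smooth f -> continuous f.
Proof. by move=> /(_ 0%N). Qed.

Lemma smooth_derive V (f : V -> R) (u : V) : smooth f -> smooth ('D_u f).
Proof. by move=> sf n; have [_ Df] := sf n.+1; exact: Df. Qed.

(** A coinduction principle: a class of differentiable functions stable under all directional
    derivatives consists of smooth functions. *)
Lemma smooth_ind V (P : (V -> R) -> Prop) :
  (forall f, P f -> (forall x, differentiable f x) /\ forall u, P ('D_u f)) ->
  forall f, P f -> smooth f.
Proof.
move=> step f Pf n; elim: n f Pf => [|n IH] f /step[df Df] /=.
  by move=> x; exact: differentiable_continuous.
by split=> // u; exact: IH.
Qed.

Lemma smooth_cst V (c : R) : smooth (cst c : V -> R).
Proof.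
apply: (@smooth_ind V (fun f => exists c, f = cst c)); last by exists c.
move=> _ [{}c ->]; split=> [x|u]; first exact: differentiable_cst.
by exists 0; apply/funext => x; rewrite derive_cst.
Qed.

Lemma of_class_C_add V n (f g : V -> R) :
  of_class_C n f -> of_class_C n g -> of_class_C n (f + g).
Proof.
elim: n f g => [|n IH] f g /=; first by move=> cf cg x; apply: cvgD; [exact: cf|exact: cg].
move=> [df Df] [dg Dg]; split=> [x|u]; first exact: differentiableD.
have -> : 'D_u (f + g) = 'D_u f + 'D_u g.
  by apply/funext => x; rewrite deriveD//; exact: diff_derivable.
exact: IH.
Qed.

Lemma smoothD V (f g : V -> R) : smooth f -> smooth g -> smooth (f + g).
Proof. by move=> sf sg n; exact: of_class_C_add. Qed.

Lemma smoothM V (f g : V -> R) : smooth f -> smooth g -> smooth (f * g).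
Proof.
move=> sf sg n; elim: n f g sf sg => [|n IH] f g sf sg /=.
  by move=> x; apply: cvgM; exact: smooth_continuous.
split=> [x|u]; first by apply: differentiableM; exact: smooth_differentiable.
have -> : 'D_u (f * g) = f * 'D_u g + g * 'D_u f.
  apply/funext => x.
  by rewrite deriveM//; apply: diff_derivable; exact: smooth_differentiable.
by apply: of_class_C_add; apply: IH => //; exact: smooth_derive.
Qed.

(** Here [L] is the linear part of [a]. The difference quotient of the composite along [u] is that
    of [f] along [L u], so the class of such composites is stable under derivatives and no chain
    rule is invoked. *)
Lemma smooth_comp_affine V W (a : V -> W) (L : V -> W) (f : W -> R) :
  (forall h u x, a (h *: u + x) = h *: L u + a x) ->
  (forall x, differentiable a x) -> smooth f -> smooth (f \o a).
Proof.
move=> aL da sf; apply: (@smooth_ind V (fun h => exists2 f, smooth f & h = f \o a));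
  last by exists f.
move=> _ [{sf}f sf ->]; split=> [x|u].
  by apply: differentiable_comp; [exact: da|exact: smooth_differentiable].
exists ('D_(L u) f); first exact: (smooth_derive (L u) sf).
apply/funext => x; rewrite /derive.
rewrite (_ : (fun h => _) = (fun h => h^-1 *:
  ((f \o shift (a x)) (h *: L u) - f (a x))))//.
by apply/funext => h; rewrite /shift/= aL.
Qed.

(* P(1/x) exp(-1/x), extended by 0 to x <= 0: these functions are stable
   under differentiation. *)
Definition flat (P : {poly R}) (x : R) : R :=
  if 0 < x then P.[x^-1] * expR (- x^-1) else 0.

Lemma expR_pow_bound (k : nat) (s : R) : 0 <= s ->
  s ^+ k * expR (- s) <= k`!%:R.
Proof.
move=> s0; rewrite expRN -ler_pdivlMr ?invr_gt0 ?expR_gt0// invrK.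
case: k => [|k]; first by rewrite expr0 mul1r -(expR0 R) ler_expR.
have h : s ^+ k.+1 / k.+1`!%:R <= expR s.
  by apply: le_trans (expR_ge1Dxn k s0); rewrite lerDr.
by move: h; rewrite ler_pdivrMr ?ltr0n ?fact_gt0// mulrC.
Qed.

(** Quadratic decay is what makes the derivative at 0 vanish. After division by x^2 the monomial of
    degree i becomes x^-(i+2) exp(-1/x), which is at most (i+2)!. *)
Lemma flat_bound (P : {poly R}) : exists2 C : R, 0 <= C &
  forall x, `|flat P x| <= C * x ^+ 2.
Proof.
pose C := \sum_(i < size P) `|P`_i| * (i + 2)`!%:R.
exists C; first by apply: sumr_ge0 => i _; rewrite mulr_ge0.
move=> x; rewrite /flat; case: ifPn => x0; last first.
  by rewrite normr0 mulr_ge0 ?sqr_ge0//; apply: sumr_ge0 => i _; rewrite mulr_ge0.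
rewrite -ler_pdivrMr ?exprn_gt0// horner_coef mulr_suml.
rewrite -[_ / _]ger0_norm ?divr_ge0 ?sqr_ge0// normrM normr_id -normrM mulr_suml.
apply: le_trans (ler_norm_sum _ _ _) _; apply: ler_sum => i _.
have s0 : 0 <= x^-1 by rewrite invr_ge0 ltW.
have -> : P`_i * x^-1 ^+ i * expR (- x^-1) / x ^+ 2 =
    P`_i * (x^-1 ^+ (i + 2) * expR (- x^-1)) by rewrite exprD [x^-1 ^+ 2]exprVn; ring.
rewrite normrM ler_wpM2l// ger0_norm ?expR_pow_bound//.
by rewrite mulr_ge0 ?expR_ge0 ?exprn_ge0.
Qed.

(** For x > 0 the derivative of P(1/x) exp(-1/x) is x^-2 (P - P')(1/x) exp(-1/x). *)
Definition flat_deriv (P : {poly R}) : {poly R} := 'X^2 * (P - P^`()).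

Lemma is_derive_flat (P : {poly R}) (x : R) :
  is_derive x 1 (flat P) (flat (flat_deriv P) x).
Proof.
have [x0|x0|->] := ltgtP x 0.
- rewrite /flat (lt_gtF x0).
  apply: (near_eq_is_derive (f := cst 0)).
  have : nbhs x [set y | y < 0] by apply: open_nbhs_nbhs; split => //; exact: open_lt.
  by apply: filterS => y /= y0; rewrite (lt_gtF y0).
- have dV : is_derive x 1 (fun y : R => y^-1) (- x ^- 2 *: 1).
    by apply: (@is_deriveV R id); rewrite gt_eqF.
  have d1 := is_derive1_comp (is_derive_poly P (x^-1)) dV.
  have dN : is_derive x 1 (fun y : R => - y^-1) (- (- x ^- 2 *: 1)).
    exact: is_deriveN dV.
  have d2 := is_derive1_comp (g := fun y : R => - y^-1) (is_derive_expR (- x^-1)) dN.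
  have d12 : is_derive x 1 ((horner P \o (fun y : R => y^-1)) *
      (expR \o (fun y => - y^-1))) (flat (flat_deriv P) x).
    apply: is_derive_eq (is_deriveM d1 d2) _.
    rewrite /flat x0 /flat_deriv hornerM hornerXn hornerD hornerN /=.
    by rewrite /GRing.scale/= exprVn; ring.
  apply: near_eq_is_derive d12.
  have : nbhs x [set y | 0 < y] by apply: open_nbhs_nbhs; split => //; exact: open_gt.
  by apply: filterS => y /= y0; rewrite /flat y0.
have -> : flat (flat_deriv P) 0 = 0 by rewrite /flat ltxx.
have [C C0 PC] := flat_bound P.
have cv : h^-1 *: ((flat P \o shift 0) (h *: (1 : R)) - flat P 0)
    @[h --> (0 : R)^'] --> (0 : R).
  apply/cvgrPdist_lt => e e0; rewrite near_withinE; apply/nbhs_ballP.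
  exists (e / (C + 1)); first by rewrite /= divr_gt0// ltr_wpDl.
  move=> h; rewrite /ball/= sub0r normrN => he h0.
  rewrite sub0r normrN /shift/= addr0 [_ *: 1]mulr1.
  have -> : flat P 0 = 0 by rewrite /flat ltxx.
  rewrite subr0 normrZ normfV -ltr_pdivlMl ?invr_gt0 ?normr_gt0// invrK.
  apply: le_lt_trans (PC h) _; rewrite -real_normK ?num_real// expr2 mulrA.
  rewrite [ltRHS]mulrC ltr_pM2r ?normr_gt0//.
  move: he; rewrite ltr_pdivlMr ?ltr_wpDl// => he.
  by have := normr_ge0 h; lra.
by split; [exact: (cvgP _ cv)|exact: cvg_lim cv].
Qed.

Lemma smooth_flat (P : {poly R}) : smooth (flat P).
Proof.
apply: (@smooth_ind R (fun f => exists P, f = flat P)); last by exists P.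
move=> _ [{}P ->]; have dfl x : differentiable (flat P) x.
  by apply/derivable1_diffP; have [] := is_derive_flat P x.
split=> // u; exists (u *: flat_deriv P); apply/funext => x.
rewrite deriveE// -[u]mulr1 [_ * 1]/(u *: 1) linearZ/= -deriveE//.
have [_ ->] := is_derive_flat P x.
by rewrite /flat; case: ifP => _; rewrite ?scaler0// hornerZ /GRing.scale/= mulrA mulr1.
Qed.

Lemma flat1_itv (x : R) : 0 <= flat 1 x <= 1.
Proof.
rewrite /flat; case: ifPn => x0; last by rewrite lexx ler01.
by rewrite hornerC mul1r expR_ge0 expR_le1 oppr_le0 invr_ge0 ltW.
Qed.

Lemma flat1_gt0 (x : R) : (0 < flat 1 x) = (0 < x).
Proof.
rewrite /flat; case: ifPn => x0; last by rewrite ltxx.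
by rewrite hornerC mul1r expR_gt0.
Qed.

End smooth_functions.

Definition bump (R : realType) (V : normedModType R) (f : V -> R) :=
  [/\ smooth f, compactly_supported f & forall x, 0 <= f x <= 1].

Section bump_functions.
Context (R : realType).
Implicit Types V W : normedModType R.

Lemma compactly_supported_sub V (f : V -> R) (K : set V) :
  compact K -> (forall x, f x != 0 -> K x) -> compactly_supported f.
Proof.
move=> cK fK; have clK : closed K := compact_closed (@norm_hausdorff _ _) cK.
apply: (subclosed_compact (@closed_closure _ _) cK).
by rewrite [X in _ `<=` X]((closure_id K).1 clK); exact: closureS.
Qed.

Lemma compact_supports V (f : V -> R) : compactly_supported f ->
  exists2 K, compact K & forall x, f x != 0 -> K x.
Proof.
by move=> cf; exists (closure [set x | f x != 0]) => // x fx; exact: subset_closure.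
Qed.

Lemma bump0 V : bump (cst 0 : V -> R).
Proof.
split; [exact: smooth_cst| |by move=> x /=; rewrite lexx ler01].
by apply: (compactly_supported_sub compact0) => x; rewrite eqxx.
Qed.

(** The union of two independent events, in terms of probabilities: a smooth substitute for the
    maximum that keeps values in [0, 1] and vanishes only where both functions do. *)
Lemma bump_or V (f g : V -> R) : bump f -> bump g ->
  bump (fun x => 1 - (1 - f x) * (1 - g x)).
Proof.
move=> [sf cf f01] [sg cg g01]; split.
- rewrite (_ : (fun _ => _) = f + (g + cst (-1) * (f * g))).
    by apply: smoothD => //; apply: smoothD => //; apply: smoothM;
      [exact: smooth_cst|exact: smoothM].
  by apply/funext => x; rewrite !fctE /=; ring.
- have [K cK fK] := compact_supports cf; have [L cL gL] := compact_supports cg.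
  apply: (compactly_supported_sub (compactU cK cL)) => x.
  have [->|/fK] := eqVneq (f x) 0; last by left.
  have [->|/gL] := eqVneq (g x) 0; last by right.
  by rewrite !subr0 mulr1 subrr eqxx.
- move=> x; have /andP[f0 f1] := f01 x; have /andP[g0 g1] := g01 x.
  by apply/andP; split; nra.
Qed.

Lemma bump_pow V (f : V -> R) n : bump f -> bump (fun x => 1 - (1 - f x) ^+ n).
Proof.
move=> bf; elim: n => [|n IH].
  by rewrite (_ : (fun _ => _) = cst 0); [exact: bump0|apply/funext => x; rewrite expr0 subrr].
rewrite (_ : (fun _ => _) = (fun x => 1 - (1 - f x) * (1 - (1 - (1 - f x) ^+ n)))).
  exact: bump_or.
by apply/funext => x; rewrite exprS; ring.
Qed.

Lemma bump_prod V (f : nat -> V -> R) n : (forall i, bump (f i)) ->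
  bump (fun x => 1 - \prod_(i < n) (1 - f i x)).
Proof.
move=> bf; elim: n => [|n IH].
  rewrite (_ : (fun _ => _) = cst 0); first exact: bump0.
  by apply/funext => x; rewrite big_ord0 subrr.
rewrite (_ : (fun _ => _) =
    (fun x => 1 - (1 - (1 - \prod_(i < n) (1 - f i x))) * (1 - f n x))).
  exact: bump_or.
by apply/funext => x; rewrite big_ord_recr/=; ring.
Qed.

(** The approximation is 1 minus the product over i < n of (1 - psi i x)^n. Outside [U] every factor
    is 1. Inside, one psi i x is positive, and from n > i on the product is squeezed between 0 and
    (1 - psi i x)^n, which tends to 0. *)
Lemma bump_indicator V (psi : nat -> V -> R) (U : set V) :
  (forall n, bump (psi n)) -> (forall x, U x <-> exists n, 0 < psi n x) ->
  exists2 F : nat -> V -> R, forall n, bump (F n) &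
    forall x, F n x @[n --> \oo] --> (\1_U x : R).
Proof.
move=> bpsi Upsi.
pose F n (x : V) : R := 1 - \prod_(i < n) (1 - (1 - (1 - psi i x) ^+ n)).
exists F.
  move=> n; apply: (@bump_prod V (fun i x => 1 - (1 - psi i x) ^+ n)) => i.
  exact: bump_pow (bpsi i).
have psi01 i x : 0 <= 1 - psi i x <= 1.
  by have [_ _ /(_ x)/andP[? ?]] := bpsi i; apply/andP; split; lra.
move=> x; have [Ux|nUx] := pselect (U x); last first.
  rewrite indicE memNset//= (_ : F^~ x = cst 0); first exact: cvg_cst.
  apply/funext => n /=.
  rewrite /F big1 ?subrr// => i _; have -> : psi i x = 0.
    apply/eqP; rewrite eq_le; have [_ _ /(_ x)/andP[-> _]] := bpsi i.
    by rewrite andbT leNgt; apply/negP => p0; apply: nUx; apply/Upsi; exists i.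
  by rewrite !subr0 expr1n subrr subr0.
rewrite indicE mem_set// -[X in _ --> X]subr0.
apply: cvgB; first exact: cvg_cst.
have [i pi0] := (Upsi x).1 Ux.
have pi1 : `|1 - psi i x| < 1.
  by rewrite ger0_norm; [lra|case/andP: (psi01 i x)].
apply: (@squeeze_cvgr _ _ _ _ (fun=> 0) (fun n => (1 - psi i x) ^+ n));
  [|exact: cvg_cst|exact: cvg_expr].
exists i.+1 => // n /= ni; have -> : \prod_(j < n) (1 - (1 - (1 - psi j x) ^+ n)) =
    \prod_(j < n) (1 - psi j x) ^+ n by apply: eq_bigr => j _; rewrite subKr.
have p01 j : 0 <= (1 - psi j x) ^+ n <= 1.
  by have /andP[? ?] := psi01 j x; rewrite exprn_ge0//= exprn_ile1.
rewrite prodr_ge0 /=; last by move=> j _; case/andP: (p01 j).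
rewrite (bigD1 (Ordinal ni))//= ler_piMr//; first by case/andP: (p01 i).
by apply: prodr_ile1 => j _; exact: p01.
Qed.

Definition bump_base V (psi : nat -> V -> R) := (forall n, bump (psi n)) /\
  forall (U : set V) x, open U -> U x ->
    exists2 n, 0 < psi n x & forall y, 0 < psi n y -> U y.

Lemma bump_base_indicator V (psi : nat -> V -> R) (U : set V) : bump_base psi ->
  open U -> exists2 F : nat -> V -> R, forall n, bump (F n) &
    forall x, F n x @[n --> \oo] --> (\1_U x : R).
Proof.
move=> [bpsi base] oU; apply: (@bump_indicator _ (fun n =>
    if pselect (forall y, 0 < psi n y -> U y) then psi n else cst 0)).
  by move=> n; case: pselect => ?; [exact: bpsi|exact: bump0].
move=> x; split=> [Ux|[n]]; last first.
  by case: pselect => //= h; [exact: h|rewrite ltxx].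
by have [n px pU] := base U x oU Ux; exists n; case: pselect.
Qed.

Lemma smooth_prod (I : Type) (r : seq I) V (f : I -> V -> R) :
  (forall i, smooth (f i)) -> smooth (fun x => \prod_(i <- r) f i x).
Proof.
move=> sf; elim: r => [|i r IH].
  rewrite (_ : (fun _ => _) = cst 1); first exact: smooth_cst.
  by apply/funext => x; rewrite big_nil.
rewrite (_ : (fun _ => _) = f i * (fun x => \prod_(j <- r) f j x)).
  exact: smoothM.
by apply/funext => x; rewrite big_cons.
Qed.

Lemma smooth_flat_sub (d : nat) (i : 'I_d) (c a : R) :
  smooth (fun x : 'rV[R]_d => flat 1 (c * x ord0 i + a)).
Proof.
apply: (@smooth_comp_affine _ _ _ (fun x : 'rV[R]_d => c * x ord0 i + a)
  (fun x => c * x ord0 i)); last exact: smooth_flat.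
  by move=> h u x; rewrite !mxE /GRing.scale/=; ring.
move=> x; apply: differentiableD; last exact: differentiable_cst.
by apply: differentiableM; [exact: differentiable_cst|exact: differentiable_coord].
Qed.

(** Balls of the sup norm are cubes, so a product over the coordinates of two [flat 1] factors, one
    for each face, is positive exactly on a given ball. Rational centres and radii 1/(k+1) keep the
    family countable. *)
Lemma bump_base_rV (d : nat) : exists psi : nat -> 'rV[R]_d -> R, bump_base psi.
Proof.
pose side (q : 'rV[rat]_d) (k : nat) (i : 'I_d) (x : 'rV[R]_d) : R :=
  flat 1 (1 * x ord0 i + (k.+1%:R^-1 - ratr (q ord0 i))) *
  flat 1 (-1 * x ord0 i + (k.+1%:R^-1 + ratr (q ord0 i))).
pose box q k (x : 'rV[R]_d) : R := \prod_(i < d) side q k i x.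
have side01 q k i x : 0 <= side q k i x <= 1.
  have /andP[a0 a1] := flat1_itv (1 * x ord0 i + (k.+1%:R^-1 - ratr (q ord0 i))).
  have /andP[b0 b1] := flat1_itv (-1 * x ord0 i + (k.+1%:R^-1 + ratr (q ord0 i))).
  by rewrite mulr_ge0//= mulr_ile1.
have sideP q k i x : (0 < side q k i x) =
    (`|ratr (q ord0 i) - x ord0 i| < k.+1%:R^-1).
  have /andP[a0 _] := flat1_itv (1 * x ord0 i + (k.+1%:R^-1 - ratr (q ord0 i))).
  have /andP[b0 _] := flat1_itv (-1 * x ord0 i + (k.+1%:R^-1 + ratr (q ord0 i))).
  have -> : (0 < side q k i x) =
     (0 < flat 1 (1 * x ord0 i + (k.+1%:R^-1 - ratr (q ord0 i)))) &&
     (0 < flat 1 (-1 * x ord0 i + (k.+1%:R^-1 + ratr (q ord0 i)))).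
    by rewrite !lt0r a0 b0 mulr_ge0// !andbT mulf_eq0 negb_or.
  rewrite !flat1_gt0 ltr_norml; set e := k.+1%:R^-1; set y := ratr _.
  by apply/andP/andP => -[? ?]; split; lra.
have box01 q k x : 0 <= box q k x <= 1.
  rewrite prodr_ge0/=; last by move=> i _; case/andP: (side01 q k i x).
  by apply: prodr_ile1 => i _; exact: side01.
have boxP q k x : 0 < box q k x <-> ball (map_mx ratr q : 'rV[R]_d) k.+1%:R^-1 x.
  split=> [bx|[_ h]]; last first.
    by apply: prodr_gt0 => i _; rewrite sideP; have := h ord0 i; rewrite !mxE.
  split=> [|i j]; first by rewrite invr_gt0.
  rewrite !ord1 !mxE; have : 0 < side q k j x.
    rewrite lt0r; have /andP[-> _] := side01 q k j x; rewrite andbT.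
    by apply/eqP => s0; move: bx; rewrite /box (bigD1 j)//= s0 mul0r ltxx.
  by rewrite sideP.
have bbox q k : bump (box q k).
  split; last exact: box01.
    by apply: smooth_prod => i; apply: smoothM; exact: smooth_flat_sub.
  apply: (@compactly_supported_sub _ _
      (closed_ball (map_mx ratr q : 'rV[R]_d) k.+1%:R^-1)).
    apply: bounded_closed_compact; last exact: closed_ball_closed.
    exists (`|map_mx ratr q : 'rV[R]_d| + k.+1%:R^-1); split; first exact: num_real.
    move=> M hM x; rewrite closed_ballE ?invr_gt0//= /closed_ball_/= => qx.
    have := ler_distD (map_mx ratr q : 'rV[R]_d) 0 x; rewrite !sub0r !normrN => h.
    by apply: le_trans h _; apply: le_trans (ltW hM); rewrite lerD2l.
  move=> x bx; apply: subset_closure; apply/boxP; rewrite lt0r bx.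
  by case/andP: (box01 q k x).
exists (fun n => if unpickle n is Some (q, k) then box q k else cst 0); split.
  by move=> n; case: unpickle => [[q k]|]; [exact: bbox|exact: bump0].
move=> U x oU Ux.
have [q [k [xq qU]]] := dense_ball (@ball_rat_mx R 1 d) oU Ux.
exists (pickle (q, k)); rewrite pickleK; last by move=> y /boxP; exact: qU.
apply/boxP; apply: ball_sym; apply: le_ball xq.
by rewrite ler_pdivrMr// ler_peMr ?invr_ge0// ler1n.
Qed.

Lemma smooth_fst V W (f : V -> R) : smooth f -> smooth (fun p : V * W => f p.1).
Proof.
move=> sf; apply: (@smooth_comp_affine R (V * W)%type V fst fst f) => // p.
by apply: linear_differentiable; exact: continuous_fst.
Qed.

Lemma smooth_snd V W (f : W -> R) : smooth f -> smooth (fun p : V * W => f p.2).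
Proof.
move=> sf; apply: (@smooth_comp_affine R (V * W)%type W snd snd f) => // p.
by apply: linear_differentiable; exact: continuous_snd.
Qed.

Lemma bump_base_prod V W (psi : nat -> V -> R) (phi : nat -> W -> R) :
  bump_base psi -> bump_base phi ->
  exists chi : nat -> V * W -> R, bump_base chi.
Proof.
move=> [bpsi psiP] [bphi phiP].
exists (fun n => if unpickle n is Some (i, j)
  then (fun p => psi i p.1 * phi j p.2) else cst 0); split.
  move=> n; case: unpickle => [[i j]|]; last exact: bump0.
  have [sf /compact_supports[K cK fK] f01] := bpsi i.
  have [sg /compact_supports[L cL gL] g01] := bphi j.
  split.
  - rewrite (_ : (fun _ => _) = (fun p : V * W => psi i p.1) * (fun p => phi j p.2))//.
    by apply: smoothM; [exact: smooth_fst|exact: smooth_snd].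
  - apply: (compactly_supported_sub (compact_setX cK cL)) => p.
    by rewrite mulf_eq0 negb_or => /andP[/fK ? /gL ?].
  - move=> p; have /andP[f0 f1] := f01 p.1; have /andP[g0 g1] := g01 p.2.
    by rewrite mulr_ge0//= mulr_ile1.
move=> U [x y] oU Uxy.
have [[P Q]/= [Px Qy] PQU] : nbhs (x, y) U by exact: open_nbhs_nbhs.
move: Px Qy; rewrite !nbhsE => -[P' [oP' P'x] P'P] [Q' [oQ' Q'y] Q'Q].
have [i pi PiP] := psiP _ _ oP' P'x; have [j pj PjQ] := phiP _ _ oQ' Q'y.
exists (pickle (i, j)); rewrite pickleK//=; first by rewrite mulr_gt0.
move=> [a b] /=; have [_ _ /(_ a)/andP[f0 _]] := bpsi i.
have [_ _ /(_ b)/andP[g0 _]] := bphi j => fg.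
apply: PQU; split=> /=.
  apply/P'P/PiP; rewrite lt0r f0 andbT; apply/eqP => f00.
  by move: fg; rewrite f00 mul0r ltxx.
apply/Q'Q/PjQ; rewrite lt0r g0 andbT; apply/eqP => g00.
by move: fg; rewrite g00 mulr0 ltxx.
Qed.

End bump_functions.

(** * Measures determined by integrals against bumps *)

Section determining.
Context (R : realType).

Lemma measure_limit_unique (dT : measure_display) (T : measurableType dT)
    (P Q : probability T R) (F : nat -> T -> R) (U : set T) :
  measurable U -> (forall n, measurable_fun setT (F n)) ->
  (forall n x, 0 <= F n x <= 1) ->
  (forall x, F n x @[n --> \oo] --> (\1_U x : R)) ->
  (forall n, (\int[P]_x (F n x)%:E = \int[Q]_x (F n x)%:E)%E) -> P U = Q U.
Proof.
move=> mU mF F01 Fcv PQ.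
have lim (m : probability T R) :
    (\int[m]_x (F n x)%:E)%E @[n --> \oo] --> m U.
  have [] := @dominated_convergence _ _ _ m setT measurableT
    (fun n x => (F n x)%:E) (fun x => (\1_U x)%:E) (EFin \o cst 1).
  - by move=> n; apply/measurable_EFinP; exact: mF.
  - by apply/measurable_EFinP; exact: measurable_indic.
  - by apply: aeW => x _; apply: cvg_EFin; [exact: nearW|exact: Fcv].
  - exact: finite_measure_integrable_cst.
  - by apply: aeW => x n _; rewrite /= lee_fin ger0_norm; case/andP: (F01 n x).
  by move=> _ _; rewrite integral_indic// setIT.
apply: (cvg_unique _ (lim P)) => //.
rewrite (_ : (fun n => _) = (fun n => \int[Q]_x (F n x)%:E)%E); first exact: lim.
by apply/funext => n; exact: PQ.
Qed.

Lemma continuous_measurable_mx (d : nat) (f : 'rV[R]_d -> R) : continuous f ->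
  measurable_fun setT f.
Proof.
move=> /continuousP cf; apply: measurable_fun_open_real => U oU.
by rewrite setTI; apply: open_measurable_mx; exact: cf.
Qed.

Lemma continuous_measurable_mx2 (d : nat) (f : 'rV[R]_d * 'rV[R]_d -> R) :
  continuous f -> measurable_fun setT f.
Proof.
move=> /continuousP cf; apply: measurable_fun_open_real => U oU.
by rewrite setTI; apply: open_measurable_mx2; exact: cf.
Qed.

(** The product sigma-algebra is generated by measurable rectangles; uniqueness of measures needs it
    generated by the open sets, on which the two measures will be compared. *)
Lemma measurable_openE2 (d : nat) :
  @measurable _ ('rV[R]_d * 'rV[R]_d)%type = <<s @open ('rV[R]_d * 'rV[R]_d)%type >>.
Proof.
apply/seteqP; split; last first.
  apply: smallest_sub; first exact: sigma_algebra_measurable.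
  by move=> U oU; exact: open_measurable_mx2.
rewrite measurable_prod_measurableType; apply: smallest_sub.
  exact: smallest_sigma_algebra.
pose T := g_sigma_algebraType (@open ('rV[R]_d * 'rV[R]_d)%type).
have m1 : measurable_fun setT (fst : T -> 'rV[R]_d).
  apply: measurable_fun_open_mx => U oU; rewrite setTI.
  apply: sub_sigma_algebra; move: U oU; apply/continuousP; exact: continuous_fst.
have m2 : measurable_fun setT (snd : T -> 'rV[R]_d).
  apply: measurable_fun_open_mx => U oU; rewrite setTI.
  apply: sub_sigma_algebra; move: U oU; apply/continuousP; exact: continuous_snd.
move=> _ [A mA [B mB <-]].
have -> : A `*` B = (setT `&` fst @^-1` A) `&` (setT `&` snd @^-1` B).
  by rewrite !setTI.
exact: (@measurableI _ T _ _ (m1 measurableT A mA) (m2 measurableT B mB)).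
Qed.

Lemma open_measure_unique (dT : measure_display) (T : measurableType dT)
    (O : set (set T)) (P Q : probability T R) : measurable = <<s O >> ->
  setI_closed O -> O setT -> (forall U, O U -> P U = Q U) ->
  forall A, measurable A -> P A = Q A.
Proof.
move=> mO OI OT PQ; apply: (measure_unique O (fun=> setT)) => //.
  by rewrite bigcup_const//; exists 0%N.
by move=> k; apply: le_lt_trans (probability_le1 P measurableT) (ltry _).
Qed.

Lemma bump_determines_mx (d : nat) (P Q : probability 'rV[R]_d R) :
  (forall f : 'rV[R]_d -> R, bump f ->
     (\int[P]_x (f x)%:E = \int[Q]_x (f x)%:E)%E) ->
  forall A, measurable A -> P A = Q A.
Proof.
move=> PQ; apply: (@open_measure_unique _ _ (@open 'rV[R]_d)) => //.
- by move=> A B; exact: openI.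
- exact: openT.
move=> U oU; have [psi bpsi] := bump_base_rV R d.
have [F bF Fcv] := bump_base_indicator bpsi oU.
apply: (@measure_limit_unique _ _ P Q F) => //.
- exact: open_measurable_mx.
- by move=> n; apply: continuous_measurable_mx; have [/smooth_continuous] := bF n.
- by move=> n; have [] := bF n.
- by move=> n; exact: PQ.
Qed.

Lemma bump_determines_mx2 (d : nat)
    (P Q : probability ('rV[R]_d * 'rV[R]_d)%type R) :
  (forall f : 'rV[R]_d * 'rV[R]_d -> R, bump f ->
     (\int[P]_x (f x)%:E = \int[Q]_x (f x)%:E)%E) ->
  forall A, measurable A -> P A = Q A.
Proof.
move=> PQ; apply: (@open_measure_unique _ _ (@open ('rV[R]_d * 'rV[R]_d)%type)) => //.
- exact: measurable_openE2.
- by move=> A B; exact: openI.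
- exact: openT.
move=> U oU; have [psi0 bpsi0] := bump_base_rV R d.
have [psi bpsi] := bump_base_prod bpsi0 bpsi0.
have [F bF Fcv] := bump_base_indicator bpsi oU.
apply: (@measure_limit_unique _ _ P Q F) => //.
- exact: open_measurable_mx2.
- by move=> n; apply: continuous_measurable_mx2; have [/smooth_continuous] := bF n.
- by move=> n; have [] := bF n.
- by move=> n; exact: PQ.
Qed.

End determining.

(** * Monotone sets are graphs almost everywhere *)

Lemma product_sigma_finite (d1 d2 : measure_display) (T1 : measurableType d1)
    (T2 : measurableType d2) (R : realType)
    (m1 : {sigma_finite_measure set T1 -> \bar R})
    (m2 : {sigma_finite_measure set T2 -> \bar R}) :
  sigma_finite setT (m1 \x m2)%E.
Proof.
have [F FT Ffin] := sigma_finiteT m1; have [G GT Gfin] := sigma_finiteT m2.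
exists (fun n => if unpickle n is Some (i, j) then F i `*` G j else set0).
  apply/seteqP; split=> // -[x y] _.
  have : [set: T1] x by []; rewrite FT => -[i _ Fx].
  have : [set: T2] y by []; rewrite GT => -[j _ Gy].
  by exists (pickle (i, j)) => //; rewrite pickleK.
move=> n; case: unpickle => [[i j]|]; last by rewrite measure0.
have [mF Foo] := Ffin i; have [mG Goo] := Gfin j; split; first exact: measurableX.
by rewrite product_measure1E// lte_mul_pinfty// ge0_fin_numE.
Qed.

Section sigma_finite_image.
Context (d1 d2 : measure_display) (T1 : measurableType d1) (T2 : measurableType d2).
Context (R : realType) (m : {measure set T1 -> \bar R}).
Variables (f : T1 -> T2) (g : T2 -> T1).
Hypotheses (mf : measurable_fun setT f) (mg : measurable_fun setT g).
Hypotheses (fK : cancel f g) (sfm : sigma_finite setT m).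

(** A pushforward of a sigma-finite measure need not be sigma-finite; the left inverse [g]
    transports an exhausting sequence to the target. *)
Definition sf_image := pushforward m f.

Let sf_image0 : sf_image set0 = 0%E.
Proof. by rewrite /sf_image /pushforward preimage_set0 measure0. Qed.

Let sf_image_ge0 A : (0 <= sf_image A)%E.
Proof. exact: measure_ge0. Qed.

Let sf_image_sigma_additive : semi_sigma_additive sf_image.
Proof.
move=> F mF tF mUF; rewrite /sf_image /pushforward preimage_bigcup.
apply: measure_semi_sigma_additive.
- by move=> n; rewrite -[X in measurable X]setTI; exact: mf.
- apply/trivIsetP => i j _ _ ij; rewrite -preimage_setI.
  by move/trivIsetP : tF => /(_ _ _ _ _ ij) ->//; rewrite preimage_set0.
- by rewrite -preimage_bigcup -[X in measurable X]setTI; exact: mf.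
Qed.

HB.instance Definition _ := isMeasure.Build _ _ _ sf_image
  sf_image0 sf_image_ge0 sf_image_sigma_additive.

Let sf_image_sigma_finite : sigma_finite setT sf_image.
Proof.
have [F FT Ffin] := sfm.
exists (fun n => g @^-1` F n); first by rewrite -preimage_bigcup -FT preimage_setT.
move=> n; have [mF Foo] := Ffin n; split.
  by rewrite -[X in measurable X]setTI; exact: mg.
rewrite /sf_image /pushforward (_ : _ @^-1` _ = F n)//.
by apply/seteqP; split=> x; rewrite /preimage/= fK.
Qed.

HB.instance Definition _ := Measure_isSigmaFinite.Build _ _ _ sf_image
  sf_image_sigma_finite.

Definition sf_image_measure : {sigma_finite_measure set T2 -> \bar R} := sf_image.

End sigma_finite_image.

Section lebesgue_null.
Context (R : realType).

Definition append (n : nat) (p : measurableTypeR R * 'rV[R]_n) : 'rV[R]_n.+1 :=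
  (row_mx p.1%:M p.2 : 'rV[R]_(1 + n)).

Definition unappend (n : nat) (z : 'rV[R]_n.+1) : measurableTypeR R * 'rV[R]_n :=
  (z ord0 ord0, rsubmx (z : 'rV[R]_(1 + n))).

Lemma appendK n : cancel (@append n) (@unappend n).
Proof.
move=> [t z]; rewrite /unappend /append; congr pair; last by rewrite row_mxKr.
transitivity ((row_mx t%:M z : 'rV[R]_(1 + n)) ord0 (lshift n (ord0 : 'I_1))).
  by congr (row_mx _ _ _ _); exact/val_inj.
by rewrite row_mxEl mxE eqxx.
Qed.

Lemma append_lift n (p : measurableTypeR R * 'rV[R]_n) (i : 'I_n) :
  append p ord0 (lift ord0 i) = p.2 ord0 i.
Proof.
transitivity ((row_mx p.1%:M p.2 : 'rV[R]_(1 + n)) ord0 (rshift 1 i)).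
  by congr (row_mx _ _ _ _); exact/val_inj.
by rewrite row_mxEr.
Qed.

Lemma append_ord0 n (p : measurableTypeR R * 'rV[R]_n) : append p ord0 ord0 = p.1.
Proof. by case: p => t z; have [] := appendK (t, z). Qed.

Lemma measurable_append n : measurable_fun setT (@append n).
Proof.
apply: measurable_fun_open_mx => U oU; rewrite setTI.
apply: open_measurable_time; rewrite openE => p Up.
have /nbhs_ballP[e /= e0 eU] : nbhs (append p) U by exact: open_nbhs_nbhs.
apply/nbhs_ballP; exists e => // q [/= pq1 [_ pq2]]; apply: eU; split=> // i j.
rewrite !ord1; case: (unliftP ord0 j) => [k ->|->].
  by rewrite !append_lift.
by rewrite !append_ord0.
Qed.

Lemma measurable_unappend n : measurable_fun setT (@unappend n).
Proof.
apply: measurable_fun_pair.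
  apply: measurable_fun_open_real => U oU; rewrite setTI.
  apply: open_measurable_mx; move: U oU; apply/continuousP.
  exact: (@coord_continuous R 1 n.+1 ord0 ord0).
apply: measurable_fun_open_mx => U oU; rewrite setTI.
apply: open_measurable_mx; apply: open_ball_sub => z Uz.
have /nbhs_ballP[e /= e0 eU] : nbhs (rsubmx (z : 'rV[R]_(1 + n))) U.
  exact: open_nbhs_nbhs.
exists e => // y [/= _ zy]; apply: eU; split=> // i j.
by rewrite !mxE.
Qed.

(** [lebesgue] is a bare set function. Induction over its recursion finds a sigma-finite measure
    behind it, which is what the exchange of integrals requires. *)
Lemma lebesgue_sigma_finite (d : nat) :
  exists m : {sigma_finite_measure set 'rV[R]_d -> \bar R},
    (m : set 'rV[R]_d -> \bar R) = @lebesgue R d.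
Proof.
elim: d => [|n [m mE]]; first by exists (\d_(0 : 'rV[R]_0)).
exists (sf_image_measure (m := (lebesgue_measure \x m)%E) (@measurable_append n)
  (@measurable_unappend n) (@appendK n) (product_sigma_finite _ _)).
by rewrite /= -mE.
Qed.

Definition thin_along (d : nat) (i : 'I_d) (A : set 'rV[R]_d) :=
  forall x y, A x -> A y -> (forall j, j != i -> x ord0 j = y ord0 j) -> x = y.

(** Fubini, by induction on the dimension. The order of integration depends on whether [i] is the
    coordinate split off by the recursion. *)
Lemma thin_null (d : nat) (i : 'I_d) (A : set 'rV[R]_d) :
  measurable A -> thin_along i A -> @lebesgue R d A = 0%E.
Proof.
elim: d i A => [[]//|n IH] i A mA thinA.
pose B := @append n @^-1` A.
have mB : measurable B by rewrite -[B]setTI; exact: measurable_append.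
have [m mE] := lebesgue_sigma_finite n.
have -> : @lebesgue R n.+1 A = (lebesgue_measure \x m)%E B by rewrite mE.
case: (unliftP ord0 i) => [k ik|i0].
  (* Freezing the first coordinate leaves a set that is thin along [k], in one dimension less. *)
  rewrite /product_measure1; apply: integral0_eq => t _ /=.
  rewrite mE; apply: (IH k); first exact: measurable_xsection.
  move=> x y; rewrite !xsectionE => Bx By xy.
  have E : append (t, x) = append (t, y).
    apply: thinA => // j; case: (unliftP ord0 j) => [l ->|-> _].
      by rewrite !append_lift ik (inj_eq lift_inj) => /xy.
    by rewrite !append_ord0.
  by have := congr1 (@unappend n) E; rewrite !appendK => -[].
(* Here the first coordinate is the thin direction: it is integrated first, and each section has at
   most one point. *)
rewrite (@product_measure_unique _ _ _ _ _ _ _ (lebesgue_measure \x^ m)%E)//.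
  rewrite /product_measure2; apply: integral0_eq => z _ /=.
  have [[t Bt]|nB] := pselect (exists t, B (t, z)).
    rewrite (_ : ysection B z = [set t]) ?lebesgue_measure_set1//.
    apply/seteqP; split=> [s|_ ->]; rewrite ysectionE// => Bs.
    have E : append (s, z) = append (t, z).
      apply: thinA => // j; case: (unliftP ord0 j) => [l -> _|->].
        by rewrite !append_lift.
      by rewrite i0 eqxx.
    by have := congr1 (@unappend n) E; rewrite !appendK => -[].
  rewrite (_ : ysection B z = set0) ?measure0//.
  by apply/seteqP; split=> // t; rewrite ysectionE => Bt; apply: nB; exists t.
by move=> A1 A2 mA1 mA2; exact: product_measure2E.
Qed.

End lebesgue_null.

Section graph.
Context (R : realType) (d : nat).
Local Notation Rd := 'rV[R]_d.

Lemma probability_setI_full (dT : measure_display) (T : measurableType dT)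
    (P : probability T R) (A Z : set T) : measurable A -> measurable Z ->
  P Z = 1%E -> P (A `&` Z) = P A.
Proof.
move=> mA mZ PZ; rewrite -[in RHS](setIT A) -(setUv Z) setIUr measureU.
- rewrite [X in (_ + X)%E](_ : _ = 0%E) ?adde0//=.
  apply/eqP; rewrite -measure_le0; apply: (@le_trans _ _ (P (~` Z))).
    apply: le_measure; rewrite ?inE//; last exact: measurableC.
    by apply: measurableI => //; exact: measurableC.
  by rewrite probability_setC// PZ subee.
- exact: measurableI.
- by apply: measurableI => //; exact: measurableC.
- by rewrite setIACA setICr setI0.
Qed.

Definition below (S : set (Rd * Rd)) (i : 'I_d) (q : R) : set Rd :=
  fst @` (S `&` [set p : Rd * Rd | p.2 ord0 i <= q]).

Definition above (S : set (Rd * Rd)) (i : 'I_d) (q : R) : set Rd :=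
  fst @` (S `&` [set p : Rd * Rd | q <= p.2 ord0 i]).

Lemma measurable_fst_image (S C : set (Rd * Rd)) : closed S -> closed C ->
  measurable (fst @` (S `&` C)).
Proof.
move=> cS cC; apply: sigma_compact_measurable_rV; apply: sigma_compact_image.
  exact: continuous_fst.
by apply: sigma_compact_rV2; exact: closedI.
Qed.

Lemma continuous_snd_coord (i : 'I_d) : continuous (fun p : Rd * Rd => p.2 ord0 i).
Proof.
move=> p; apply: (@continuous_comp _ Rd R snd (fun x : Rd => x ord0 i)).
  exact: continuous_snd.
exact: coord_continuous.
Qed.

(** If x exceeds y in coordinate [i] only, monotonicity forbids a partner of x at most [q] in that
    coordinate when y has one at least [q']. Two points of the intersection can play both roles, so
    neither exceeds the other. *)
Lemma thin_below_above (S : set (Rd * Rd)) (i : 'I_d) (q q' : R) :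
  monotone_set S -> q < q' -> thin_along i (below S i q `&` above S i q').
Proof.
move=> Smon qq'; have no_step x y : below S i q x -> above S i q' y ->
    (forall j, j != i -> x ord0 j = y ord0 j) -> x ord0 i <= y ord0 i.
  move=> [[x1 y1] [/= S1 y1q] <-] [[x2 y2] [/= S2 y2q] <-] xy; rewrite leNgt.
  apply/negP => lt12; have := Smon _ _ S1 S2; rewrite /dot (bigD1 i)//= big1.
    rewrite !mxE addr0 => h; have h1 : 0 < x1 ord0 i - x2 ord0 i by rewrite subr_gt0.
    by move: h; rewrite pmulr_rge0// subr_ge0; lra.
  by move=> j ji; rewrite !mxE xy// subrr mul0r.
move=> x y [bx ax] [by_ ay] xy; apply/rowP => j.
have [->|/xy//] := eqVneq j i.
apply/le_anti/andP; split; first exact: no_step.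
by apply: no_step => // k /xy.
Qed.

Lemma graph_of_monotone (S : set (Rd * Rd)) (mu0 : probability Rd R)
    (gam : probability (Rd * Rd)%type R) :
  monotone_set S -> closed S -> gam S = 1%E ->
  (forall A, measurable A -> gam (A `*` setT) = mu0 A) ->
  mu0 `<< @lebesgue R d ->
  exists (D : set Rd) (u : Rd -> Rd), induced_by_map mu0 gam D u /\
    forall x, D x -> S (x, u x) /\ forall y, S (x, y) -> y = u x.
Proof.
move=> Smon cS gS g1 ac.
have mS : measurable S.
  by rewrite -[S]setCK; apply: measurableC; apply: open_measurable_mx2; exact: closed_openC.
pose cut (c : 'I_d * (rat * rat)) : set Rd := if ratr c.2.1 < ratr c.2.2 :> R
  then below S c.1 (ratr c.2.1) `&` above S c.1 (ratr c.2.2) else set0.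
have mcut c : measurable (cut c).
  rewrite /cut; case: ifP => // _; apply: measurableI.
    apply: measurable_fst_image => //.
    apply: (@preimage_closed _ R _ [set r | r <= _]); last exact: closed_le.
    by move=> p _; exact: continuous_snd_coord.
  apply: measurable_fst_image => //.
  apply: (@preimage_closed _ R _ [set r | _ <= r]); last exact: closed_ge.
  by move=> p _; exact: continuous_snd_coord.
have cut0 c : mu0 (cut c) = 0%E.
  apply: (ac (cut c) _ (cut c) (mcut c) (@subset_refl _ _)) => B mB Bc.
  rewrite /cut in Bc; case: ifPn Bc => [lt_c|_] Bc.
    apply: (thin_null mB (i := c.1)) => x y /Bc Ax /Bc Ay.
    exact: (thin_below_above Smon lt_c).
  have [m mE] := lebesgue_sigma_finite R d.
  by rewrite -mE (_ : B = set0) ?measure0//; apply/seteqP; split.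
pose M := \bigcup_n (if unpickle n is Some c then cut c else set0).
have mM : measurable M.
  by apply: bigcupT_measurable => n; case: unpickle => [c|//]; exact: mcut.
have M0 : mu0 M = 0%E.
  apply/eqP; rewrite -measure_le0.
  apply: le_trans (measure_sigma_subadditive _ _ _ (@subset_refl _ _)) _ => //.
    by move=> n; case: unpickle => [c|//]; exact: mcut.
  by rewrite eseries0// => n _ _; case: unpickle => [c|]; [exact: cut0|exact: measure0].
(* Outside [M], two partners of the same point cannot differ in a coordinate: two rationals would
   fit in between and put the point in a cut. *)
pose D := fst @` S `\` M.
have mfS : measurable (fst @` S).
  by have := measurable_fst_image cS (@closedT _); rewrite setIT.
have mD : measurable D by exact: measurableD.
have D1 : mu0 D = 1%E.
  apply/eqP; rewrite eq_le probability_le1//=.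
  have -> : mu0 D = mu0 (fst @` S `&` ~` M) by [].
  rewrite probability_setI_full//; last 2 first.
  - exact: measurableC.
  - by rewrite probability_setC// M0 sube0.
  rewrite -g1// -gS; apply: le_measure; rewrite ?inE//.
    exact: measurableX.
  by move=> p Sp; split=> //=; exists p.
have uniqD x y y' : ~ M x -> S (x, y) -> S (x, y') -> y = y'.
  move=> nM Sy Sy'; apply/rowP => i.
  suff le_ z z' : S (x, z) -> S (x, z') -> z' ord0 i <= z ord0 i.
    by apply/le_anti/andP; split; exact: le_.
  move=> Sz Sz'; rewrite leNgt; apply/negP => zz'; apply: nM.
  have [q] := rat_in_itvoo zz'; rewrite in_itv/= => /andP[zq qz'].
  have [q'] := rat_in_itvoo qz'; rewrite in_itv/= => /andP[qq' q'z'].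
  exists (pickle (i, (q, q'))) => //; rewrite pickleK /cut /= qq'.
  by split; [exists (x, z)|exists (x, z')] => //; split=> //=; exact: ltW.
pose u x := if pselect (D x) then xget 0 [set y | S (x, y)] else 0.
have uP x : D x -> S (x, u x) /\ forall y, S (x, y) -> y = u x.
  move=> Dx; rewrite /u; case: pselect => // -[[[x' y] /= Sy x'x] nM].
  subst x'; have Su : S (x, xget 0 [set y | S (x, y)]).
    by case: xgetP => [_ _ //|/(_ y)].
  by split=> // y' Sy'; exact: uniqD nM Sy' Su.
have mu_ : measurable_fun setT u.
  apply: measurable_fun_open_mx => U oU; rewrite setTI.
  have mK : measurable (fst @` (S `&` snd @^-1` (~` U))).
    apply: measurable_fst_image => //; apply: preimage_closed.
      by move=> p _; exact: continuous_snd.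
    exact: open_closedC.
  (* On [D] the partner is unique, so it lies in [U] exactly when no partner lies in the closed
     complement; this makes the preimage a difference of Borel projections. Off [D] the value is the
     default 0. *)
  rewrite (_ : u @^-1` U = (D `\` fst @` (S `&` snd @^-1` (~` U))) `|`
      (if pselect (U 0) then ~` D else set0)).
    apply: measurableU; first exact: measurableD.
    by case: pselect => ? //=; exact: measurableC.
  apply/seteqP; split=> [x Uux|x [[Dx nK]|]].
  - have [Dx|nD] := pselect (D x).
      left; split=> // -[[x' y] [/= Sy nU] x'x]; subst x'; apply: nU.
      by have [_ /(_ y Sy) ->] := uP x Dx.
    right; move: Uux; rewrite /preimage/= {1}/u; case: pselect => [//|? U0].
    by case: pselect.
  - apply: contrapT => nU; apply: nK; exists (x, u x) => //.
    by split=> //; have [] := uP x Dx.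
  - by case: pselect => // U0 nD; rewrite /preimage/= /u; case: pselect.
exists D, u; split=> //; split=> //; first exact: measurable_funTS.
move=> A mA.
have mG : measurable (D `&` (fun x => (x, u x)) @^-1` A).
  apply: measurableI => //; rewrite -[X in measurable X]setTI.
  by apply: measurable_fun_pair => //; exact: measurable_id.
(* Both sides of the claim may be intersected with this set of full measure, on which a pair is
   determined by its first component. *)
have DT1 : gam (S `&` D `*` setT) = 1%E.
  by rewrite setIC probability_setI_full ?g1//; exact: measurableX.
have mSD : measurable (S `&` D `*` setT).
  by apply: measurableI => //; exact: measurableX.
rewrite -g1// -(probability_setI_full mA mSD DT1).
rewrite -(probability_setI_full (measurableX mG measurableT) mSD DT1).
congr (gam _); apply/seteqP; split=> [[x y] [/= Axy [Sxy [/= Dx _]]]|].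
  have [_ /(_ y Sxy) yu] := uP x Dx; subst y.
  by split=> //; split.
move=> [x y] [[/= [Dx Axu] _] [Sxy _]]; split=> //=.
by have [_ /(_ y Sxy) ->] := uP x Dx.
Qed.

End graph.

(** * The space of curves *)

Section curves_topology.
Context (R : realType) (d : nat).
Local Notation Rd := 'rV[R]_d.
Implicit Types (l g : curve R d) (p : Rd * Rd).

Lemma at_time_val l (t : set_type (@unit_itv R)) : at_time l (set_val t) = l t.
Proof.
have := valLK (0 : Rd) (l : set_type (@unit_itv R) -> Rd).
by move=> /(congr1 (fun f => f t)).
Qed.

Lemma unit_itv_set_val (t : R) : 0 <= t <= 1 ->
  exists t' : set_type (@unit_itv R), set_val t' = t.
Proof.
move=> t01; have tI : t \in @unit_itv R by rewrite inE /unit_itv/= in_itv.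
by exists (SigSub tI).
Qed.

Lemma set_val_unit_itv (t : set_type (@unit_itv R)) : 0 <= (set_val t : R) <= 1.
Proof. by have := set_valP t; rewrite /unit_itv/= in_itv. Qed.

Lemma at_time_out l (t : R) : ~~ (0 <= t <= 1) -> at_time l t = 0.
Proof.
move=> nt; rewrite /at_time /valL_ /= oinv_set_val insubN//.
by rewrite notin_setE /unit_itv/= in_itv/=; exact/negP.
Qed.

Lemma curve_ext l g : (forall t, 0 <= t <= 1 -> at_time l t = at_time g t) ->
  l = g.
Proof.
move=> lg; apply/continuousEP => t; rewrite -!at_time_val.
by apply: lg; exact: set_val_unit_itv.
Qed.

Lemma within_continuous_at_time l : {within @unit_itv R, continuous (at_time l)}.
Proof. by apply/subspace_valL_continuousP'; exact: cts_fun. Qed.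

Lemma curve_openP (A : set (curve R d)) : curve_open A <->
  forall l, A l -> exists2 e : R, 0 < e & forall g,
    (forall t, 0 <= t <= 1 -> `|at_time l t - at_time g t| < e) -> A g.
Proof.
split=> [[V oV <-] l Vl|opA].
  have /uniform_nbhs[E [entE EV]] : nbhs (l : {uniform set_type (@unit_itv R) -> Rd}) V.
    exact: open_nbhs_nbhs.
  move: entE; rewrite -entourage_ballE => -[e /= e0 eE].
  exists e => // g lg; apply: EV => t _; apply: eE => /=.
  by rewrite -ball_normE/= -!at_time_val; apply: lg; exact: set_val_unit_itv.
(* The uniform topology lives on all functions, continuous or not, so [A] is extended to a union of
   open balls around its curves. Writing distance at most e' < e leaves the room e - e' that shows
   openness. *)
pose V : set {uniform set_type (@unit_itv R) -> Rd} :=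
  [set h | exists l, A l /\ exists2 e : R, 0 < e &
     (forall g, (forall t, 0 <= t <= 1 -> `|at_time l t - at_time g t| < e) -> A g)
     /\ exists2 e' : R, e' < e & forall t, `|l t - h t| <= e'].
exists V.
  rewrite openE => h [l [Al [e e0 [lA [e' e'e lh]]]]].
  apply/uniform_nbhs; exists [set xy | ball xy.1 ((e - e') / 2) xy.2]; split.
    rewrite -entourage_ballE; exists ((e - e') / 2) => //=.
    by rewrite divr_gt0 ?subr_gt0.
  move=> k /= hk; exists l; split=> //; exists e => //; split=> //.
  exists (e' + (e - e') / 2); first by lra.
  move=> t; rewrite -(subrKA (h t)); apply: le_trans (ler_normD _ _) _.
  apply: lerD; first exact: lh.
  by have := hk t I; rewrite -ball_normE/= => /ltW.
apply/seteqP; split=> [g [l [Al [e e0 [lA [e' e'e lh]]]]]|l Al].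
  apply: lA => t /unit_itv_set_val[t' <-]; rewrite !at_time_val.
  exact: le_lt_trans (lh t') _.
have [e e0 lA] := opA l Al; exists l; split=> //; exists e => //; split=> //.
by exists 0 => // t; rewrite subrr normr0.
Qed.

Lemma curve_open_measurable (A : set (curve_space R d)) :
  @curve_open R d A -> measurable A.
Proof. by move=> oA; exact: sub_sigma_algebra. Qed.

Lemma curve_open_at_time (t : R) (U : set Rd) : open U ->
  @curve_open R d [set l | U (at_time l t)].
Proof.
move=> oU; apply/curve_openP => l /= Ult.
have [t01|nt] := boolP (0 <= t <= 1); last first.
  by exists 1 => // g _; rewrite at_time_out// -(at_time_out l nt).
have /nbhs_ballP[e /= e0 eU] : nbhs (at_time l t) U by exact: open_nbhs_nbhs.
by exists e => // g lg; apply: eU; rewrite -ball_normE; exact: lg.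
Qed.

Lemma measurable_at_time (t : R) :
  measurable_fun setT (fun l : curve_space R d => at_time l t).
Proof.
apply: measurable_fun_open_mx => U oU; rewrite setTI.
by apply: curve_open_measurable; exact: curve_open_at_time.
Qed.

(** Joint measurability in time and curve, needed for Fubini. By continuity of curves, the value at
    [t] is in [U] exactly when, for some basic interval [J i] around [t] and some basic [B j] with
    closure in [U], the curve stays in that closure during [J i]; there are countably many such
    pairs. *)
Lemma measurable_evaluation : measurable_fun setT
  (fun q : measurableTypeR R * curve_space R d => at_time q.2 q.1).
Proof.
apply: measurable_fun_open_mx => U oU; rewrite setTI.
have [B [oB bB]] := countable_base_mx R 1 d.
have [J [oJ bJ]] := countable_base_real R.
pose I : set (measurableTypeR R) := `[0, 1]%classic.
have mI : measurable I by exact: measurable_itv.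
pose F n := if unpickle n is Some (i, j) then
  if pselect (closure (B j) `<=` U) then
    (J i `&` I) `*` [set l : curve_space R d |
       forall s, J i s -> 0 <= s <= 1 -> closure (B j) (at_time l s)]
  else set0 else set0.
have mF n : measurable (F n).
  rewrite /F; case: unpickle => [[i j]|//]; case: pselect => //= _.
  apply: measurableX.
    by apply: measurableI => //; exact: measurable_realfun.open_measurable.
  rewrite -[X in measurable X]setCK; apply: measurableC.
  (* The union runs over uncountably many times, but it is a union of open sets and thus open. *)
  rewrite (_ : ~` _ = \bigcup_(s in [set s | J i s /\ 0 <= s <= 1])
      [set l | (~` closure (B j)) (at_time l s)]).
    apply: curve_open_measurable; apply/curve_openP => l [s Js ls].
    have oC : open (~` closure (B j)) by apply: closed_openC; exact: closed_closure.
    have [e e0 eP] := (curve_openP _).1 (curve_open_at_time s oC) l ls.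
    by exists e => // g /eP; exists s.
  apply/seteqP; split=> [l /= /existsNP[s /not_implyP[Js /not_implyP[s01 nl]]]|].
    by exists s.
  by move=> l [s [Js s01] nl] /= h; apply: nl; exact: h.
rewrite (_ : _ @^-1` _ = (\bigcup_n F n) `|`
    (if pselect (U 0) then (~` I) `*` setT else set0)).
  apply: measurableU; first exact: bigcupT_measurable.
  case: pselect => ? /=; last exact: measurable0.
  by apply: measurableX => //; exact: measurableC.
apply/seteqP; split=> [[t l] /= Ut|[t l] [[n _]|]] /=.
- have [t01|nt] := boolP (0 <= t <= 1); last first.
    right; case: pselect => [U0|]; first by split=> //=; rewrite /I/= in_itv/=; exact/negP.
    by rewrite (at_time_out l nt) in Ut.
  left; have /nbhs_ballP[e /= e0 eU] : nbhs (at_time l t) U by exact: open_nbhs_nbhs.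
  have e20 : 0 < e / 2 by rewrite divr_gt0.
  have [j Bj BU] := bB _ _ (ball_open (at_time l t) (e / 2)) (ballxx (at_time l t) e20).
  have clU : closure (B j) `<=` U.
    move=> z /(closureS BU) hz.
    have : closed_ball (at_time l t) (e / 2) z by exact: hz.
    rewrite closed_ballE// /closed_ball_/= => tz; apply: eU.
    by rewrite -ball_normE/=; apply: le_lt_trans tz _; lra.
  have /subspace_continuousP/(_ t) := @within_continuous_at_time l.
  rewrite /unit_itv/= in_itv/= => /(_ t01) /(_ (B j)).
  move=> /(_ (open_nbhs_nbhs (conj (oB j) Bj))) h.
  have {h} : nbhs t [set s | @unit_itv R s -> B j (at_time l s)] by exact: h.
  rewrite nbhsE => -[W [oW Wt] WB].
  have [i Jt JW] := bJ W t oW Wt.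
  exists (pickle (i, j)) => //; rewrite /F pickleK; case: pselect => [?|/(_ clU)//].
  split=> /=; first by split=> //; rewrite /I/= in_itv.
  by move=> s /JW/WB h s01; apply: subset_closure; apply: h; rewrite /unit_itv/= in_itv.
- rewrite /F; case: unpickle => [[i j]|//]; case: pselect => //= clU [/= [Jt It] h].
  by apply/clU/h => //; move: It; rewrite /I/= in_itv.
- case: pselect => // U0 [/= nI _]; rewrite at_time_out//.
  by apply/negP; move: nI; rewrite /I/= in_itv.
Qed.

Lemma continuous_line_fun p :
  continuous (fun t : set_type (@unit_itv R) => interp (set_val t : R) p).
Proof.
have cp : continuous (fun s : R => interp s p).
  move=> s; apply: (@continuous_comp R (R * (Rd * Rd))%type Rd
    (fun s : R => (s, p)) (fun q => interp q.1 q.2)).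
    exact: (cvg_pair (@cvg_id _ (nbhs s)) (@cvg_cst _ p _ (nbhs s) _)).
  exact: continuous_interp.
move=> t; apply: (@continuous_comp _ R Rd set_val (fun s => interp s p)).
  exact: initial_continuous.
exact: cp.
Qed.

Definition line p : curve R d :=
  HB.pack (fun t : set_type (@unit_itv R) => interp (set_val t : R) p)
    (isContinuous.Build _ _ _ (@continuous_line_fun p)).

Lemma at_time_line p (t : R) : 0 <= t <= 1 -> at_time (line p) t = interp t p.
Proof. by move=> /unit_itv_set_val[t' <-]; rewrite at_time_val. Qed.

Lemma abs_continuous_line p : abs_continuous (line p).
Proof.
move=> e e0; pose W := enorm (p.2 - p.1) + 1.
have W0 : 0 < W by rewrite ltr_wpDl// enorm_ge0.
exists (e / W); first by rewrite divr_gt0.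
move=> n a b ab _; rewrite ltr_pdivlMr// => abe; apply: le_lt_trans abe.
rewrite mulr_suml; apply: ler_sum => i _; have [a0 [ab_ b1]] := ab i.
rewrite !at_time_line.
- rewrite interp_slope enormZ ger0_norm ?subr_ge0// ler_wpM2l ?subr_ge0//.
  by rewrite lerDl.
- by rewrite a0 (le_trans ab_).
- by rewrite (le_trans a0).
Qed.

Lemma is_derive_interp p (t : R) : is_derive t (1 : R) (fun s : R => interp s p) (p.2 - p.1).
Proof.
have cv : h^-1 *: (((fun s : R => interp s p) \o shift t) (h *: (1 : R)) - interp t p) @[h --> (0 : R)^'] --> p.2 - p.1.
  apply/cvgrPdist_lt => e e0; rewrite near_withinE; apply: nearW => h h0.
  rewrite /shift/= interp_slope addrK [_ *: 1]mulr1 scalerA mulVf// scale1r.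
  by rewrite subrr normr0.
split; first exact: (cvgP _ cv).
exact: cvg_lim cv.
Qed.

Lemma is_derive_line p (t : R) : 0 < t < 1 ->
  is_derive t (1 : R) (at_time (line p)) (p.2 - p.1).
Proof.
move=> t01; apply: near_eq_is_derive (is_derive_interp p t).
have : nbhs t `]0, 1[%classic.
  by apply: open_nbhs_nbhs; split; [exact: interval_open|rewrite /= in_itv].
apply: filterS => s /=; rewrite in_itv/= => /andP[s0 s1].
by rewrite at_time_line// !ltW.
Qed.

Lemma measurable_line :
  measurable_fun setT (line : Rd * Rd -> curve_space R d).
Proof.
apply: (@measurability _ _ _ (curve_space R d) setT (line : Rd * Rd -> curve_space R d) (@curve_open R d)) => // _ [A oA <-]; rewrite setTI.
apply: open_measurable_mx2; rewrite openE => p /= Ap.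
have [e e0 eA] := (curve_openP A).1 oA _ Ap.
apply/nbhs_ballP; exists (e / 2); first by rewrite /= divr_gt0.
move=> q [/= pq1 pq2]; apply: eA => t t01; rewrite !at_time_line//.
have -> : interp t p - interp t q = (1 - t) *: (p.1 - q.1) + t *: (p.2 - q.2).
  by apply/rowP => i; rewrite /interp !mxE; ring.
move: pq1 pq2; rewrite -!ball_normE/= => pq1 pq2; case/andP: t01 => t0 t1.
apply: le_lt_trans (ler_normD _ _) _; rewrite !normrZ !ger0_norm ?subr_ge0//.
have := normr_ge0 (p.1 - q.1); have := normr_ge0 (p.2 - q.2).
by nra.
Qed.

(** The segments form a closed set. A curve that is not a segment misses its own chord at some time
    by a vector [z]; a segment uniformly within |z|/4 would bound |z| by less than |z|/4 + |z|/4. *)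
Lemma measurable_line_range :
  measurable (range line : set (curve_space R d)).
Proof.
rewrite -[X in measurable X]setCK; apply: measurableC.
apply: curve_open_measurable; apply/curve_openP => l nl.
have [t t01 lt_] : exists2 t, 0 <= t <= 1 &
    at_time l t != interp t (at_time l 0, at_time l 1).
  apply: contrapT => h; apply: nl; exists (at_time l 0, at_time l 1) => //.
  apply: curve_ext => t t01; rewrite at_time_line//.
  by apply: contrapT => /eqP ne; apply: h; exists t => //; rewrite eq_sym.
rewrite -subr_eq0 in lt_; set z := _ - _ in lt_.
have z0 : 0 < `|z| by rewrite normr_gt0.
exists (`|z| / 4); first by rewrite divr_gt0.
move=> g lg [p _ pg]; have := lg t t01.
have := lg 0 (introT andP (conj (lexx _) ler01)).
have := lg 1 (introT andP (conj ler01 (lexx _))).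
rewrite -pg !at_time_line ?lexx ?ler01// interp0 interp1 => l1 l0 lgt.
have zE : z = (at_time l t - interp t p) - (1 - t) *: (at_time l 0 - p.1)
    - t *: (at_time l 1 - p.2).
  by rewrite /z; apply/rowP => i; rewrite /interp !mxE; ring.
have : `|z| <= `|at_time l t - interp t p| + (1 - t) * `|at_time l 0 - p.1|
    + t * `|at_time l 1 - p.2|.
  case/andP: t01 => t0 t1; rewrite {1}zE.
  apply: le_trans (ler_normB _ _) _; rewrite [`|t *: _|]normrZ (ger0_norm t0) lerD2r.
  by apply: le_trans (ler_normB _ _) _; rewrite [`|(1 - t) *: _|]normrZ ger0_norm ?subr_ge0.
have := normr_ge0 (at_time l 0 - p.1); have := normr_ge0 (at_time l 1 - p.2).
by case/andP: t01 => t0 t1; nra.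
Qed.

End curves_topology.

(** * A function of time that no curve can follow *)

Section spike.
Context (R : realType).
Local Notation mu := (@lebesgue_measure R).

Definition approx_derivative (f : R -> R) (t D : R) := forall e : R, 0 < e ->
  exists2 del : R, 0 < del & forall s, `|s - t| < del ->
    `|f s - f t - (s - t) * D| <= e * `|s - t|.

Lemma approx_derivative_slope (f : R -> R) (a b c t D : R) :
  approx_derivative f t D -> c <= D -> slope_ge f a b c t.
Proof.
move=> fD cD e e0; have [del del0 delP] := fD e e0.
exists del => // u v au ut tv vb uvd.
have : `|v - t| < del by rewrite ger0_norm ?subr_ge0//; lra.
have : `|u - t| < del by rewrite distrC ger0_norm ?subr_ge0//; lra.
move=> /delP h1 /delP h2; move: h1 h2.
rewrite [`|u - t|]distrC [`|v - t|]ger0_norm ?subr_ge0// [`|t - u|]ger0_norm ?subr_ge0//.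
rewrite !ler_norml => /andP[h1 h2] /andP[h3 h4].
have := ler_wpM2r (_ : 0 <= v - u) cD; rewrite subr_ge0 => /(_ (le_trans ut tv)).
by lra.
Qed.

(** An index codes a rational centre and an order k. In the radius 2^-(n + k), the n makes the total
    length of the spots finite and the k makes spots around a fixed centre as small as desired;
    height times length is 2k. *)
Let center (n : nat) : R := if (unpickle n : option (rat * nat)) is Some (q, _)
  then ratr q else 0.
Let order (n : nat) : nat := if (unpickle n : option (rat * nat)) is Some (_, k)
  then k else 0%N.
Let radius (n : nat) : R := ((2 ^ (n + order n))%:R)^-1.
Let height (n : nat) : R := (order n)%:R / radius n.
Let spot (n : nat) : set R := `]center n - radius n, center n + radius n[%classic.

Let radius_gt0 n : 0 < radius n.
Proof. by rewrite invr_gt0 ltr0n expn_gt0. Qed.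

Let height_ge0 n : 0 <= height n.
Proof. by rewrite divr_ge0// ltW. Qed.

(* In every interval some spot of arbitrarily large order k sits; there the
   spike integrates to at least 2k. *)
Definition spike (t : R) : R :=
  fine (\sum_(n <oo) (height n * \1_(spot n) t)%:E)%E.

Lemma measurable_spike : measurable_fun setT spike.
Proof.
apply: measurableT_comp => //.
rewrite (_ : (fun t => _) = (fun t =>
    \sum_(0 <= n <oo | n \in xpredT) (height n * \1_(spot n) t)%:E)%E)//.
apply: ge0_emeasurable_sum => [n t _ _|n _].
  by rewrite lee_fin mulr_ge0.
apply/measurable_EFinP; apply: measurable_funM; first exact: measurable_cst.
by apply: measurable_indic; exact: measurable_itv.
Qed.

(** Borel-Cantelli: the spot of index n has length at most 2 / 2^n, and these sum to 4. *)
Lemma spike_spots_null : mu (lim_sup_set spot) = 0%E.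
Proof.
apply: lim_sup_set_cvg0; first by move=> n; exact: measurable_itv.
apply: (@le_lt_trans _ _ (4 : R)%:E); last exact: ltry.
apply: le_trans (epsilon_trick0 xpredT (_ : 0 <= 4)) => //.
apply: lee_nneseries => [n _ _|n _]; first exact: measure_ge0.
have r0 := radius_gt0 n.
rewrite /spot /= lebesgue_measure_itv/= lte_fin ifT; last by lra.
rewrite -EFinB lee_fin.
have -> : center n + radius n - (center n - radius n) = 2 * radius n by ring.
have -> : 4 / (2 ^ n.+1)%:R = 2 * ((2 ^ n)%:R)^-1 :> R.
  by rewrite expnS natrM invfM mulrA; congr (_ * _); lra.
rewrite /radius.
rewrite ler_wpM2l// lef_pV2 ?posrE ?ltr0n ?expn_gt0// ler_nat.
by rewrite leq_exp2l// leq_addr.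
Qed.

(** Away from the null set only finitely many spots contain [t], so the series is a finite sum and
    [fine] returns its true value. *)
Lemma spike_ge n t : spot n t -> ~ lim_sup_set spot t -> height n <= spike t.
Proof.
move=> nt /existsNP[N /not_implyP[_ noN]].
have noM m : (N <= m)%N -> \1_(spot m) t = 0 :> R.
  by move=> Nm; rewrite indicE memNset// => mt; apply: noN; exists m.
have f0 k : (0%N <= k)%N -> (0 <= (height k * \1_(spot k) t)%:E)%E.
  by move=> _; rewrite lee_fin mulr_ge0.
rewrite /spike (nneseries_split 0 N f0) add0n eseries0; last first.
  by move=> m Nm _; rewrite noM// mulr0.
rewrite adde0 sumEFin /= big_mkord.
have nN : (n < N)%N.
  rewrite ltnNge; apply/negP => Nn; apply: noN; exists n => //.
rewrite (bigD1 (Ordinal nN))//= indicE mem_set// mulr1 lerDl.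
by apply: sumr_ge0 => i _; rewrite mulr_ge0.
Qed.

(** A single spot is enough: on one inside ]a, b[ of length below the modulus [del] for 1 and of
    order k > 0, the increment would be at least 2k, against less than 1 by absolute continuity. *)
Lemma spike_no_primitive (f : R -> R) (a b : R) : a < b ->
  abs_continuous_on f a b ->
  ~ {ae mu, forall t : measurableTypeR R, a < t < b -> approx_derivative f t (spike t)}.
Proof.
move=> ab ac aef; have [del del0 delP] := ac 1 ltr01.
have [q] := rat_in_itvoo ab; rewrite in_itv/= => /andP[aq qb].
pose m := Num.min (Num.min (ratr q - a) (b - ratr q)) (del / 2).
have m0 : 0 < m by rewrite !lt_min !subr_gt0 aq qb divr_gt0.
have [k k0 km] : exists2 k : nat, (0 < k)%N & ((2 ^ k)%:R)^-1 < m.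
  have [k _ ke] := near_infty_natSinv_lt (PosNum m0).
  exists k.+1 => //; apply: le_lt_trans (ke k (leqnn _)).
  by rewrite lef_pV2 ?posrE ?ltr0n ?expn_gt0// ler_nat ltnW// ltn_expl.
pose n := pickle (q, k).
have cE : center n = ratr q by rewrite /center pickleK.
have oE : order n = k by rewrite /order pickleK.
have r0 := radius_gt0 n.
have rm : radius n < m.
  apply: le_lt_trans km; rewrite /radius oE lef_pV2 ?posrE ?ltr0n ?expn_gt0//.
  by rewrite ler_nat leq_exp2l// leq_addl.
move: rm; rewrite !lt_min => /andP[/andP[rm1 rm2] rm3].
pose u := ratr q - radius n; pose v := ratr q + radius n.
have au : a <= u by rewrite /u; lra.
have vb : v <= b by rewrite /v; lra.
have uv : u <= v by rewrite /u /v; lra.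
have : height n * (v - u) <= f v - f u.
  apply: ac_increment_ge => //.
    move=> e /ac[d' d0 dP]; exists d' => // j A B AB; apply: dP => i.
    by have [? [? ?]] := AB i; split; [lra|split; lra].
  have aes : {ae mu, forall t : measurableTypeR R, ~ lim_sup_set spot t}.
    exists (lim_sup_set spot); split; last by move=> t /= /contrapT.
      apply: bigcap_measurable => // j _; apply: bigcup_measurable => i _.
      exact: measurable_itv.
    exact: spike_spots_null.
  apply: filterS2 aef aes => t /= ft nt /andP[ut tv].
  apply: approx_derivative_slope (ft _) (spike_ge _ nt).
    by apply/andP; split; lra.
  by rewrite /spot/= in_itv/= cE; apply/andP.
have -> : height n * (v - u) = 2 * k%:R.
  rewrite /height oE /u /v; field; exact: lt0r_neq0.
have := delP 1%N (fun=> u) (fun=> v); rewrite !big_ord1 => h1 h2.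
have : `|f v - f u| < 1.
  apply: h1 => //; first by move=> i j; rewrite !ord1 eqxx.
  by rewrite /u /v; lra.
rewrite ltr_norml => /andP[_ h3].
have : 1 <= k%:R :> R by rewrite ler1n.
by clear h1; lra.
Qed.

End spike.

(** * The velocity field *)

Section measurable_vectors.
Context (R : realType) (d : nat).
Local Notation Rd := 'rV[R]_d.
Context (dT : measure_display) (T : measurableType dT).

Lemma continuous_measurable_pair (f : Rd * Rd -> Rd) (a b : T -> Rd) :
  continuous f -> measurable_fun setT a -> measurable_fun setT b ->
  measurable_fun setT (fun x => f (a x, b x)).
Proof.
move=> cf ma mb; apply: (@measurableT_comp _ _ _ _ _ _ f _ (fun x => (a x, b x))).
  apply: measurable_fun_open_mx => U oU; rewrite setTI.
  by apply: open_measurable_mx2; move: U oU; apply/continuousP.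
exact: measurable_fun_pair.
Qed.

Lemma measurable_funDv (a b : T -> Rd) : measurable_fun setT a ->
  measurable_fun setT b -> measurable_fun setT (fun x => a x + b x).
Proof.
apply: (continuous_measurable_pair (f := fun p => p.1 + p.2)).
exact: add_continuous.
Qed.

Lemma measurable_funBv (a b : T -> Rd) : measurable_fun setT a ->
  measurable_fun setT b -> measurable_fun setT (fun x => a x - b x).
Proof.
apply: (continuous_measurable_pair (f := fun p => p.1 - p.2)).
exact: sub_continuous.
Qed.

Lemma measurable_enorm_sqr (a : T -> Rd) : measurable_fun setT a ->
  measurable_fun setT (fun x => (enorm (a x) ^+ 2)%:E).
Proof.
move=> ma; apply/measurable_EFinP; apply: measurable_funX.
apply: (@measurableT_comp _ _ _ _ _ _ (@enorm R d)) => //.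
by apply: continuous_measurable_mx; exact: continuous_enorm.
Qed.

Lemma measurable_neqv (a b : T -> Rd) : measurable_fun setT a ->
  measurable_fun setT b -> measurable [set x | a x <> b x].
Proof.
move=> ma mb; have := measurable_funBv ma mb.
move=> /(_ measurableT (~` [set 0])); rewrite setTI.
have -> : (fun x => a x - b x) @^-1` (~` [set 0]) = [set x | a x <> b x].
  apply/seteqP; split=> x /= h e; apply: h; first by rewrite e subrr.
  by apply/subr0_eq.
apply; apply: open_measurable_mx; apply: closed_openC.
exact: (accessible_closed_set1 (hausdorff_accessible (@norm_hausdorff _ _))).
Qed.

End measurable_vectors.

Section velocity.
Context (R : realType) (d : nat).
Local Notation Rd := 'rV[R]_d.
Local Notation leb := (@lebesgue_measure R).

Definition velocity (S : set (Rd * Rd)) (t : R) (z : Rd) : Rd :=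
  (endpoints S t z).2 - (endpoints S t z).1.

Lemma velocity_interp (S : set (Rd * Rd)) (t : R) p : monotone_set S ->
  0 < t < 1 -> S p -> velocity S t (interp t p) = p.2 - p.1.
Proof. by move=> Smon t01 Sp; rewrite /velocity endpoints_interp. Qed.

Lemma measurable_velocity (S : set (Rd * Rd)) : monotone_set S -> closed S ->
  measurable_fun setT (fun q : measurableTypeR R * Rd => velocity S q.1 q.2).
Proof.
move=> Smon cS; apply: measurable_funBv.
  by apply: (measurable_endpoints Smon cS); exact: continuous_snd.
by apply: (measurable_endpoints Smon cS); exact: continuous_fst.
Qed.

Lemma measurable_interp (dT : measure_display) (T : measurableType dT)
    (f : T -> measurableTypeR R) (g : T -> Rd * Rd) :
  measurable_fun setT f -> measurable_fun setT g ->
  measurable_fun setT (fun x => interp (f x : R) (g x)).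
Proof.
move=> mf mg; apply: (@measurableT_comp _ _ _ _
  (measurableTypeR R * (Rd * Rd))%type _ (fun q => interp (q.1 : R) q.2) _ (fun x => (f x, g x))).
  apply: measurable_fun_open_mx => U oU; rewrite setTI.
  by apply: open_measurable_time2; move: U oU; apply/continuousP; exact: continuous_interp.
exact: measurable_fun_pair.
Qed.

Lemma measurable_interp_at (t : R) :
  measurable_fun setT (fun p : Rd * Rd => interp t p).
Proof.
by apply: (@measurable_interp _ _ (fun=> t) id) => //; exact: measurable_id.
Qed.

Lemma measurable_section (dX : measure_display) (X : measurableType dX)
    (dY : measure_display) (Y : measurableType dY)
    (F : measurableTypeR R * X -> Y) (t : R) :
  0 <= t <= 1 -> measurable_fun (`[0, 1]%classic `*` setT : set (measurableTypeR R * X)) F ->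
  measurable_fun setT (fun x => F (t, x)).
Proof.
move=> t01 mF; apply: (measurable_comp _ _ mF).
- by apply: measurableX => //; exact: measurable_itv.
- by move=> _ [x _ <-]; split=> //=; rewrite in_itv.
- by apply: measurable_fun_pair => //; exact: measurable_id.
Qed.

(* Fields are assumed Borel on [0,1] x R^d only; the cut-off is Borel everywhere. *)
Definition cutoff (v : R -> Rd -> Rd) (t : R) (z : Rd) : Rd :=
  if 0 <= t <= 1 then v t z else 0.

Lemma measurable_cutoff (v : R -> Rd -> Rd) :
  measurable_fun (`[0, 1]%classic `*` setT : set (measurableTypeR R * Rd))
    (fun q => v q.1 q.2) ->
  measurable_fun setT (fun q : measurableTypeR R * Rd => cutoff v q.1 q.2).
Proof.
move=> mv; apply: measurable_fun_open_mx => U oU; rewrite setTI.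
have mI : measurable (`[0, 1]%classic `*` setT : set (measurableTypeR R * Rd)).
  by apply: measurableX => //; exact: measurable_itv.
rewrite (_ : _ @^-1` U = (`[0, 1]%classic `*` setT : set (measurableTypeR R * Rd)) `&`
     (fun q => v q.1 q.2) @^-1` U
   `|` (if pselect (U 0) then ~` (`[0, 1]%classic `*` setT : set (measurableTypeR R * Rd)) else set0)).
  apply: measurableU.
    by apply: mv => //; exact: open_measurable_mx.
  by case: pselect => ? /=; [exact: measurableC|exact: measurable0].
apply/seteqP; split=> [[t z]|[t z] [[[/= t01 _]]|]] /=; rewrite /cutoff /preimage/=.
- case: ifPn => t01 Uv; first by left; split=> //; split=> //=; rewrite in_itv.
  right; case: pselect => //= _ [/=]; rewrite in_itv/= => h.
  by rewrite h in t01.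
- by move: t01; rewrite in_itv/= => ->.
- case: pselect => //= U0 nI; case: ifPn => // t01; exfalso; apply: nI.
  by split=> //=; rewrite in_itv.
Qed.

Lemma integral_itvcc01 (f : R -> \bar R) (c : \bar R) :
  (forall t, 0 < t < 1 -> f t = c) ->
  (\int[leb]_(t in `[0%R, 1%R]) f t = c)%E.
Proof.
move=> fc; have mc : measurable_fun (`]0, 1[%classic : set (measurableTypeR R)) f.
  apply: (eq_measurable_fun (cst c)); last exact: measurable_cst.
  by move=> t; rewrite inE/= in_itv/= => /fc ->.
rewrite integral_itv_bndoo// (eq_integral (cst c)); last first.
  by move=> t; rewrite inE/= in_itv/= => /fc ->.
rewrite integral_cst//=.
by rewrite lebesgue_measure_itv/= lte_fin ltr01 sube0 mule1.
Qed.

Lemma flow_loss_ge0 (gam : probability (Rd * Rd)%type R) (v : R -> Rd -> Rd) :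
  (0 <= flow_loss gam v)%E.
Proof.
apply: integral_ge0 => t _; apply: integral_ge0 => p _.
by rewrite lee_fin sqr_ge0.
Qed.

Section coupled.
Variables (gam : probability (Rd * Rd)%type R) (S : set (Rd * Rd)).
Hypotheses (Smon : monotone_set S) (cS : closed S) (mS : measurable S)
  (gS : gam (~` S) = 0%E).
Hypothesis gam2 :
  (\int[gam]_p (enorm p.1 ^+ 2 + enorm p.2 ^+ 2)%:E < +oo)%E.

Lemma kinetic_finite :
  (\int[gam]_p (enorm (p.2 - p.1) ^+ 2)%:E < +oo)%E.
Proof.
have m1 : measurable_fun setT (@fst Rd Rd) by exact: measurable_fst.
have m2 : measurable_fun setT (@snd Rd Rd) by exact: measurable_snd.
have msum : measurable_fun setT
    (fun p : Rd * Rd => (enorm p.1 ^+ 2 + enorm p.2 ^+ 2)%:E).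
  apply/measurable_EFinP; apply: measurable_funD; apply/measurable_EFinP;
    exact: measurable_enorm_sqr.
apply: (@le_lt_trans _ _
  (\int[gam]_p (2%:E * (enorm p.1 ^+ 2 + enorm p.2 ^+ 2)%:E))%E).
  apply: ge0_le_integral => //.
  - by move=> p _; rewrite lee_fin sqr_ge0.
  - by apply: measurable_enorm_sqr; exact: measurable_funBv.
  - by apply: measurable_funeM.
  - by move=> p _; rewrite -EFinM lee_fin [X in 2 * X]addrC enormB_sqr_le.
rewrite ge0_integralZl//; first by rewrite lte_mul_pinfty.
by move=> p _; rewrite lee_fin addr_ge0 ?sqr_ge0.
Qed.

(** Values off the trace are free, because at each time in ]0, 1[ the law of the interpolation does
    not charge the complement. The finite energy is the constant integral of |y - x|^2. Besides
    [velocity S], this serves for a field chosen to confine solutions. *)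
Lemma trace_field_velocity_field (v : R -> Rd -> Rd) :
  measurable_fun (`[0, 1]%classic `*` setT : set (measurableTypeR R * Rd))
    (fun q => v q.1 q.2) ->
  (forall t z, trace S (t, z) -> v t z = velocity S t z) ->
  velocity_field gam v /\ flow_loss gam v = 0%E.
Proof.
move=> mv vS.
have mvt t : 0 < t < 1 -> measurable_fun setT (v t).
  move=> /andP[t0 t1]; apply: (@measurable_section _ _ _ _ (fun q => v q.1 q.2)) => //.
  by rewrite !ltW.
have vint t p : 0 < t < 1 -> S p -> v t (interp t p) = p.2 - p.1.
  by move=> t01 Sp; rewrite vS ?velocity_interp//; exact: trace_interp.
have mvi t : 0 < t < 1 -> measurable_fun setT (fun p => v t (interp t p)).
  by move=> t01; apply: measurableT_comp; [exact: mvt|exact: measurable_interp_at].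
have m1 : measurable_fun setT (@fst Rd Rd) by exact: measurable_fst.
have m2 : measurable_fun setT (@snd Rd Rd) by exact: measurable_snd.
have loss0 : flow_loss gam v = 0%E.
  apply: integral_itvcc01 => t t01; rewrite -[RHS](integral0 gam setT).
  apply: ge0_ae_eq_integral => //.
  - apply: measurable_enorm_sqr; apply: measurable_funDv => //.
    by apply: measurable_funBv => //; exact: mvi.
  - by move=> p _; rewrite lee_fin sqr_ge0.
  exists (~` S); split=> //; first exact: measurableC.
  move=> p /= np Sp; apply: np => _.
  by rewrite vint// addrAC subrK subrr enorm0 expr0n.
split; last exact: loss0.
split; last by move=> w _; rewrite loss0; exact: flow_loss_ge0.
split; first exact: mv.
rewrite (@integral_itvcc01 _ (\int[gam]_p (enorm (p.2 - p.1) ^+ 2)%:E)%E).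
  exact: kinetic_finite.
move=> t t01; rewrite /interpolation ge0_integral_pushforward//; last 3 first.
- exact: measurable_interp_at.
- by apply: measurable_enorm_sqr; exact: mvt.
- by move=> x _; rewrite lee_fin sqr_ge0.
rewrite preimage_setT; apply: ge0_ae_eq_integral => //.
- by apply: measurable_enorm_sqr; exact: mvi.
- by apply: measurable_enorm_sqr; exact: measurable_funBv.
- by move=> p _; rewrite lee_fin sqr_ge0.
- by move=> p _; rewrite lee_fin sqr_ge0.
exists (~` S); split=> //; first exact: measurableC.
by move=> p /= np Sp; apply: np => _; rewrite vint.
Qed.

Lemma velocity_field_loss (v : R -> Rd -> Rd) : velocity_field gam v ->
  flow_loss gam v = 0%E.
Proof.
move=> [_ vmin]; have [|[adm _] loss0] := @trace_field_velocity_field (velocity S) _ (fun _ _ _ => erefl).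
  by apply: measurable_funTS; exact: measurable_velocity.
by apply/eqP; rewrite eq_le flow_loss_ge0 andbT -loss0; exact: vmin.
Qed.

(** A vanishing loss is a vanishing iterated integral of a nonnegative function; its inner integral
    vanishes for almost every time, and then the integrand almost everywhere. *)
Lemma velocity_field_ae (v : R -> Rd -> Rd) : velocity_field gam v ->
  {ae leb, forall t : measurableTypeR R, 0 < t < 1 ->
    gam [set p | cutoff v t (interp t p) <> p.2 - p.1] = 0%E}.
Proof.
move=> vv; have [[mv _] _] := vv; have mc := measurable_cutoff mv.
have m1 : measurable_fun setT (@fst Rd Rd) by exact: measurable_fst.
have m2 : measurable_fun setT (@snd Rd Rd) by exact: measurable_snd.
pose Phi (q : measurableTypeR R * (Rd * Rd)) : \bar R :=
  (enorm (cutoff v q.1 (interp (q.1 : R) q.2) - q.2.2 + q.2.1) ^+ 2)%:E.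
have mci : measurable_fun setT
    (fun q : measurableTypeR R * (Rd * Rd) => cutoff v q.1 (interp (q.1 : R) q.2)).
  apply: (@measurableT_comp _ _ _ _ _ _ (fun q : measurableTypeR R * Rd => cutoff v q.1 q.2)
    _ (fun q : measurableTypeR R * (Rd * Rd) => (q.1, interp (q.1 : R) q.2)) mc).
  apply: measurable_fun_pair; first exact: measurable_fst.
  by apply: measurable_interp; [exact: measurable_fst|exact: measurable_snd].
have mPhi : measurable_fun setT Phi.
  apply: measurable_enorm_sqr; apply: measurable_funDv; first apply: measurable_funBv => //.
    by apply: measurableT_comp => //; exact: measurable_snd.
  by apply: measurableT_comp => //; exact: measurable_snd.
have Phi0 q : (0 <= Phi q)%E by rewrite lee_fin sqr_ge0.
have mF := @measurable_fun_fubini_tonelli_F _ _ _ _ _ gam Phi mPhi Phi0.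
have : (\int[leb]_(t in `[0%R, 1%R]) `|fubini_F gam Phi t| = 0)%E.
  rewrite -(velocity_field_loss vv); apply: eq_integral => t.
  rewrite inE/= in_itv/= => t01; rewrite /fubini_F gee0_abs ?integral_ge0//.
  by apply: eq_integral => p _; rewrite /Phi /cutoff/= t01.
move=> /ae_eq_integral_abs; move=> /(_ (measurable_itv _)) /(_ (measurable_funTS mF)).
apply: filterS => t /= It0 /andP[t0 t1].
have : (\int[gam]_p `|Phi (t, p)| = 0)%E.
  rewrite -[RHS]It0 ?in_itv/= ?ltW//; apply: eq_integral => p _.
  by rewrite ger0_norm ?sqr_ge0.
have mPhit : measurable_fun setT (fun p => Phi (t, p)).
  by apply: measurableT_comp => //; apply: measurable_fun_pair => //; exact: measurable_id.
move=> /(ae_eq_integral_abs _ measurableT mPhit)[N [mN N0 NP]].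
apply/eqP; rewrite -measure_le0 -N0; apply: le_measure; rewrite ?inE//.
  apply: measurable_neqv; last exact: measurable_funBv.
  apply: (@measurableT_comp _ _ _ _ _ _ _ _ (fun p : Rd * Rd => (t, p)) mci).
  by apply: measurable_fun_pair => //; exact: measurable_id.
move=> p /= ne; apply: NP => /= h; apply: ne.
have : enorm (cutoff v t (interp t p) - p.2 + p.1) ^+ 2 = 0 by have [] := h I.
move=> /eqP; rewrite sqrf_eq0 => /eqP/enorm_eq0.
by move=> e; apply/subr0_eq; rewrite -e opprB addrA addrAC.
Qed.

End coupled.
End velocity.

(** * Laws of curves *)

Section interpolation_law.
Context (R : realType).

Definition law (dT dU : measure_display) (T : measurableType dT)
    (U : measurableType dU) (P : probability T R) (f : T -> U)
    (mf : measurable_fun setT f) : probability U R :=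
  distribution P (HB.pack_for {mfun T >-> U} f (isMeasurableFun.Build _ _ _ _ f mf)).

Lemma bounded_measurable_integrable (dT : measure_display) (T : measurableType dT)
    (P : probability T R) (f : T -> R) (M : R) : measurable_fun setT f ->
  (forall x, `|f x| <= M) -> P.-integrable setT (EFin \o f).
Proof.
move=> mf fM; apply: (@le_integrable _ _ _ P setT measurableT _ (EFin \o cst M)).
- exact/measurable_EFinP.
- move=> x _ /=; rewrite lee_fin [leRHS]ger0_norm ?fM//.
  exact: le_trans (fM x).
- exact: finite_measure_integrable_cst.
Qed.

Lemma compactly_supported_bounded (V : normedModType R) (f : V -> R) :
  continuous f -> compactly_supported f -> exists M, forall x, `|f x| <= M.
Proof.
move=> cf /compact_supports[K cK fK].
have /compact_bounded[M [_ Mf]] : compact (f @` K).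
  by apply: continuous_compact => //; exact: continuous_subspaceT.
exists (`|M| + 1) => x; have [->|/fK Kx] := eqVneq (f x) 0.
  by rewrite normr0 addr_ge0.
apply: Mf; last by exists x.
by apply: le_lt_trans (ler_norm _) _; rewrite ltrDl.
Qed.

End interpolation_law.

Section trace_closed.
Context (R : realType) (d : nat).
Local Notation Rd := 'rV[R]_d.

(* Locally in time, the endpoints of nearby points of the trace stay in a
   compact set. *)
Lemma trace_closure (S : set (Rd * Rd)) (t : R) (z : Rd) : monotone_set S ->
  closed S -> 0 < t < 1 ->
  (forall e : R, 0 < e -> exists s x, [/\ `|s - t| < e, `|x - z| < e & trace S (s, x)]) ->
  trace S (t, z).
Proof.
move=> Smon cS /andP[t0 t1] near_trace.
have [s0 [x0 [_ _ [_ [p0 Sp0 _]]]]] := near_trace 1 ltr01.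
pose h := Num.min (t / 2) ((1 - t) / 2).
have h0 : 0 < h by rewrite lt_min !divr_gt0 ?subr_gt0.
have ht : h <= t / 2 by rewrite ge_min lexx.
have ht1 : h <= (1 - t) / 2 by rewrite ge_min lexx orbT.
pose a := t - h; pose b := t + h.
have a0 : 0 < a by rewrite /a; lra.
have b1 : b < 1 by rewrite /b; lra.
(* [L] bounds the distance from a point within 1 of [z] to the interpolation of the reference pair
   [p0]; the Lipschitz inverse turns it into the bound [M] on all pairs that interpolate to such
   points. *)
pose L := `|z| + 1 + (`|p0.1| + `|p0.2|).
pose M := `|p0| + ((1 - b)^-1 + a^-1) * (Num.sqrt d%:R * L).
have bound s x p : a <= s <= b -> `|x - z| < 1 -> S p -> interp s p = x -> `|p| <= M.
  move=> /andP[as_ sb] xz Sp px.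
  have s01 : 0 < s < 1 by rewrite (lt_le_trans a0)// (le_lt_trans sb).
  have /andP[sp0 sp1] := s01.
  have xL : enorm (interp s p - interp s p0) <= Num.sqrt d%:R * L.
    apply: le_trans (enorm_le_normr _) _; rewrite ler_wpM2l ?sqrtr_ge0//.
    apply: le_trans (ler_normB _ _) _; apply: lerD.
      rewrite px -(subrK z x); apply: le_trans (ler_normD _ _) _.
      by rewrite addrC lerD2l ltW.
    apply: le_trans (ler_normD _ _) _; rewrite !normrZ.
    rewrite ger0_norm ?subr_ge0 ?(ltW sp1)// ger0_norm ?(ltW sp0)//.
    apply: lerD; rewrite ler_piMl//; first by lra.
    exact: ltW.
  have D0 : 0 <= Num.sqrt d%:R * L.
    by rewrite mulr_ge0 ?sqrtr_ge0// !addr_ge0.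
  have e1 : enorm (p.1 - p0.1) <= ((1 - b)^-1 + a^-1) * (Num.sqrt d%:R * L).
    apply: le_trans (interp_fst_le Smon s01 Sp Sp0) _.
    apply: le_trans (ler_wpM2l _ xL) _; first by rewrite invr_ge0; lra.
    rewrite ler_wpM2r// -[leLHS]addr0 lerD ?invr_ge0 ?(ltW a0)//.
    by rewrite lef_pV2 ?posrE ?subr_gt0// lerD2l lerN2.
  have e2 : enorm (p.2 - p0.2) <= ((1 - b)^-1 + a^-1) * (Num.sqrt d%:R * L).
    apply: le_trans (interp_snd_le Smon s01 Sp Sp0) _.
    apply: le_trans (ler_wpM2l _ xL) _; first by rewrite invr_ge0 ltW.
    rewrite ler_wpM2r// -[leLHS]add0r lerD ?invr_ge0 ?subr_ge0 ?(ltW b1)//.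
    by rewrite lef_pV2 ?posrE.
  rewrite -[p](subrK p0); apply: le_trans (ler_normD _ _) _.
  rewrite addrC /M lerD2l ge_max; apply/andP; split.
    exact: le_trans (normr_le_enorm _) e1.
  exact: le_trans (normr_le_enorm _) e2.
pose K := S `&` (closed_ball (0 : Rd) (M + 1) `*` closed_ball (0 : Rd) (M + 1)).
have M0 : 0 < M + 1.
  have c0 : 0 <= (1 - b)^-1 + a^-1.
    apply: addr_ge0; rewrite invr_ge0; last exact: (ltW a0).
    by rewrite subr_ge0; exact: (ltW b1).
  have L0 : 0 <= L by rewrite !addr_ge0.
  by rewrite ltr_wpDl// addr_ge0// mulr_ge0// mulr_ge0// sqrtr_ge0.
have cB : compact (closed_ball (0 : Rd) (M + 1)).
  apply: bounded_closed_compact; last exact: closed_ball_closed.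
  exists (M + 1); split; first exact: num_real.
  move=> y ny x; rewrite closed_ballE//= /closed_ball_/= sub0r normrN => xn.
  exact: le_trans (ltW ny).
have cK : compact K by rewrite /K setIC; apply: compact_closedI => //; exact: compact_setX.
pose F (q : R * (Rd * Rd)) := (q.1, interp q.1 q.2).
have cF : continuous F.
  by move=> q; exact: (cvg_pair (@continuous_fst _ _ q) (@continuous_interp _ _ q)).
have cA : closed (F @` (`[a, b]%classic `*` K)).
  apply: compact_closed; first exact: norm_hausdorff.
  apply: continuous_compact; first exact: continuous_subspaceT.
  by apply: compact_setX => //; exact: segment_compact.
have : closure (F @` (`[a, b]%classic `*` K)) (t, z).
  move=> N /nbhs_ballP[e /= e0 eN].
  pose e' := Num.min e (Num.min 1 h).
  have e'0 : 0 < e' by rewrite lt_min e0 lt_min ltr01 h0.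
  have e'e : e' <= e by rewrite ge_min lexx.
  have e'1 : e' <= 1 by rewrite 2!ge_min lexx orbT.
  have e'h : e' <= h by rewrite 2!ge_min lexx !orbT.
  have [s [x [st xz [/= s01 [p Sp px]]]]] := near_trace e' e'0.
  have se := lt_le_trans st e'e; have sh := lt_le_trans st e'h.
  have xe := lt_le_trans xz e'e; have x1 := lt_le_trans xz e'1.
  have sab : a <= s <= b.
    by move: sh; rewrite ltr_norml /a /b => /andP[? ?]; apply/andP; split; lra.
  have pM := bound s x p sab x1 Sp px.
  exists (s, x); split; last first.
    by apply: eN; split; rewrite -ball_normE/= distrC.
  exists (s, p); last by rewrite /F /= px.
  split=> /=; first by rewrite in_itv.
  split=> //; have : `|p| <= M + 1 by apply: le_trans pM _; rewrite lerDl.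
  rewrite ge_max => /andP[p1 p2].
  by split=> /=; rewrite closed_ballE//= /closed_ball_/= sub0r normrN.
rewrite -((closure_id _).1 cA) => -[[s p] [/= _ [Sp _]] [-> <-]].
by split => /=; [rewrite t0|exists p].
Qed.

End trace_closed.

Section curve_laws.
Context (R : realType) (d : nat).
Local Notation Rd := 'rV[R]_d.
Local Notation leb := (@lebesgue_measure R).
Variables (gam : probability (Rd * Rd)%type R) (S : set (Rd * Rd)).
Hypotheses (Smon : monotone_set S) (cS : closed S) (mS : measurable S)
  (gS : gam (~` S) = 0%E).
Hypothesis gam2 :
  (\int[gam]_p (enorm p.1 ^+ 2 + enorm p.2 ^+ 2)%:E < +oo)%E.

(** At almost every fixed time the offending curves are null, since the law of the position is that
    of the interpolation under [gam]. Measurability of [E] in time and curve jointly allows the two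
    quantifiers to be exchanged. *)
Lemma curve_law_ae (Lam : probability (curve_space R d) R) (v : R -> Rd -> Rd) :
  velocity_field gam v ->
  (forall t : R, 0 < t < 1 -> forall A : set Rd, measurable A ->
     Lam [set l | A (at_time l t)] = gam [set p | A (interp t p)]) ->
  {ae Lam, forall l : curve_space R d,
    {ae leb, forall t : measurableTypeR R, 0 < t < 1 ->
      trace S (t : R, at_time l t) /\
      v t (at_time l t) = velocity S t (at_time l t)}}.
Proof.
move=> vv lawt; have [[mv _] _] := vv; have mc := measurable_cutoff mv.
pose B : set (measurableTypeR R * Rd) :=
  (`]0, 1[%classic `*` setT) `&` (~` trace S `|`
    [set q | cutoff v q.1 q.2 <> velocity S q.1 q.2]).
have mB : measurable B.
  apply: measurableI; first by apply: measurableX => //; exact: measurable_itv.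
  apply: measurableU; first by apply: measurableC; exact: trace_measurable.
  by apply: measurable_neqv => //; exact: measurable_velocity.
pose E : set (measurableTypeR R * curve_space R d) :=
  (fun q => (q.1, at_time q.2 q.1)) @^-1` B.
have mE : measurable E.
  have mf : measurable_fun setT
      (fun q : measurableTypeR R * curve_space R d => (q.1, at_time q.2 q.1)).
    apply: measurable_fun_pair; first exact: measurable_fst.
    exact: measurable_evaluation.
  by rewrite -[E]setTI; exact: (mf measurableT B mB).
have Et0 : {ae leb, forall t : measurableTypeR R, Lam (xsection E t) = 0%E}.
  apply: filterS (velocity_field_ae Smon cS mS gS gam2 vv) => t /= vt0.
  have [t01|nt] := boolP (0 < t < 1); last first.
    rewrite (_ : xsection E t = set0) ?measure0//; apply/seteqP; split=> // l.
    by rewrite xsectionE => -[[/=]]; rewrite in_itv/= (negbTE nt).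
  have mBt : measurable (xsection B t) by exact: measurable_xsection.
  have -> : xsection E t = [set l | (xsection B t) (at_time l t)].
    by rewrite !xsectionE.
  rewrite lawt//; apply/eqP; rewrite -measure_le0.
  pose N := [set p : Rd * Rd | cutoff v t (interp t p) <> p.2 - p.1].
  have mN : measurable N.
    apply: measurable_neqv; last first.
      by apply: measurable_funBv; [exact: measurable_snd|exact: measurable_fst].
    apply: (@measurableT_comp _ _ _ _ _ _ _ _
      (fun p : Rd * Rd => (t : measurableTypeR R, interp t p)) mc).
    by apply: measurable_fun_pair => //; exact: measurable_interp_at.
  apply: (@le_trans _ _ (gam (~` S `|` N))).
    apply: le_measure; rewrite ?inE.
    - rewrite -[X in measurable X]setTI; apply: (measurable_interp_at t) => //.
    - by apply: measurableU => //; exact: measurableC.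
    move=> p; rewrite /= xsectionE => -[_ /= h].
    have [Sp|nSp] := pselect (S p); last by left.
    right=> /= vp; case: h; first by apply; exact: trace_interp.
    by apply; rewrite vp velocity_interp.
  apply: le_trans (measureU2 _ (measurableC mS) mN) _.
  have gN : gam N = 0%E := vt0 t01.
  by rewrite /= gS gN adde0.
have EL : (leb \x^ Lam)%E E = 0%E.
  rewrite -(@product_measure_unique _ _ _ _ _ leb Lam (leb \x^ Lam)%E)//; last first.
    by move=> A1 A2 mA1 mA2; exact: product_measure2E.
  rewrite /product_measure1 -[RHS](integral0 leb setT).
  apply: ge0_ae_eq_integral => //; first exact: measurable_fun_xsection.
  by apply: filterS Et0 => t /= Et _.
have mEy : measurable_fun setT (fun l => leb (ysection E l)).
  exact: measurable_fun_ysection.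
have : (\int[Lam]_l `|leb (ysection E l)| = 0)%E.
  by rewrite -[RHS]EL; apply: eq_integral => l _; rewrite gee0_abs.
move=> /(ae_eq_integral_abs _ measurableT mEy); apply: filterS => l /= /(_ I) El0.
exists (ysection E l); split=> //; first exact: measurable_ysection.
move=> t /= h; rewrite ysectionE; apply: contrapT => nE; apply: h => t01.
have [tr|ntr] := pselect (trace S (t : R, at_time l t)); last first.
  by exfalso; apply: nE; split; [split|left] => //=; rewrite in_itv.
split=> //; apply: contrapT => nv; apply: nE; split; first by split=> //=; rewrite in_itv.
right=> /=; rewrite /cutoff !ltW//; by case/andP: t01.
Qed.

Lemma dense_of_ae (P : R -> Prop) (a b : R) : a < b ->
  {ae leb, forall t : measurableTypeR R, a < t < b -> P t} ->
  exists2 t, a < t < b & P t.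
Proof.
move=> ab [N [mN N0 NP]]; apply: contrapT => h.
have : (leb `]a, b[ <= leb N)%E.
  apply: le_measure; rewrite ?inE//.
  move=> t /=; rewrite in_itv/= => tab; apply: NP => /= Pt; apply: h.
  by exists t => //; exact: Pt.
rewrite [X in (_ <= X)%E]N0 /= lebesgue_measure_itv/= lte_fin ab -EFinB lee_fin.
by rewrite subr_le0 leNgt ab.
Qed.

(** A dense set of times suffices, by continuity of the curve and [trace_closure]. *)
Lemma trace_curve (l : curve R d) :
  (forall a b : R, 0 < a -> a < b -> b < 1 ->
    exists2 t, a < t < b & trace S (t, at_time l t)) ->
  forall t, 0 < t < 1 -> trace S (t, at_time l t).
Proof.
move=> dl t t01; apply: trace_closure => // e e0.
have /andP[t0 t1] := t01.
have /subspace_continuousP/(_ t) := @within_continuous_at_time _ _ l.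
rewrite /unit_itv/= in_itv/= => /(_ (introT andP (conj (ltW t0) (ltW t1)))).
move=> /cvgrPdist_lt/(_ e e0); rewrite near_withinE => /nbhs_ballP[r /= r0 rP].
pose h := Num.min (Num.min e r) (Num.min t (1 - t)) / 2.
have m0 : 0 < Num.min (Num.min e r) (Num.min t (1 - t)).
  by rewrite !lt_min e0 r0 t0 subr_gt0 t1.
have h0 : 0 < h by rewrite divr_gt0.
have [he hr ht ht1] : [/\ h < e, h < r, h < t & h < 1 - t].
  have : h < Num.min (Num.min e r) (Num.min t (1 - t)).
    by rewrite /h ltr_pdivrMr// ltr_pMr// ltr1n.
  by rewrite !lt_min => /andP[/andP[? ?] /andP[? ?]].
have [||| s /andP[s1 s2] tr] := dl (t - h) (t + h); [lra|lra|lra|].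
have st : `|s - t| < h by rewrite ltr_norml; apply/andP; split; lra.
exists s, (at_time l s); split=> //; first exact: lt_trans he.
rewrite distrC; apply: rP; first by rewrite /ball/= distrC; exact: lt_trans hr.
by rewrite in_itv/=; apply/andP; split; lra.
Qed.

End curve_laws.

(** * Weak rectified couplings and rectifiability *)

Section weak_rectification.
Context (R : realType) (d : nat).
Local Notation Rd := 'rV[R]_d.
Local Notation leb := (@lebesgue_measure R).
Variables (gam : probability (Rd * Rd)%type R) (S : set (Rd * Rd)).
Hypotheses (Smon : monotone_set S) (cS : closed S) (mS : measurable S)
  (gS : gam (~` S) = 0%E).
Hypothesis gam2 :
  (\int[gam]_p (enorm p.1 ^+ 2 + enorm p.2 ^+ 2)%:E < +oo)%E.
Variable v : R -> Rd -> Rd.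
Hypothesis vv : velocity_field gam v.

Let half01 : 0 < (2^-1 : R) < 1.
Proof. by rewrite invr_gt0 ltr0n invf_lt1// ltr1n. Qed.

Lemma itv01_int (t : R) : 0 < t < 1 -> 0 <= t <= 1.
Proof. by move=> /andP[t0 t1]; rewrite !ltW. Qed.

Lemma ae_itvoo : {ae leb, forall t : measurableTypeR R, 0 <= t <= 1 -> 0 < t < 1}.
Proof.
exists [set 0; 1]; split; first by apply: measurableU; exact: measurable_set1.
  apply/eqP; rewrite -measure_le0; apply: le_trans (measureU2 _ _ _) _ => //.
  by rewrite /= !lebesgue_measure_set1 adde0.
move=> t /= h; apply: contrapT => n; apply: h => /andP[t0 t1].
rewrite !lt_neqAle t0 t1 !andbT eq_sym.
by apply/andP; split; apply/eqP => E; apply: n; [left|right].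
Qed.

Lemma curve_straight (l : curve R d) (w : R -> Rd -> Rd) : abs_continuous l ->
  satisfies_ode w l ->
  {ae leb, forall t : measurableTypeR R, 0 < t < 1 -> trace S (t : R, at_time l t) /\
     w t (at_time l t) = velocity S t (at_time l t)} ->
  exists2 q, S q & l = line q.
Proof.
move=> acl ode aeS; have [||q Sq lq] := @straight_line R d S l Smon acl.
- apply: trace_curve => // a b a0 ab b1; apply: dense_of_ae => //.
  apply: filterS aeS => t /= h /andP[at_ tb].
  by case: h => //; rewrite (lt_trans a0)// (lt_trans tb).
- have ode' : {ae leb, forall t : measurableTypeR R, 0 <= t <= 1 ->
    is_derive (t : R) (1 : R) (at_time l) (w t (at_time l t))} := ode.
  have ode2 : {ae leb, forall t : measurableTypeR R, 0 < t < 1 ->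
      is_derive (t : R) (1 : R) (at_time l) (velocity S t (at_time l t))}.
    apply: filterS2 ode' aeS => t /= dt ht t01; have [_ wt] := ht t01.
    by have := dt (itv01_int t01); rewrite wt.
  exact: ode2.
by exists q => //; apply: curve_ext => t t01; rewrite lq// at_time_line.
Qed.

Lemma weak_rectified_unique (gam' : probability (Rd * Rd)%type R) :
  weak_rectified_coupling gam v gam' -> forall A, measurable A -> gam' A = gam A.
Proof.
move=> [Lam [acL [odeL bL cL]]].
have mat t := @measurable_at_time R d t.
have lawt t : 0 < t < 1 -> forall A : set Rd, measurable A ->
    law Lam (mat t) A = law gam (measurable_interp_at t) A.
  move=> t01; apply: bump_determines_mx => f [sf cf f01].
  have mf : measurable_fun setT f.
    by apply: continuous_measurable_mx; exact: smooth_continuous.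
  rewrite [LHS]ge0_integral_pushforward//; last 2 first.
  - by apply/measurable_EFinP.
  - by move=> x _; rewrite lee_fin; case/andP: (f01 x).
  rewrite preimage_setT; apply: esym; apply: bL => //.
    exact: smooth_continuous.
  exact: itv01_int.
have aeS := curve_law_ae Smon cS mS gS gam2 vv lawt.
have str : {ae Lam, forall l : curve_space R d, exists2 q, S q & l = line q}.
  have FF : Filter (almost_everywhere Lam) by exact: ae_filter_ringOfSetsType.
  apply: (@filterS3 _ (nbhs (almost_everywhere Lam)) _ _ _ _ _ _ acL odeL aeS) => l /= acl odel aesl.
  exact: curve_straight odel aesl.
apply: bump_determines_mx2 => psi [spsi cpsi psi01].
have psi0 p : 0 <= psi p by case/andP: (psi01 p).
have mpsi : measurable_fun setT psi.
  by apply: continuous_measurable_mx2; exact: smooth_continuous.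
(* The test function is rewritten in terms of the position at time 1/2 alone, whose law is the same
   under [Lam] and under [gam]. *)
pose Psi (z : Rd) := psi (endpoints S 2^-1 z).
have mep (f : Rd * Rd -> Rd) : continuous f ->
    measurable_fun setT (fun z => f (endpoints S (2^-1 : R) z)).
  move=> cf; apply: (@measurableT_comp _ _ _ _ _ _ _ _
    (fun z : Rd => ((2^-1 : R) : measurableTypeR R, z)) (measurable_endpoints Smon cS cf)).
  by apply: measurable_fun_pair; [exact: measurable_cst|exact: measurable_id].
have mPsi : measurable_fun setT Psi.
  apply: (@measurableT_comp _ _ _ _ _ _ psi _ (endpoints S 2^-1)) => //.
  apply/measurable_fun_pairP; split; apply: mep.
    exact: continuous_fst.
  exact: continuous_snd.
rewrite cL//.
transitivity (\int[Lam]_l (Psi (at_time l (2^-1)%R))%:E)%E.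
  apply: ge0_ae_eq_integral => //.
  - apply/measurable_EFinP; apply: (@measurableT_comp _ _ _ _ _ _ psi _
      (fun l : curve_space R d => (at_time l 0, at_time l 1))) => //.
    by apply: measurable_fun_pair; exact: mat.
  - by apply/measurable_EFinP; apply: measurableT_comp => //; exact: mat.
  - by move=> l _; rewrite lee_fin.
  - by move=> l _; rewrite lee_fin; exact: psi0.
  apply: filterS str => l /= [q Sq ->] _.
  rewrite !at_time_line ?lexx ?ler01 ?itv01_int//.
  by rewrite /Psi endpoints_interp// interp0 interp1 -surjective_pairing.
transitivity (\int[law Lam (mat (2^-1)%R)]_z (Psi z)%:E)%E.
  rewrite [RHS]ge0_integral_pushforward//; first exact/measurable_EFinP.
  by move=> z _; rewrite lee_fin; exact: psi0.
rewrite (eq_measure_integral (law gam (measurable_interp_at 2^-1))); last first.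
  by move=> A mA _; exact: lawt.
rewrite [LHS]ge0_integral_pushforward//; last 2 first.
- exact/measurable_EFinP.
- by move=> z _; rewrite lee_fin; exact: psi0.
rewrite preimage_setT; apply: ge0_ae_eq_integral => //.
- apply/measurable_EFinP.
  by apply: (measurableT_comp mPsi); exact: measurable_interp_at.
- exact/measurable_EFinP.
- by move=> z _; rewrite lee_fin; exact: psi0.
- by move=> z _; rewrite lee_fin; exact: psi0.
exists (~` S); split=> //; first exact: measurableC.
by move=> p /= np Sp; apply: np => _; rewrite /Psi endpoints_interp.
Qed.

(** The witness is the law under [gam] of the segment joining the two points. *)
Lemma weak_rectified_self (gam' : probability (Rd * Rd)%type R) :
  (forall A, measurable A -> gam' A = gam A) -> weak_rectified_coupling gam v gam'.
Proof.
move=> gg; pose Lam := law gam (@measurable_line R d).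
have mat t := @measurable_at_time R d t.
have lawt t : 0 < t < 1 -> forall A : set Rd, measurable A ->
    Lam [set l | A (at_time l t)] = gam [set p | A (interp t p)].
  move=> t01 A mA; rewrite /Lam /law /distribution /pushforward /=.
  congr (gam _); apply/seteqP; split=> p; rewrite /preimage/= at_time_line//;
    exact: itv01_int.
have aeS := curve_law_ae Smon cS mS gS gam2 vv lawt.
have ends : measurable_fun setT
    (fun l : curve_space R d => (at_time l 0, at_time l 1)).
  by apply: measurable_fun_pair; exact: mat.
have aeL : {ae Lam, forall l : curve_space R d, exists2 q, S q & l = line q}.
  (* The image of [S] under [line], written as an intersection whose measurability is known: a
     segment is recovered from its values at times 0 and 1. *)
  pose G : set (curve_space R d) := range (@line R d) `&`
    (fun l => (at_time l 0, at_time l 1)) @^-1` S.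
  have mG : measurable G.
    apply: measurableI; first exact: measurable_line_range.
    by rewrite -[X in measurable X]setTI; exact: ends.
  exists (~` G); split; first exact: measurableC.
    rewrite /Lam /law /distribution /pushforward /= -gS; congr (gam _).
    apply/seteqP; split=> p; rewrite /preimage/= => h Sp; apply: h.
      split; first by exists p.
      by rewrite /= !at_time_line ?lexx ?ler01// interp0 interp1 -surjective_pairing.
    case: Sp => _ /=.
    by rewrite !at_time_line ?lexx ?ler01// interp0 interp1 -surjective_pairing.
  move=> l /= h [[q _ ql]]; rewrite /preimage/= -ql => Sq; apply: h; exists q => //.
  by move: Sq; rewrite !at_time_line ?lexx ?ler01// interp0 interp1 -surjective_pairing.
exists Lam; split; first by apply: filterS aeL => l [q _ ->]; exact: abs_continuous_line.
split.
- apply: filterS2 aeL aeS => l /= [q Sq ->].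
  apply: filterS2 ae_itvoo => t /= t01 h /t01{}t01; have [_ ->] := h t01.
  by rewrite at_time_line ?itv01_int// velocity_interp//; exact: is_derive_line.
- move=> psi cpsi supp t t01.
  have [M psiM] := compactly_supported_bounded cpsi supp.
  have mpsi : measurable_fun setT psi by exact: continuous_measurable_mx.
  rewrite /interpolation integral_pushforward//; last 3 first.
  + exact: measurable_interp_at.
  + exact/measurable_EFinP.
  + apply: (@bounded_measurable_integrable _ _ _ _ _ M) => //.
    by apply: measurableT_comp => //; exact: measurable_interp_at.
  rewrite [RHS]integral_pushforward//; last 2 first.
  + by apply/measurable_EFinP; apply: measurableT_comp => //; exact: mat.
  + apply: (@bounded_measurable_integrable _ _ _ _ _ M) => //.
    apply: (measurableT_comp mpsi).
    by apply: (measurableT_comp (mat t)); exact: measurable_line.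
  rewrite !preimage_setT; apply: eq_integral => p _ /=.
  by rewrite at_time_line.
- move=> psi spsi supp.
  have cpsi := smooth_continuous spsi.
  have [M psiM] := compactly_supported_bounded cpsi supp.
  have mpsi : measurable_fun setT psi by exact: continuous_measurable_mx2.
  rewrite (eq_measure_integral gam); last by move=> A mA _; exact: gg.
  rewrite [RHS]integral_pushforward//; last 2 first.
  + by apply/measurable_EFinP; exact: (measurableT_comp mpsi ends).
  + apply: (@bounded_measurable_integrable _ _ _ _ _ M) => //.
    apply: (measurableT_comp mpsi).
    by apply: (measurableT_comp ends); exact: measurable_line.
  rewrite preimage_setT; apply: eq_integral => p _ /=.
  by rewrite !at_time_line ?lexx ?ler01// interp0 interp1 -surjective_pairing.
Qed.

(* Off the trace the field is a spike, which no absolutely continuous curve can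
   follow, so that solutions are confined to the trace. *)
Definition confining_field (t : R) (z : Rd) : Rd :=
  if pselect (trace S (t, z)) then velocity S t z else const_mx (spike t).

Lemma confining_field_trace (t : R) (z : Rd) : trace S (t, z) ->
  confining_field t z = velocity S t z.
Proof. by move=> tr; rewrite /confining_field; case: pselect. Qed.

Lemma measurable_confining_field : measurable_fun setT
  (fun q : measurableTypeR R * Rd => confining_field q.1 q.2).
Proof.
apply: measurable_fun_open_mx => U oU; rewrite setTI.
have mU : measurable U by exact: open_measurable_mx.
have mG := trace_measurable Smon cS.
have msp : measurable_fun setT
    (fun q : measurableTypeR R * Rd => const_mx (spike q.1) : Rd).
  apply: (@measurableT_comp _ _ _ _ _ _ (fun t : measurableTypeR R => const_mx (spike t) : Rd)).
    apply: (@measurableT_comp _ _ _ _ _ _ (fun r : R => const_mx r : Rd)); last exact: measurable_spike.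
    apply: measurable_fun_open_mx => V oV; rewrite setTI.
    apply: measurable_realfun.open_measurable.
    apply: open_ball_sub => r Vr.
    have /nbhs_ballP[e /= e0 eV] : nbhs (const_mx r : Rd) V by exact: open_nbhs_nbhs.
    exists e => // s rs; apply: eV; split=> // i j; rewrite !mxE; exact: rs.
  exact: measurable_fst.
rewrite (_ : _ @^-1` U = (trace S `&` (fun q => velocity S q.1 q.2) @^-1` U) `|`
    (~` trace S `&` (fun q => const_mx (spike q.1)) @^-1` U)).
  apply: measurableU; apply: measurableI => //.
  - by rewrite -[X in measurable X]setTI; exact: (measurable_velocity Smon cS).
  - exact: measurableC.
  - by rewrite -[X in measurable X]setTI; exact: msp.
apply/seteqP; split=> [[t z]|[t z] [[]|[]]]; rewrite /preimage/= /confining_field.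
- by case: pselect => ? ?; [left|right].
- by move=> tr Uv; case: pselect.
- by move=> ntr Uv; case: pselect.
Qed.

(** If the curve avoided the trace during an interval of times, each of its coordinates would be a
    primitive of [spike] there. Hence it meets the trace at a dense set of times. *)
Lemma confined_trace (l : curve R d) : S !=set0 -> abs_continuous l ->
  satisfies_ode confining_field l -> forall t, 0 < t < 1 -> trace S (t, at_time l t).
Proof.
move=> [p0 Sp0] acl ode; apply: trace_curve => // a b a0 ab b1.
apply: contrapT => h.
have ntr t : a < t < b -> ~ trace S (t, at_time l t).
  by move=> tab tr; apply: h; exists t.
(* In dimension 0 there is no coordinate to carry the spike; but all points coincide, and
   nonemptiness of [S] puts the curve on the trace. *)
have [[i]|noi] := pselect (inhabited 'I_d); last first.
  have m01 : 0 < (a + b) / 2 < 1 by apply/andP; split; lra.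
  apply: (ntr ((a + b) / 2)); first by apply/andP; split; lra.
  rewrite (_ : at_time l _ = interp ((a + b) / 2) p0); first exact: trace_interp.
  by apply/rowP => i; case: noi; exists.
apply: (@spike_no_primitive R (fun t => at_time l t ord0 i) a b ab).
  move=> e e0; have [del del0 delP] := acl e e0; exists del => // n A B AB dis sAB.
  have AB01 k : 0 <= A k /\ A k <= B k /\ B k <= 1.
    by have [aA [AB_ Bb]] := AB k; split; [lra|split=> //; lra].
  apply: le_lt_trans (delP n A B AB01 dis sAB); apply: ler_sum => k _.
  by apply: le_trans (coord_le_enorm _ i); rewrite !mxE.
have ode' : {ae leb, forall t : measurableTypeR R, 0 <= t <= 1 ->
    is_derive (t : R) (1 : R) (at_time l) (confining_field t (at_time l t))} := ode.
apply: filterS ode' => t /= dt tab e e0; have /andP[at_ tb] := tab.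
have [|del del0 delP] := is_derive_approx (dt _) e0.
  by apply/andP; split; lra.
exists del => // s sdel; apply: le_trans (delP s sdel).
apply: le_trans (normr_coord_le _ i); rewrite /confining_field.
by case: pselect => [/(ntr _ tab)//|?]; rewrite !mxE.
Qed.

End weak_rectification.

(** The representative is [confining_field S]: any solution from [x] stays on the trace, is a
    segment with endpoints in [S], and the uniqueness of the partner of [x] fixes its other end. *)
Lemma monotone_rectifiable (R : realType) (d : nat)
    (mu0 : probability 'rV[R]_d R) (gam : probability ('rV[R]_d * 'rV[R]_d)%type R)
    (S : set ('rV[R]_d * 'rV[R]_d)) (D : set 'rV[R]_d) (u : 'rV[R]_d -> 'rV[R]_d) :
  monotone_set S -> closed S -> measurable S -> gam (~` S) = 0%E ->
  (\int[gam]_p (enorm p.1 ^+ 2 + enorm p.2 ^+ 2)%:E < +oo)%E ->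
  induced_by_map mu0 gam D u ->
  (forall x, D x -> S (x, u x) /\ forall y, S (x, y) -> y = u x) ->
  rectifiable mu0 gam.
Proof.
move=> Smon cS mS gS gam2 [mD D1 _ _] Du.
have [||vv _] := @trace_field_velocity_field _ _ gam S Smon mS gS gam2 (confining_field S).
- by apply: measurable_funTS; exact: measurable_confining_field.
- exact: confining_field_trace.
exists (confining_field S) => //.
exists (~` D); split; first exact: measurableC.
  by rewrite /= probability_setC// [X in (_ - X)%E]D1 subee.
move=> x /= nx Dx; apply: nx; have [Sx ux] := Du x Dx.
have lx t : 0 < t < 1 -> trace S (t, at_time (line (x, u x)) t).
  by move=> t01; rewrite at_time_line ?itv01_int//; exact: trace_interp.
have x0 : at_time (line (x, u x)) 0 = x by rewrite at_time_line ?lexx ?ler01// interp0.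
exists (line (x, u x)); split; first split=> //; first split.
- exact: abs_continuous_line.
- have ode : {ae @lebesgue_measure R, forall t : measurableTypeR R, 0 <= t <= 1 ->
    is_derive (t : R) (1 : R) (at_time (line (x, u x)))
      (confining_field S t (at_time (line (x, u x)) t))}.
    apply: filterS (ae_itvoo R) => t /= t01 /t01{}t01.
    rewrite confining_field_trace; last exact: lx.
    by rewrite at_time_line ?itv01_int// velocity_interp//; exact: is_derive_line.
  exact: ode.
move=> l [[acl odel] l0].
have [|q Sq lq] := curve_straight Smon cS acl odel.
  apply: aeW => t t01.
  have tr : trace S (t, at_time l t) by apply: confined_trace => //; exists (x, u x).
  by split=> //; exact: confining_field_trace.
move: l0; rewrite lq at_time_line ?lexx ?ler01// interp0 => q1.
rewrite {lq}(surjective_pairing q) q1 in Sq *.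
by rewrite (ux _ Sq).
Qed.

Theorem proposition10 (R : realType) (d N : nat)
  (mu0 mu1 : probability 'rV[R]_d R)
  (gam : probability ('rV[R]_d * 'rV[R]_d)%type R)
  (v : R -> 'rV[R]_d -> 'rV[R]_d)
  (hN : (2 <= N)%N) (hmu0 : in_P2 mu0) (hmu1 : in_P2 mu1)
  (hgam : coupling mu0 mu1 gam) (hmon : cyclically_monotone N gam)
  (hv : velocity_field gam v) :
  [/\ flow_loss gam v = 0%E,
      forall gam' : probability ('rV[R]_d * 'rV[R]_d)%type R,
        weak_rectified_coupling gam v gam' <->
        (forall A, measurable A -> gam' A = gam A)
    & mu0 `<< @lebesgue R d ->
        rectifiable mu0 gam /\
        exists (D : set 'rV[R]_d) (u : 'rV[R]_d -> 'rV[R]_d),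
          monotone_map D u /\ induced_by_map mu0 gam D u].
Proof.
have [gam2 marg0 _] := hgam.
have Smon := cyclically_monotone_set hN hmon.
have cS : closed (measure_support gam) := @closed_support R d gam.
have mS := support_measurable gam.
have gS := supportC_null gam.
split.
- exact: (velocity_field_loss Smon cS mS gS gam2 hv).
- move=> gam'; split; first exact: (weak_rectified_unique Smon cS mS gS gam2 hv).
  exact: (weak_rectified_self Smon cS mS gS gam2 hv).
move=> mu0ac.
have [D [u [Dind Du]]] := graph_of_monotone Smon cS (support_full gam) marg0 mu0ac.
split; first exact: (monotone_rectifiable Smon cS mS gS gam2 Dind Du).
exists D, u; split=> // x x' /Du[Sx _] /Du[Sx' _].
have := Smon _ _ Sx Sx' => /=; rewrite /dot.
by under eq_bigr do rewrite mulrC.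
Qed.
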